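(* Let $\mathcal H$ be an ordinary crystal of weight one over $S_0$, and write $\mathcal H=\mathcal U\oplus \mathrm{Fil}^1$, where $\mathcal U$ is the unit-root part of $\mathcal H$. Put $g=\operatorname{rank}_A\mathcal U$ and $h=\operatorname{rank}_A\mathrm{Fil}^1$. (i) There exist bases $a=\{a_j\}_{j=1}^g$ and $b=\{b_i\}_{i=1}^h$ of the $A$-modules $\mathcal U$ and $\mathrm{Fil}^1$, respectively, satisfying $$\nabla a_j=0\ (1\le j\le g),\qquad \nabla b_i=\sum_{j=1}^g\eta_{ij}\otimes a_j\ (1\le i\le h)$$ for some closed $\eta_{ij}\in\omega$, and, for every lifting $\phi$ of the Frobenius, $$\mathcal F(\phi)\phi^*a_j=a_j\ (1\le j\le g),\qquad \mathcal F(\phi)\phi^*b_i=p\,b_i+p\sum_{j=1}^g u_{ij}(\phi)a_j\ (1\le i\le h)$$ for some $u_{ij}(\phi)\in A$. Moreover $$\phi^*\eta_{ij}=p\,\eta_{ij}+p\,du_{ij}(\phi)\qquad\text{for each lifting }\phi .$$ (ii) With such a choice of $a,b$, there exists a unique collection of elements $\tau_{ij}=\tau_{ij}^{\log}+\tau_{ij}'$ ($1\le i\le h$, $1\le j\le g$) with $$(\tau_{ij}^{\log},\tau_{ij}')\in\Big(\bigoplus_{l=1}^r\mathbb Z_p\cdot\log t_l\Big)\oplus K[[t]]$$ such that for all $i,j$ and all liftings $\phi$ of the Frobenius $$\eta_{ij}=d\tau_{ij},\qquad \tau_{ij}'(0)\in pW,\qquad \phi^*\tau_{ij}-p\,\tau_{ij}-p\,u_{ij}(\phi)=0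 .$$ (iii) Suppose $p\ne2$. The power series $$q_{ij}'=\exp(\tau_{ij}')=\sum_{n\ge0}\frac{(\tau_{ij}')^n}{n!}\qquad(1\le i\le h,\ 1\le j\le g)$$ are well-defined elements of $A$ and satisfy $q_{ij}'(0)\equiv1\pmod{pW}$.
   Context: **Base.** $k$ is an algebraically closed field of characteristic $p>0$, $W$ its ring of Witt vectors, $K=\operatorname{Frac}W$, $\sigma$ the Frobenius on $k,W,K$. $\mathbb N$ contains $0$, and $0^0=1$. Fix integers $0\le r\le m$ and variables $t=(t_1,\dots,t_m)$. Let $A=W[[t]]$, $\mathcal L=\bigcup_{n\in\mathbb N^r}t^nA^\times\cong\mathbb N^r\oplus A^\times$ (a log structure via the inclusion $\mathcal L\subset A$), $S=(\operatorname{Spec}A,\mathcal L)$; $A_0=k[[t]]$, $\mathcal L_0$, $S_0$ are the reductions mod $p$. Put $t_i'=t_i$ for $i\le r$ and $t_i'=1+t_i$ for $i>r$. Let $\omega=\omega^1_{S/W}$ be the module of log differentials, free over $A$ with basis $d\log t_i'=dt_i'/t_i'$; the dual basis is $\theta_i=t_i'\,d/dt_i'$. A *lifting of the Frobenius* is a ($\sigma$-semilinear) endomorphism $\phi$ of $(A,\mathcal L)$ lifting the $p$-power map on $(A_0,\mathcal L_0)$; equivalently $\phi(t_i')=(t_i')^pf_i(\phi)$ with $f_i(\phi)\in1+pA$ for $1\le i\le m$. **Crystals over $S_0$.** A *crystal* $(\mathcal H,\nabla)$ over $S_0$ is a free $A$-module $\mathcal H$ of finite rank with an integrable connection $\nabla:\mathcal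 H\to\omega\otimes_A\mathcal H$ that is quasi-nilpotent: for each $i$, $\prod_{j=0}^{n-1}(\nabla(\theta_i)-j)\to0$ $p$-adically as $n\to\infty$. An *F-crystal* is a crystal with, for every lifting $\phi$ of the Frobenius, a horizontal $A$-linear map $\mathcal F(\phi):\phi^*\mathcal H=A\otimes_\phi\mathcal H\to\mathcal H$, an isomorphism after $\otimes_WK$; write $\phi^*x=1\otimes x$. These maps are compatible: for liftings $\phi_1,\phi_2$ with $\phi_1(t_i')=(t_i')^pf_i$, $\phi_2(t_i')=(t_i')^pg_i$ one has $\mathcal F(\phi_1)=\mathcal F(\phi_2)\circ\chi(\phi_1,\phi_2)$, where $\chi(\phi_1,\phi_2)\phi_1^*x=\sum_{n\in\mathbb N^m}\prod_i\frac{(f_i/g_i-1)^{n_i}}{n_i!}\,\phi_2^*\{\prod_i\prod_{j=0}^{n_i-1}(\nabla(\theta_i)-j)\,x\}$. A *unit-root F-crystal* is one for which $\mathcal F(\phi)$ is an isomorphism for some (equivalently all) $\phi$. A *Hodge F-crystal* is an F-crystal with a decreasing filtration $\mathrm{Fil}^i\subset\mathcal H$ ($i\in\mathbb N$) by free submodules with free quotients $\mathcal H/\mathrm{Fil}^i$, such that $\mathrm{Fil}^0=\mathcal H$, $\mathrm{Fil}^n=0$ for $n\gg0$, $\nabla\mathrm{Fil}^{i+1}\subset\omega\otimes\mathrm{Fil}^i$, and $\mathcal F(\phi)\phi^*\mathrm{Fil}^i\subset p^i\mathcal H$ for all $\phi,i$. Its *weight* is $\rho_1+\rho_2$, where $\rho_1=\max\{n:\mathrm{Fil}^n=\mathcal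 H\}$ and $\rho_2=\max\{n:\mathrm{Fil}^n\ne0\}$. **Ordinary crystals.** For a Hodge F-crystal $\mathcal H$, let $e_0^*\mathcal H=\mathcal H/(t_1,\dots,t_m)\mathcal H$ be its fibre at the origin, with the $\sigma$-linear Frobenius induced by $\mathcal F(\phi)\phi^*$ (for $\phi(t_i')=(t_i')^p$) and the induced filtration. $\mathcal H$ is *ordinary* if the Newton polygon of this Frobenius coincides with the Hodge polygon (slope $i$ with multiplicity $\operatorname{rank}\mathrm{Fil}^i/\mathrm{Fil}^{i+1}$). An ordinary crystal has a unique increasing filtration by sub-F-crystals $0\subset\mathcal U_0\subset\mathcal U_1\subset\cdots$ with $\mathcal U_i/\mathcal U_{i-1}$ (where $\mathcal U_{-1}=0$) of the form $\mathcal V_i(-i)$, $\mathcal V_i$ a unit-root F-crystal, and $\mathcal H=\mathcal U_i\oplus\mathrm{Fil}^{i+1}$ for all $i$; here $(-i)$ means the Frobenius is multiplied by $p^i$. In weight one, $\mathcal U=\mathcal U_0$ is the unit-root part. **Logarithms.** $\log t_l$ is a formal symbol with $d\log t_l=dt_l/t_l$ and $\phi^*\log t_l=p\log t_l+\log f_l(\phi)$, where $\log f_l(\phi)=-\sum_{n\ge1}(1-f_l(\phi))^n/n\in pA$. $\phi^*\tau'$ for $\tau'\in K[[t]]$ with $d\tau'\in\omega$ is $\sigma$ on coefficients followed by $p$-adically convergent substitution $t\mapsto\phi(t)$. $\tau'(0)$ denotes the constant term. *)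

(* Defs.v *)
From HB Require Import structures.
From mathcomp Require Import all_boot all_order all_algebra.
From mathcomp Require Import boolp classical_sets.
From mathcomp Require Import mpoly.

Set Implicit Arguments.
Unset Strict Implicit.
Unset Printing Implicit Defensive.

Import GRing.Theory.
Local Open Scope classical_set_scope.
Local Open Scope ring_scope.

Record mseries (m : nat) (R : Type) := MSeries { scoef :> 'X_{1..m} -> R }.

HB.instance Definition _ m R := gen_eqMixin (mseries m R).
HB.instance Definition _ m R := gen_choiceMixin (mseries m R).

Lemma mseriesP m R (f g : mseries m R) : (forall k, f k = g k) -> f = g.
Proof. by case: f g => f [g] /= /funext ->. Qed.

Section SeriesRing.
Variables (m : nat) (R : comNzRingType).
Implicit Types f g h : mseries m R.

Definition sadd f g : mseries m R := MSeries (fun k => f k + g k).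
Definition sopp f : mseries m R := MSeries (fun k => - f k).
Definition sconst (c : R) : mseries m R :=
  MSeries (fun k => if k == 0%MM then c else 0).
Definition smul f g : mseries m R := MSeries (fun k =>
  \sum_(l : 'X_{1..m < (mdeg k).+1, (mdeg k).+1} | k == (l.1 + l.2)%MM)
     f l.1 * g l.2).

Lemma saddA : associative sadd.
Proof. by move=> f g h; apply: mseriesP => k /=; rewrite addrA. Qed.
Lemma saddC : commutative sadd.
Proof. by move=> f g; apply: mseriesP => k /=; rewrite addrC. Qed.
Lemma sadd0 : left_id (sconst 0) sadd.
Proof. by move=> f; apply: mseriesP => k /=; rewrite if_same add0r. Qed.
Lemma saddN : left_inverse (sconst 0) sopp sadd.
Proof. by move=> f; apply: mseriesP => k /=; rewrite if_same addNr. Qed.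

HB.instance Definition _ :=
  GRing.isZmodule.Build (mseries m R) saddA saddC sadd0 saddN.

Let trunc N f : {mpoly R[m]} := \sum_(k : 'X_{1..m < N}) f k *: 'X_[k].

Let truncE N f k : (mdeg k < N)%N -> (trunc N f)@_k = f k.
Proof.
move=> kN; rewrite /trunc raddf_sum /= (bigD1 (BMultinom kN)) //=.
rewrite mcoeffZ mcoeffX eqxx mulr1 big1 ?addr0 // => l lk.
rewrite mcoeffZ mcoeffX; case: eqP => [e|_]; last by rewrite mulr0.
by case/eqP: lk; apply: val_inj.
Qed.

Let smulE N f g k : (mdeg k < N)%N -> smul f g k = (trunc N f * trunc N g)@_k.
Proof.
move=> kN; rewrite mcoeffM; apply: eq_bigr => -[l1 l2] /= /eqP e.
have := bmdeg l1; have := bmdeg l2; rewrite !ltnS => d2 d1.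
by rewrite !truncE // (leq_ltn_trans _ kN).
Qed.

Let mcoeffM_eq (p p' q q' : {mpoly R[m]}) k :
  (forall l, (mdeg l <= mdeg k)%N -> p@_l = p'@_l) ->
  (forall l, (mdeg l <= mdeg k)%N -> q@_l = q'@_l) ->
  (p * q)@_k = (p' * q')@_k.
Proof.
move=> ep eq; rewrite !mcoeffM; apply: eq_bigr => -[l1 l2] /= _.
have := bmdeg l1; have := bmdeg l2; rewrite !ltnS => d2 d1.
by rewrite ep ?eq.
Qed.

Lemma smulA : associative smul.
Proof.
move=> f g h; apply: mseriesP => k.
have kN := ltnSn (mdeg k); rewrite !(smulE _ _ kN).
transitivity ((trunc (mdeg k).+1 f * (trunc (mdeg k).+1 g * trunc (mdeg k).+1 h))@_k).
  by apply: mcoeffM_eq => // l lk; rewrite truncE // -smulE.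
by rewrite mulrA; apply: mcoeffM_eq => // l lk; rewrite truncE // -smulE.
Qed.
Lemma smulC : commutative smul.
Proof.
by move=> f g; apply: mseriesP => k; rewrite !(smulE _ _ (ltnSn _)) mulrC.
Qed.
Lemma smul1 : left_id (sconst 1) smul.
Proof.
move=> f; apply: mseriesP => k; rewrite (smulE _ _ (ltnSn _)).
rewrite -[RHS](truncE _ (ltnSn (mdeg k))) -[in RHS](mul1r (trunc _ f)).
apply: mcoeffM_eq => // l lk; rewrite truncE // mcoeff1 /=.
by case: eqP.
Qed.
Lemma smulDl : left_distributive smul sadd.
Proof.
move=> f g h; apply: mseriesP => k /=; rewrite -big_split /=.
by apply: eq_bigr => l _; rewrite mulrDl.
Qed.
Lemma sone_neq0 : sconst 1 != sconst 0.
Proof.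
apply/eqP => /(congr1 (fun f : mseries m R => f 0%MM)) /=; rewrite eqxx.
exact/eqP/oner_neq0.
Qed.

HB.instance Definition _ := GRing.Zmodule_isComNzRing.Build (mseries m R)
  smulA smulC smul1 smulDl sone_neq0.

Definition sunit : pred (mseries m R) := fun f => `[< exists g, g * f = 1 >].
Definition sinv f : mseries m R := xget f [set g | g * f = 1].

Lemma smulVx : {in sunit, left_inverse 1 sinv *%R}.
Proof.
by move=> f; rewrite unfold_in => /asboolP [g gf]; rewrite /sinv; case: xgetP => //= /(_ g).
Qed.
Lemma sunitPl f g : g * f = 1 -> sunit f.
Proof. by move=> gf; apply/asboolP; exists g. Qed.
Lemma sinv_out : {in [predC sunit], sinv =1 id}.
Proof.
move=> f /asboolP nf; rewrite /sinv; case: xgetP => //= g _ gf.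
by case: nf; exists g.
Qed.

HB.instance Definition _ := GRing.ComNzRing_hasMulInverse.Build (mseries m R)
  smulVx sunitPl sinv_out.

End SeriesRing.

Section SeriesCalculus.
Variables (m : nat) (R : comNzRingType).

Definition smono (n : 'X_{1..m}) : mseries m R :=
  MSeries (fun k => if k == n then 1 else 0).
Definition svar (i : 'I_m) : mseries m R := smono U_(i).
Definition sderiv (i : 'I_m) (f : mseries m R) : mseries m R :=
  MSeries (fun k => f (k + U_(i))%MM *+ (k i).+1).

Variable r : nat.

(* Coordinates are numbered from 0: the log coordinates are those with i < r. *)
Definition tlog (i : 'I_m) : mseries m R :=
  if (i < r)%N then svar i else 1 + svar i.
Definition theta (i : 'I_m) (f : mseries m R) : mseries m R :=
  tlog i * sderiv i f.

(* Forms are row vectors of coordinates in the basis (d tlog i / tlog i)_i,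
   which is dual to (theta i)_i. *)
Definition sd (f : mseries m R) : 'rV[mseries m R]_m := \row_i theta i f.
Definition closed_form (eta : 'rV[mseries m R]_m) : Prop :=
  forall i j, theta i (eta 0 j) = theta j (eta 0 i).

End SeriesCalculus.

Definition smap m (R S : Type) (f : R -> S) (x : mseries m R) : mseries m S :=
  MSeries (fun k => f (x k)).

(* For k perfect of characteristic p, the Witt ring W(k) is the p-torsion-free,
   p-adically separated and complete ring with residue ring W / pW = k, unique
   up to unique isomorphism; W is a domain, so p-torsion-free means p != 0. *)
Record witt_ring (p : nat) (k : fieldType) (W : idomainType)
    (res : {rmorphism W -> k}) : Prop := {
  witt_p : p%:R != 0 :> W;
  witt_surj : forall y : k, exists x, res x = y;
  witt_ker : forall x, res x = 0 <-> exists y, x = p%:R * y;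
  witt_sep : forall x : W, (forall N, exists y, x = p%:R ^+ N * y) -> x = 0;
  witt_complete : forall u : nat -> W,
    (forall N, exists y, u N.+1 - u N = p%:R ^+ N * y) ->
    exists l, forall N, exists y, l - u N = p%:R ^+ N * y }.

Section PadicFractions.
Variables (p : nat) (W : idomainType).
Local Notation K := {fraction W}.

(* The closure of Z in W. *)
Definition in_Zp (c : W) : Prop :=
  forall N, exists (z : int) (w : W), c - z%:~R = p%:R ^+ N * w.

Definition padic_cvg (u : nat -> K) (l : K) : Prop :=
  forall N, exists D0, forall D, (D0 <= D)%N ->
    exists w : W, l - u D = tofrac (p%:R ^+ N * w).
(* 0 if there is no limit *)
Definition padic_lim (u : nat -> K) : K := xget 0 [set l | padic_cvg u l].

(* The extension to K of an injective ring endomorphism f of W. *)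
Definition fracmap (f : W -> W) (x : K) : K :=
  tofrac (f \n_(repr x)) / tofrac (f \d_(repr x)).

End PadicFractions.

(* The multi-indices with all entries < D, used for partial sums over N^m. *)
Definition box m D (n : {ffun 'I_m -> 'I_D}) : 'X_{1..m} :=
  [multinom (n i : nat) | i < m].

Section Modules.
Variables (A : comUnitRingType) (H : lmodType A).

Definition submod (U : set H) : Prop :=
  U 0 /\ forall a x y, U x -> U y -> U (a *: x + y).

Definition lincomb n (c : {ffun 'I_n -> A}) (s : 'I_n -> H) : H :=
  \sum_i c i *: s i.

(* The classes of the s i form a basis of U / V. *)
Definition qbasis (U V : set H) n (s : 'I_n -> H) : Prop :=
  (forall i, U (s i)) /\
  forall x, U x -> exists! c : {ffun 'I_n -> A}, V (x - lincomb c s).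
Definition basis (U : set H) n (s : 'I_n -> H) : Prop := qbasis U [set 0] s.

Definition qrank (U V : set H) (n : nat) : Prop :=
  exists s : 'I_n -> H, qbasis U V s.
Definition has_rank (U : set H) (n : nat) : Prop := qrank U [set 0] n.

Definition padic_sum (p m : nat) (x : 'X_{1..m} -> H) (y : H) : Prop :=
  forall N, exists D0, forall D, (D0 <= D)%N ->
    exists z, y - \sum_(n : {ffun 'I_m -> 'I_D}) x (box n) = z *+ p ^ N.

Definition tens m (eta : 'rV[A]_m) (x : H) : {ffun 'I_m -> H} :=
  [ffun l => eta 0 l *: x].

End Modules.

Section FCrystals.
Variables (p r m : nat) (W : idomainType) (sigma : {rmorphism W -> W}).
Local Notation A := (mseries m W).
Local Notation K := {fraction W}.
Local Notation t' := (@tlog m W r).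
Local Notation omega := 'rV[A]_m.

Definition log_structure (x : A) : Prop :=
  exists (n : 'X_{1..m}) (v : A),
    [/\ forall i : 'I_m, (r <= i)%N -> n i = 0%N,
        v \is a GRing.unit & x = smono W n * v].

Record lifting := Lifting {
  lift_fun :> {rmorphism A -> A};
  lift_semilinear : forall c, lift_fun (sconst m c) = sconst m (sigma c);
  lift_frobenius : forall x, exists y, lift_fun x = x ^+ p + p%:R * y;
  lift_log : forall x, log_structure x -> log_structure (lift_fun x) }.

(* The factor f_i(phi), unique since A is a domain. *)
Definition lfac (phi : lifting) (i : 'I_m) : A :=
  xget 1 [set f | (exists y, f = 1 + p%:R * y) /\ phi (t' i) = t' i ^+ p * f].

(* phi^*(d log t'_l) = p d log t'_l + d log f_l(phi) *)
Definition dlog_pull (phi : lifting) (l : 'I_m) : omega :=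
  delta_mx 0 l *+ p + (lfac phi l)^-1 *: sd r (lfac phi l).
Definition form_pull (phi : lifting) (eta : omega) : omega :=
  \sum_l phi (eta 0 l) *: dlog_pull phi l.

(* nabla takes values in omega (x) H, identified with H^m by the basis
   (d log t'_l)_l: the l-th component of nabla x is nabla(theta_l) x.
   The theta_l commute, so integrability is commutation of the components. *)
Record crystal := Crystal {
  crys_mod :> lmodType A;
  crys_free : exists n, has_rank [set: crys_mod] n;
  nabla : crys_mod -> {ffun 'I_m -> crys_mod};
  nablaD : forall x y, nabla (x + y) = nabla x + nabla y;
  nabla_leibniz : forall a x,
    nabla (a *: x) = tens (sd r a) x + [ffun l => a *: nabla x l];
  nabla_integrable : forall i j x, nabla (nabla x i) j = nabla (nabla x j) i;
  nabla_nilpotent : forall i N, exists n0, forall n, (n0 <= n)%N ->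
    forall x, exists z, iteri n (fun j y => nabla y i - y *+ j) x = z *+ p ^ N }.
Arguments nabla {c} x.

(* prod_i prod_(j < n i) (nabla(theta_i) - j) *)
Definition nabla_prod (H : crystal) (n : 'X_{1..m}) (x : H) : H :=
  foldr (fun i y => iteri (n i) (fun j z => nabla z i - z *+ j) y) x
    (enum 'I_m).

(* A linear map phi^*H -> H is given by the phi-semilinear map
   F : x |-> its value at phi^*x = 1 (x) x.  If s is a basis of U, then the
   1 (x) s_i form a basis of phi^*U. *)
Section Linearization.
Variables (H : lmodType A) (U : set H) (F : H -> H).
Definition lin_iso : Prop := forall n (s : 'I_n -> H),
  basis U s -> basis U (fun i => F (s i)).
Definition lin_isogeny : Prop := forall n (s : 'I_n -> H), basis U s ->
  (forall c : {ffun 'I_n -> A}, lincomb c (fun i => F (s i)) = 0 -> c = 0) /\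
  (forall x, U x -> exists N (c : {ffun 'I_n -> A}),
     x *+ p ^ N = lincomb c (fun i => F (s i))).
End Linearization.

(* c ^ n / n!, for c in pA *)
Definition divpow (c : A) (n : nat) : A := xget 0 [set d | d *+ n`! = c ^+ n].

Definition chi_coef (phi1 phi2 : lifting) (n : 'X_{1..m}) : A :=
  \prod_i divpow (lfac phi1 i / lfac phi2 i - 1) (n i).

Record Fcrystal := FCrystal {
  fc_crystal :> crystal;
  frob : lifting -> fc_crystal -> fc_crystal;
  frobD : forall phi x y, frob phi (x + y) = frob phi x + frob phi y;
  frob_semilinear : forall phi (a : A) x,
    frob phi (a *: x) = phi a *: frob phi x;
  frob_horizontal : forall phi x, nabla (frob phi x) =
    \sum_l tens (dlog_pull phi l) (frob phi (nabla x l));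
  frob_isogeny : forall phi, lin_isogeny [set: fc_crystal] (frob phi);
  frob_compat : forall phi1 phi2 x,
    padic_sum p
      (fun n => chi_coef phi1 phi2 n *: frob phi2 (nabla_prod n x))
      (frob phi1 x) }.
Arguments frob {f} phi x.

Definition unit_root (V : Fcrystal) : Prop :=
  exists phi, lin_iso [set: V] (@frob V phi).

(* f restricts to a morphism from U to the twist Y(-i), whose Frobenius is
   p^i times that of Y. *)
Definition Fmorphism_on (X Y : Fcrystal) (U : set X) (i : nat) (f : X -> Y) :
    Prop :=
  [/\ forall (a : A) x y, U x -> U y -> f (a *: x + y) = a *: f x + f y,
      forall x l, U x -> f (nabla x l) = nabla (f x) l &
      forall phi x, U x -> f (frob phi x) = frob phi (f x) *+ p ^ i].

Definition sub_Fcrystal (H : Fcrystal) (U : set H) : Prop :=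
  exists (Y : Fcrystal) (f : Y -> H),
    [/\ Fmorphism_on [set: Y] 0 f, injective f & U = range f].

Record hodge := Hodge {
  hodge_F :> Fcrystal;
  Fil : nat -> set hodge_F;
  Fil_submod : forall i, submod (Fil i);
  Fil_free : forall i, exists n, has_rank (Fil i) n;
  Fil_quo_free : forall i, exists n, qrank [set: hodge_F] (Fil i) n;
  Fil_decr : forall i x, Fil i.+1 x -> Fil i x;
  Fil0 : Fil 0 = [set: hodge_F];
  Fil_large : exists n0, forall n, (n0 <= n)%N -> Fil n = [set 0];
  Fil_transversal : forall i x l, Fil i.+1 x -> Fil i (nabla x l);
  Fil_frob : forall phi i x, Fil i x ->
    exists z, frob phi x = z *+ p ^ i }.
Arguments Fil : clear implicits.

Definition is_max (P : nat -> Prop) (n : nat) : Prop :=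
  P n /\ forall j, P j -> (j <= n)%N.

Definition has_weight (H : hodge) (w : nat) : Prop :=
  exists rho1 rho2,
    [/\ is_max (fun n => Fil H n = [set: H]) rho1,
        is_max (fun n => Fil H n <> [set 0]) rho2 & w = (rho1 + rho2)%N].

(* By Dieudonne-Manin, an isocrystal (V, F) over an algebraically closed field
   is a direct sum of simple objects with basis e, F e, .., F^(b-1) e and
   F^b e = p^a e, each contributing the slope a/b with multiplicity b.
   Only a >= 0 occurs for the isocrystals that contain an F-stable lattice. *)
Definition newton_slopes (V : vectType K) (F : V -> V) (sl : seq rat) : Prop :=
  exists L : seq (nat * nat * V),
    [/\ forall a b e, (a, b, e) \in L ->
          [/\ (0 < b)%N, coprime a b & iter b F e = p%:R ^+ a *: e],
        basis_of {:V}
          (flatten [seq [seq iter j F c.2 | j <- iota 0 c.1.2] | c <- L]) &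
        sl = flatten [seq nseq c.1.2 (c.1.1%:R / c.1.2%:R) | c <- L]].

(* The fibre e_0^*H is W^n by the basis s of H; the matrix of its Frobenius
   is that of the constant terms of P.  A polygon is given by its slopes. *)
Definition ordinary (H : hodge) : Prop :=
  exists (phi : lifting) (n : nat) (s : 'I_n -> H) (P : 'M[A]_n) (sl : seq rat),
    [/\ forall i, phi (t' i) = t' i ^+ p,
        basis [set: H] s,
        forall j, frob phi (s j) = \sum_i P i j *: s i,
        newton_slopes (fun x : 'cV[K]_n =>
          map_mx (fun a : A => tofrac (a 0%MM)) P *m map_mx (fracmap sigma) x)
          sl &
        forall i : nat,
          qrank (Fil H i) (Fil H i.+1) (count_mem (i%:R : rat) sl)].

Definition pred_step (H : hodge) (U : nat -> set H) (i : nat) : set H :=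
  if i is j.+1 then U j else [set 0].

Definition slope_filtration (H : hodge) (U : nat -> set H) : Prop :=
  forall i,
    [/\ forall x, U i x -> U i.+1 x,
        sub_Fcrystal (U i),
        exists (V : Fcrystal) (f : H -> V),
          [/\ unit_root V, Fmorphism_on (U i) i f,
              forall v, exists2 x, U i x & f x = v &
              forall x, U i x -> f x = 0 <-> pred_step U i x] &
        forall x, exists! yz : H * H,
          [/\ U i yz.1, Fil H i.+1 yz.2 & x = yz.1 + yz.2]].

Definition unit_root_part (H : hodge) (U0 : set H) : Prop :=
  exists U, slope_filtration U /\ U 0%N = U0.

Definition adapted_bases (H : hodge) (U : set H) (g h : nat)
    (a : 'I_g -> H) (b : 'I_h -> H) (eta : 'I_h -> 'I_g -> omega)
    (u : lifting -> 'I_h -> 'I_g -> A) : Prop :=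
  [/\ basis U a /\ basis (Fil H 1) b,
      forall j, nabla (a j) = 0,
      forall i j, closed_form r (eta i j),
      forall i, nabla (b i) = \sum_j tens (eta i j) (a j) &
      forall phi,
        (forall j, frob phi (a j) = a j) /\
        (forall i, frob phi (b i) =
           b i *+ p + (\sum_j u phi i j *: a j) *+ p)].

Local Notation toK := (smap (@tofrac W)).

(* The pullback of a series with denominators: sigma on the coefficients, then
   substitution t := phi(t).  Since phi(t_i) may have a constant term, each
   coefficient of the result is a p-adic limit. *)
Definition series_pull (phi : lifting) (x : mseries m K) : mseries m K :=
  MSeries (fun k => padic_lim p (fun D =>
    \sum_(n : {ffun 'I_m -> 'I_D})
      fracmap sigma (x (box n)) *
      tofrac ((\prod_i phi (svar W i) ^+ box n i) k))).

Definition series_log (f : A) : mseries m K :=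
  MSeries (fun k => padic_lim p (fun D =>
    - \sum_(1 <= n < D) tofrac (((1 - f) ^+ n) k) / n%:R)).

Section Logarithms.
Variable le_rm : (r <= m)%N.

(* (c, x) stands for sum_l c_l log t_l + x. *)
Definition log_series := ('rV[W]_r * mseries m K)%type.

Definition log_d (tau : log_series) : 'rV[mseries m K]_m :=
  \sum_l sconst m (tofrac (tau.1 0 l)) *: delta_mx 0 (widen_ord le_rm l)
  + sd r tau.2.

Definition log_pull (phi : lifting) (tau : log_series) : log_series :=
  (map_mx sigma tau.1 *+ p,
   \sum_l sconst m (tofrac (sigma (tau.1 0 l))) *
      series_log (lfac phi (widen_ord le_rm l))
   + series_pull phi tau.2).

Definition log_primitive (eta : omega) (u : lifting -> A) (tau : log_series) :
    Prop :=
  [/\ forall l, in_Zp p (tau.1 0 l),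
      map_mx toK eta = log_d tau,
      exists w : W, tau.2 0%MM = tofrac (p%:R * w) &
      forall phi,
        log_pull phi tau - tau *+ p - ((0, toK (u phi)) : log_series) *+ p = 0].

End Logarithms.

(* The exponential series of x converges to q, coefficientwise and
   p-adically. *)
Definition exp_series_to (x : mseries m K) (q : A) : Prop :=
  forall k, padic_cvg p
    (fun D => \sum_(n < D) ((x ^+ n) k) / (n`!)%:R) (tofrac (q k)).

End FCrystals.
Arguments Fil {p r m W sigma} h i.

(* Main.v *)
Require Import Defs.
From HB Require Import structures.
From mathcomp Require Import all_boot all_order all_algebra.
From mathcomp Require Import boolp classical_sets.
From mathcomp Require Import mpoly zify ring.
Set Implicit Arguments.
Unset Strict Implicit.
Unset Printing Implicit Defensive.
Import GRing.Theory.
Local Open Scope ring_scope.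

(** Write A = W[[t]] and K = Frac W.

    The bases come from Lang's theorem.  An invertible Frobenius matrix over k
    has a fixed basis (lang); by successive approximation, first t-adically
    modulo p and then p-adically, so has one over A (frobenius_fixed_basis).
    The pullback of log forms by a lifting is divisible by p, so a vector fixed
    by Frobenius is horizontal, and the comparison between liftings then shows
    that it is fixed by all of them (unit_root_horizontal_basis).  In weight one
    Fil 1 maps isomorphically onto the second graded piece of the slope
    filtration.  Fixed bases of the two unit-root crystals give a and b, up to
    error terms with values in U, which are eta and u (adapted_bases_exist).
    Horizontality of Frobenius is the relation between eta and u
    (adapted_form_pull).

    A closed form eta has a primitive tau, by integrating its coefficients
    (poincare).  Its residues are fixed by sigma, hence lie in Z_p, and its
    constant term has to be p w with sigma w - p w the constant term of
    u (phi0), where phi0 is the lifting with phi0 (t') = t' ^ p; there is exactly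
    one such w in W.  For any lifting phi, both sides of the
    equation have the same derivatives, and what remains is an identity of
    constant terms.  It is the comparison of the Frobenius maps of phi and phi0
    on b, read at the origin: there the operators
    prod_i prod_(j < n i) (nabla i - j) give the Taylor coefficients of tau, and
    on the logarithms they give the coefficients of log (lfac phi i)
    (pull_sum_const, nabla_coord_primitive, log_primitive_exists).

    For the exponential, let x be the part of tau without constant term.  At
    phi0 the logarithms disappear, and substitution of phi0 maps x to p x + p v
    with v in A.  Hence q = exp x is mapped to q ^ p exp (p v), which is congruent
    to q ^ p modulo p as soon as q is integral; Dwork's argument turns this into
    integrality of q, by induction on the degree (dwork).  The constant term of
    tau lies in pW and is exponentiated p-adically, which needs p odd
    (exp_const_cvg, log_primitive_exp). *)

(** * Coefficients and derivatives of power series *)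

Lemma mnm_neq0 m (l : 'X_{1..m}) : l <> 0%MM -> exists i, l i != 0%N.
Proof.
move=> l0; apply: contrapT => h; apply: l0; apply/mnmP => i; rewrite mnm0E.
by apply/eqP; apply: contrapT => /negP hi; apply: h; exists i.
Qed.

Lemma mnm1_le m (l : 'X_{1..m}) i : (U_(i) <= l)%MM = (l i != 0%N).
Proof.
apply/mnm_lepP/idP => [/(_ i)|li j]; first by rewrite mnm1E eqxx -lt0n.
by rewrite mnm1E; case: eqP => // <-; rewrite lt0n.
Qed.

Section Coefficients.
Variables (m : nat) (R : comNzRingType).
Local Notation A := (mseries m R).
Implicit Types (f g : A) (k l n : 'X_{1..m}).

Lemma scoef0 k : (0 : A) k = 0. Proof. by rewrite /= if_same. Qed.
Lemma scoefD f g k : (f + g) k = f k + g k. Proof. by []. Qed.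
Lemma scoefN f k : (- f) k = - f k. Proof. by []. Qed.
Lemma scoefB f g k : (f - g) k = f k - g k. Proof. by []. Qed.
Lemma scoef1 k : (1 : A) k = if k == 0%MM then 1 else 0. Proof. by []. Qed.

Lemma scoef_sum I (s : seq I) (P : pred I) (F : I -> A) k :
  (\sum_(i <- s | P i) F i) k = \sum_(i <- s | P i) F i k.
Proof. by elim/big_rec2: _ => [|i x y _ <-] //; rewrite scoef0. Qed.

Lemma scoefMn f d k : (f *+ d) k = f k *+ d.
Proof. by elim: d => [|d IH]; rewrite ?mulr0n ?scoef0 // !mulrS scoefD IH. Qed.

Lemma scoefM_ind (P : R -> Prop) f g k :
  P 0 -> (forall x y, P x -> P y -> P (x + y)) ->
  (forall l1 l2, k = (l1 + l2)%MM -> P (f l1 * g l2)) -> P ((f * g) k).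
Proof. by move=> P0 PD PM; rewrite /=; apply: big_ind => // l /eqP; apply: PM. Qed.

Definition eq_upto N f g := forall k, (mdeg k < N)%N -> f k = g k.

Lemma eq_uptoM N f f' g g' :
  eq_upto N f f' -> eq_upto N g g' -> eq_upto N (f * g) (f' * g').
Proof.
move=> ef eg k kN; rewrite /=; apply: eq_bigr => -[l1 l2] /= _.
have := bmdeg l1; have := bmdeg l2; rewrite !ltnS => d2 d1.
by rewrite ef ?eg //; apply: leq_ltn_trans kN.
Qed.

Definition of_mpoly (P : {mpoly R[m]}) : A := MSeries (fun k => P@_k).

Fact of_mpoly_zmod : zmod_morphism of_mpoly.
Proof. by move=> P Q; apply: mseriesP => k; rewrite /= mcoeffB. Qed.
Fact of_mpoly_monoid : monoid_morphism of_mpoly.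
Proof.
split=> [|P Q]; apply: mseriesP => k; last exact: mcoeffM.
by rewrite scoef1 /= mcoeff1; case: eqP.
Qed.
HB.instance Definition _ :=
  GRing.isZmodMorphism.Build {mpoly R[m]} A of_mpoly of_mpoly_zmod.
HB.instance Definition _ :=
  GRing.isMonoidMorphism.Build {mpoly R[m]} A of_mpoly of_mpoly_monoid.

Lemma of_mpolyD P Q : of_mpoly (P + Q) = of_mpoly P + of_mpoly Q.
Proof. exact: rmorphD. Qed.
Lemma of_mpolyM P Q : of_mpoly (P * Q) = of_mpoly P * of_mpoly Q.
Proof. exact: rmorphM. Qed.

Definition trunc N f : {mpoly R[m]} := \sum_(k : 'X_{1..m < N}) f k *: 'X_[k].

Lemma mcoeff_trunc N f k : (trunc N f)@_k = if (mdeg k < N)%N then f k else 0.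
Proof.
rewrite /trunc raddf_sum /=; case: ifP => [kN | /negbT kN].
  rewrite (bigD1 (BMultinom kN)) //= mcoeffZ mcoeffX eqxx mulr1 big1 ?addr0 //.
  move=> l lk; rewrite mcoeffZ mcoeffX; case: eqP => [e|_]; rewrite ?mulr0 //.
  by case/eqP: lk; apply: val_inj.
rewrite big1 // => l _; rewrite mcoeffZ mcoeffX; case: eqP => [e|_].
  by case/negP: kN; rewrite -e bmdeg.
by rewrite mulr0.
Qed.

Lemma truncK N f : eq_upto N f (of_mpoly (trunc N f)).
Proof. by move=> k kN /=; rewrite mcoeff_trunc kN. Qed.

Definition const_coef f : R := f 0%MM.
Fact const_coef_zmod : zmod_morphism const_coef. Proof. by []. Qed.
Fact const_coef_monoid : monoid_morphism const_coef.
Proof.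
split=> [|f g]; first by rewrite /const_coef scoef1 eqxx.
rewrite /const_coef.
have z : (mdeg (0%MM : 'X_{1..m}) < 1)%N by rewrite mdeg0.
rewrite (eq_uptoM (@truncK 1 f) (@truncK 1 g) z) -rmorphM /=.
by rewrite (rmorphM (mcoeff 0%MM)) /= !mcoeff_trunc z.
Qed.
HB.instance Definition _ :=
  GRing.isZmodMorphism.Build A R const_coef const_coef_zmod.
HB.instance Definition _ :=
  GRing.isMonoidMorphism.Build A R const_coef const_coef_monoid.

Lemma const_coefE f : const_coef f = f 0%MM. Proof. by []. Qed.
Lemma scoef0M f g : (f * g) 0%MM = f 0%MM * g 0%MM.
Proof. exact: (rmorphM const_coef). Qed.
Lemma scoef0X f d : (f ^+ d) 0%MM = f 0%MM ^+ d.
Proof. exact: (rmorphXn const_coef). Qed.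

Lemma of_mpolyX n : of_mpoly 'X_[n] = smono R n.
Proof.
by apply: mseriesP => k; rewrite /= mcoeffX eq_sym; case: eqP.
Qed.

Lemma scoef_smono n k : smono R n k = if k == n then 1 else 0.
Proof. by []. Qed.

Lemma smonoE n : smono R n = \prod_i svar R i ^+ n i.
Proof.
rewrite -of_mpolyX mpolyXE_id rmorph_prod; apply: eq_bigr => i _ /=.
by rewrite rmorphXn /= of_mpolyX.
Qed.

Lemma scoef_smonoM n f k :
  (smono R n * f) k = if (n <= k)%MM then f (k - n)%MM else 0.
Proof.
have e := eq_uptoM (@truncK (mdeg k).+1 (smono R n)) (@truncK (mdeg k).+1 f).
case: ifP => nk; last first.
  apply: (scoefM_ind (P := fun x => x = 0)) => // [x y -> ->|l1 l2 kl].
    by rewrite addr0.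
  rewrite /=; case: eqP => [e1|]; rewrite ?mul0r //.
  by move: nk; rewrite kl e1 lem_addr.
have kn : k = (n + (k - n))%MM by rewrite addmC submK.
have nd : (mdeg n <= mdeg k)%N by rewrite kn mdegD leq_addr.
have -> : (smono R n * f) k = (of_mpoly 'X_[n] * of_mpoly (trunc (mdeg k).+1 f)) k.
  by rewrite of_mpolyX; apply: (eq_uptoM _ (@truncK _ f) (ltnSn _)).
rewrite -rmorphM /= mulrC {1}kn mcoeffMX mcoeff_trunc ltnS.
by rewrite (leq_trans (mdegB _ _)).
Qed.

Lemma scoef_smonoDM n f k : (smono R n * f) (n + k)%MM = f k.
Proof. by rewrite scoef_smonoM lem_addr addmC addmK. Qed.

Lemma smono_inj n f g : smono R n * f = smono R n * g -> f = g.
Proof.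
by move=> e; apply: mseriesP => k; rewrite -[LHS](scoef_smonoDM n) e scoef_smonoDM.
Qed.

Fact sconst_zmod : zmod_morphism (@sconst m R).
Proof. by move=> x y; apply: mseriesP => k /=; case: eqP; rewrite ?subrr. Qed.
Lemma scoef_sconstM c f k : (sconst m c * f) k = c * f k.
Proof.
have e := @truncK (mdeg k).+1 f.
have -> : (sconst m c * f) k = (of_mpoly c%:MP * of_mpoly (trunc (mdeg k).+1 f)) k.
  apply: (eq_uptoM _ e (ltnSn _)) => l _ /=.
  by rewrite mcoeffC eq_sym; case: eqP; rewrite ?mulr1 ?mulr0.
by rewrite -rmorphM /= mcoeffCM mcoeff_trunc ltnSn.
Qed.
Fact sconst_monoid : monoid_morphism (@sconst m R).
Proof.
split=> // x y; apply: mseriesP => k; rewrite scoef_sconstM /=.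
by case: eqP; rewrite ?mulr0.
Qed.
HB.instance Definition _ :=
  GRing.isZmodMorphism.Build R A (@sconst m R) sconst_zmod.
HB.instance Definition _ :=
  GRing.isMonoidMorphism.Build R A (@sconst m R) sconst_monoid.

Lemma scoef_natM d f k : (d%:R * f) k = d%:R * f k.
Proof. by rewrite !mulr_natl scoefMn. Qed.
Lemma scoef_natXM d N f k : (d%:R ^+ N * f) k = d%:R ^+ N * f k.
Proof. by rewrite -natrX scoef_natM natrX. Qed.

Definition vanish N f := forall k, (mdeg k < N)%N -> f k = 0.

Lemma vanishM N N' f g : vanish N f -> vanish N' g -> vanish (N + N') (f * g).
Proof.
move=> vf vg k kN; apply: (scoefM_ind (P := fun x => x = 0)) => //.
  by move=> x y -> ->; rewrite addr0.
move=> l1 l2 e; case: (ltnP (mdeg l1) N) => d1; first by rewrite vf ?mul0r.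
rewrite vg ?mulr0 //; move: kN; rewrite e mdegD; lia.
Qed.
Lemma vanishMl N f g : vanish N g -> vanish N (f * g).
Proof. by move=> vg; apply: (@vanishM 0 N). Qed.
Lemma vanishX N f d : vanish N f -> vanish (N * d) (f ^+ d).
Proof.
move=> vf; elim: d => [|d IH]; first by rewrite muln0.
by rewrite exprS mulnS; apply: vanishM.
Qed.
Lemma vanish1 f : f 0%MM = 0 <-> vanish 1 f.
Proof.
split=> [f0 k|]; last by apply; rewrite mdeg0.
by rewrite ltnS leqn0 mdeg_eq0 => /eqP ->.
Qed.
Lemma eq_uptoP N f g : eq_upto N f g <-> vanish N (f - g).
Proof.
split=> e k kN; first by rewrite scoefB e ?subrr.
by apply/eqP; rewrite -subr_eq0 -scoefB e.
Qed.

Lemma sderivD i f g : sderiv i (f + g) = sderiv i f + sderiv i g.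
Proof. by apply: mseriesP => k; rewrite /= mulrnDl. Qed.
Lemma sderiv0 i : sderiv i (0 : A) = 0.
Proof. by apply: mseriesP => k; rewrite /= !if_same mul0rn. Qed.
Lemma sderivN i f : sderiv i (- f) = - sderiv i f.
Proof. by apply: mseriesP => k; rewrite /= mulNrn. Qed.
Lemma sderivB i f g : sderiv i (f - g) = sderiv i f - sderiv i g.
Proof. by rewrite sderivD sderivN. Qed.
Lemma sderiv_sum i I (s : seq I) (P : pred I) (F : I -> A) :
  sderiv i (\sum_(j <- s | P j) F j) = \sum_(j <- s | P j) sderiv i (F j).
Proof.
by elim/big_rec2: _ => [|j x y _ <-]; rewrite ?sderiv0 // sderivD.
Qed.
Lemma sderivMn i f d : sderiv i (f *+ d) = sderiv i f *+ d.
Proof. by elim: d => [|d IH]; rewrite ?mulr0n ?sderiv0 // !mulrS sderivD IH. Qed.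
Lemma sderiv_eq_upto i N f g :
  eq_upto N.+1 f g -> eq_upto N (sderiv i f) (sderiv i g).
Proof.
by move=> e k kN; rewrite /= e // mdegD mdeg1 addn1 ltnS.
Qed.
Lemma sderiv_mpoly i P : sderiv i (of_mpoly P) = of_mpoly (P^`M(i)).
Proof. by apply: mseriesP => k; rewrite /= mcoeff_deriv. Qed.

Lemma sderivM i f g : sderiv i (f * g) = sderiv i f * g + f * sderiv i g.
Proof.
apply: mseriesP => k; pose N := (mdeg k).+1.
have eN h : eq_upto N h (of_mpoly (trunc N.+1 h)).
  by move=> l lN; apply: truncK; apply: leqW.
rewrite (sderiv_eq_upto i (eq_uptoM (@truncK N.+1 f) (@truncK N.+1 g)) (ltnSn _)).
rewrite -of_mpolyM sderiv_mpoly mderivM of_mpolyD !of_mpolyM -!sderiv_mpoly !scoefD.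
have eD h := sderiv_eq_upto i (@truncK N.+1 h).
by rewrite (eq_uptoM (eD f) (eN g) (ltnSn _)) (eq_uptoM (eN f) (eD g) (ltnSn _)).
Qed.

Lemma sderiv_const i (c : R) : sderiv i (sconst m c) = 0.
Proof.
apply: mseriesP => k; rewrite scoef0 /= ifF ?mul0rn //.
by rewrite mnmD_eq0 mnm1_eq0 andbF.
Qed.
Lemma sderiv1 i : @sderiv m R i 1 = 0. Proof. exact: sderiv_const. Qed.
Lemma sderiv_var i j : @sderiv m R i (svar R j) = (i == j)%:R.
Proof.
apply: mseriesP => k; rewrite /=.
case: (k =P 0%MM) => [->|k0].
  rewrite add0m mnm0E eq_mnm1.
  by case: eqP => _; rewrite ?mulr1n ?mulr0n ?scoef1 ?scoef0 ?eqxx.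
rewrite ifF ?mul0rn; last first.
  apply/eqP => e; apply: k0; apply/eqP; rewrite -mdeg_eq0.
  by move/(congr1 (@mdeg m)): e; rewrite mdegD !mdeg1; lia.
by case: eqP => _; rewrite ?scoef0 // scoef1; case: eqP.
Qed.
Lemma sderivX i f d : sderiv i (f ^+ d) = (f ^+ d.-1 * sderiv i f) *+ d.
Proof.
elim: d => [|d IH]; first by rewrite sderiv1 mulr0n.
rewrite exprS sderivM IH /= mulrS mulrC; congr (_ + _).
rewrite -mulrnAr mulrA; case: d {IH} => [|d]; first by rewrite !mulr0n !mulr0.
by rewrite -exprS mulrnAr.
Qed.

Lemma scoef_var0 (i : 'I_m) : svar R i 0%MM = 0.
Proof. by rewrite /= ifF // eq_sym mnm1_eq0. Qed.

End Coefficients.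

Section CoefMap.
Variables (m : nat) (R S : comNzRingType) (h : {rmorphism R -> S}).
Fact smap_zmod : zmod_morphism (@smap m R S h).
Proof. by move=> f g; apply: mseriesP => k; rewrite /= rmorphB. Qed.
Fact smap_monoid : monoid_morphism (@smap m R S h).
Proof.
split=> [|f g]; apply: mseriesP => k; rewrite /=.
  by case: eqP; rewrite ?rmorph1 ?rmorph0.
by rewrite rmorph_sum; apply: eq_bigr => l _; rewrite rmorphM.
Qed.
HB.instance Definition _ := GRing.isZmodMorphism.Build
  (mseries m R) (mseries m S) (@smap m R S h) smap_zmod.
HB.instance Definition _ := GRing.isMonoidMorphism.Build
  (mseries m R) (mseries m S) (@smap m R S h) smap_monoid.
Lemma smap_smono n : smap h (smono R n) = smono S n :> mseries m S.
Proof. by apply: mseriesP => k /=; case: eqP; rewrite ?rmorph1 ?rmorph0. Qed.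
Lemma smap_const c : smap h (sconst m c) = sconst m (h c).
Proof. by apply: mseriesP => k /=; case: eqP; rewrite ?rmorph0. Qed.
Lemma smap_sderiv i f : smap h (sderiv i f) = sderiv i (smap h f) :> mseries m S.
Proof. by apply: mseriesP => k; rewrite /= rmorphMn. Qed.
Lemma smap_tlog r i : smap h (tlog R r i) = tlog S r i :> mseries m S.
Proof.
by rewrite /tlog /svar; case: ifP => _; rewrite ?rmorphD ?rmorph1 /= smap_smono.
Qed.
Lemma smap_theta r i f : smap h (theta r i f) = theta r i (smap h f) :> mseries m S.
Proof. by rewrite /theta rmorphM /= smap_tlog smap_sderiv. Qed.
End CoefMap.

(** * p-adic divisibility, completeness and limits *)

Section Divisibility.
Variable p : nat.

Definition pdvd (R : comNzRingType) N (x : R) := exists y, x = p%:R ^+ N * y.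

Section OneRing.
Variable R : comNzRingType.
Implicit Types x y : R.

Lemma pdvd_pow N x : pdvd N (p%:R ^+ N * x). Proof. by exists x. Qed.
Lemma pdvd_all x : pdvd 0 x. Proof. by exists x; rewrite mul1r. Qed.
Lemma pdvd0 N : pdvd N (0 : R). Proof. by exists 0; rewrite mulr0. Qed.
Lemma pdvdD N x y : pdvd N x -> pdvd N y -> pdvd N (x + y).
Proof. by move=> [a ->] [b ->]; exists (a + b); rewrite mulrDr. Qed.
Lemma pdvdN N x : pdvd N x -> pdvd N (- x).
Proof. by move=> [a ->]; exists (- a); rewrite mulrN. Qed.
Lemma pdvdM N N' x y : pdvd N x -> pdvd N' y -> pdvd (N + N') (x * y).
Proof. by move=> [a ->] [b ->]; exists (a * b); rewrite exprD mulrACA. Qed.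
Lemma pdvdMl N x y : pdvd N y -> pdvd N (x * y).
Proof. exact: (pdvdM (pdvd_all x)). Qed.
Lemma pdvdMr N x y : pdvd N x -> pdvd N (x * y).
Proof. by rewrite mulrC; apply: pdvdMl. Qed.
Lemma pdvd_le N N' x : (N' <= N)%N -> pdvd N x -> pdvd N' x.
Proof.
by move=> le [a ->]; exists (p%:R ^+ (N - N') * a); rewrite mulrA -exprD subnKC.
Qed.
Lemma pdvd_sum N I (s : seq I) (P : pred I) (F : I -> R) :
  (forall i, P i -> pdvd N (F i)) -> pdvd N (\sum_(i <- s | P i) F i).
Proof. by move=> dF; apply: big_ind => //; [apply: pdvd0 | apply: pdvdD]. Qed.
Lemma pdvdX N x d : pdvd N x -> pdvd (N * d) (x ^+ d).
Proof.
move=> dx; elim: d => [|d IH]; first by rewrite muln0; apply: pdvd_all.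
by rewrite exprS mulnS; apply: pdvdM.
Qed.
End OneRing.

Lemma pdvd_rmorph (R S : comNzRingType) (f : {rmorphism R -> S}) N x :
  pdvd N x -> pdvd N (f x).
Proof. by move=> [y ->]; exists (f y); rewrite rmorphM rmorphXn rmorph_nat. Qed.

Lemma pdvd_coef m (R : comNzRingType) N (f : mseries m R) :
  pdvd N f <-> forall k, pdvd N (f k).
Proof.
split=> [[y ->] k|/choice [y fy]]; first by rewrite scoef_natXM; apply: pdvd_pow.
by exists (MSeries y); apply: mseriesP => k; rewrite scoef_natXM -fy.
Qed.

(** Completeness is stated for the p-adic expansions that successive
    approximation produces. *)
Definition pcomplete (M : zmodType) := forall a : nat -> M,
  exists l, forall N, exists y, l - \sum_(i < N) a i *+ p ^ i = y *+ p ^ N.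
Definition pseparated (M : zmodType) :=
  forall x : M, (forall N, exists y, x = y *+ p ^ N) -> x = 0.

(** Successive approximation: the error left by an approximate solution is a
    multiple of p, and is corrected by solving the same equation again. *)
Lemma psolve (M : zmodType) (L : {additive M -> M}) :
  pcomplete M -> pseparated M ->
  (forall E, exists C E', L C = E + E' *+ p) -> forall E, exists C, L C = E.
Proof.
move=> cM sM /choice [c /choice [e Lc]] E.
have [Ei [E0 LE]] : exists Ei : nat -> M,
    Ei 0%N = E /\ forall i, L (c (Ei i)) = Ei i - Ei i.+1 *+ p.
  exists (fun i => iter i (fun x => - e x) E); split=> // i.
  by rewrite Lc /= mulNrn opprK.
have [l lP] := cM (fun i => c (Ei i)); exists l; apply/eqP; rewrite -subr_eq0.
apply/eqP/sM => N; have [y ly] := lP N; exists (L y - Ei N).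
have tele : L (\sum_(i < N) c (Ei i) *+ p ^ i) = E - Ei N *+ p ^ N.
  elim: N {y ly} => [|N IH]; first by rewrite big_ord0 raddf0 E0 expn0 mulr1n subrr.
  rewrite big_ord_recr /= (raddfD L) IH (raddfMn L) LE mulrnBl -mulrnA -expnS.
  by rewrite addrA subrK.
rewrite -[l](subrK (\sum_(i < N) c (Ei i) *+ p ^ i)) ly (raddfD L) tele (raddfMn L).
by rewrite mulrnBl -addrA addrAC subrr add0r.
Qed.

Lemma pcomplete_choice (M : zmodType) T (a : T -> nat -> M) : pcomplete M ->
  exists (l : T -> M) (y : T -> nat -> M),
    forall t N, l t - \sum_(i < N) a t i *+ p ^ i = y t N *+ p ^ N.
Proof.
move=> cM; have /choice [l] := fun t => cM (a t).
move=> lP; have /choice [y ly] : forall t, exists y : nat -> M, forall N,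
    l t - \sum_(i < N) a t i *+ p ^ i = y N *+ p ^ N.
  by move=> t; have [y ly] := choice (lP t); exists y.
by exists l, y.
Qed.

Lemma pcomplete_series m (R : comNzRingType) : pcomplete R -> pcomplete (mseries m R).
Proof.
move=> cR a; have [l [y ly]] := pcomplete_choice (fun k i => a i k) cR.
exists (MSeries l) => N; exists (MSeries (fun k => y k N)); apply: mseriesP => k.
rewrite scoefB scoef_sum scoefMn /= -ly; congr (_ - _).
by apply: eq_bigr => i _; rewrite scoefMn.
Qed.

Lemma pcomplete_matrix (V : zmodType) a b : pcomplete V -> pcomplete 'M[V]_(a, b).
Proof.
move=> cV s.
have [l [y ly]] := pcomplete_choice (fun (ij : 'I_a * 'I_b) i => s i ij.1 ij.2) cV.
exists (\matrix_(i, j) l (i, j)) => N; exists (\matrix_(i, j) y (i, j) N).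
apply/matrixP => i j; rewrite mulmxnE !mxE -ly; congr (_ - _).
by rewrite summxE; apply: eq_bigr => t _; rewrite mulmxnE.
Qed.

Lemma pseparated_series m (R : comNzRingType) : pseparated R -> pseparated (mseries m R).
Proof.
move=> sR f fP; apply: mseriesP => k; rewrite scoef0; apply: sR => N.
by have [y ->] := fP N; exists (y k); rewrite scoefMn.
Qed.

Lemma pseparated_matrix (V : zmodType) a b : pseparated V -> pseparated 'M[V]_(a, b).
Proof.
move=> sV A AP; apply/matrixP => i j; rewrite mxE; apply: sV => N.
by have [y ->] := AP N; exists (y i j); rewrite mulmxnE.
Qed.

Lemma pdvd_natmul (R : comNzRingType) N (x : R) :
  pdvd N x <-> exists y, x = y *+ p ^ N.
Proof. by split=> -[y ->]; exists y; rewrite -[y *+ _]mulr_natl natrX. Qed.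
End Divisibility.

Section FactorialValuation.
Variable p : nat.
Hypothesis p_pr : prime p.

(** Legendre's formula, as a bound: the quotients n %/ p ^ k decrease at least
    geometrically. *)
Lemma logn_fact_bound n : (0 < n)%N -> ((p - 1) * logn p n`! < n)%N.
Proof.
move=> n_gt0; have p1 := prime_gt1 p_pr.
pose S K := (\sum_(1 <= k < K.+1) n %/ p ^ k)%N.
have SS K : S K.+1 = (S K + n %/ p ^ K.+1)%N by rewrite /S big_nat_recr.
have bnd K : ((p - 1) * S K + n %/ p ^ K <= n)%N.
  elim: K => [|K IH]; first by rewrite /S big_geq // muln0 expn0 divn1.
  have d : (p * (n %/ p ^ K.+1) <= n %/ p ^ K)%N.
    by rewrite expnSr divnMA mulnC leq_trunc_div.
  apply: leq_trans IH; rewrite SS mulnDr.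
  have : (n %/ p ^ K.+1 <= p * (n %/ p ^ K.+1))%N by rewrite leq_pmull ?prime_gt0.
  rewrite mulnBl mul1n; lia.
rewrite logn_fact // -/(S n).
elim: {1}n => [|K IH]; first by rewrite /S big_geq // muln0.
by have := bnd K.+1; rewrite SS; case: (n %/ p ^ K.+1)%N => [|d]; rewrite ?addn0 //; lia.
Qed.

Lemma logn_half d : (2 * logn p d <= d)%N.
Proof.
case: d => [|d]; first by rewrite logn0.
have le : (p ^ logn p d.+1 <= d.+1)%N by apply: dvdn_leq => //; apply: pfactor_dvdnn.
apply: leq_trans le; have p1 := prime_gt1 p_pr.
elim: (logn p d.+1) => [|v IH]; first by rewrite muln0.
have := expnS p v; case: v IH => [|v] IH; last by nia.
by move=> ->; rewrite expn0 !muln1.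
Qed.
End FactorialValuation.

Section WittRing.
Variables (p : nat) (k : closedFieldType) (W : idomainType).
Variables (res : {rmorphism W -> k}).
Hypothesis (char_k : p \in [pchar k]) (W_witt : witt_ring p res).
Local Notation K := {fraction W}.
Local Notation F := (@tofrac W).
Local Notation pdvd := (pdvd p).

Lemma p_prime : prime p. Proof. exact: pcharf_prime char_k. Qed.
Lemma res_p : res p%:R = 0. Proof. by rewrite rmorph_nat (pcharf0 char_k). Qed.
Lemma p_neq0 : p%:R != 0 :> W. Proof. exact: witt_p W_witt. Qed.

Lemma res_eq0 x : res x = 0 <-> pdvd 1 x.
Proof. by rewrite /pdvd expr1; apply: witt_ker W_witt x. Qed.

Lemma W_separated : pseparated p W.
Proof.
move=> x xP; apply: (witt_sep W_witt) => N; have [y ->] := xP N.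
by exists y; rewrite -natrX mulr_natl.
Qed.

Lemma W_complete : pcomplete p W.
Proof.
move=> a; have [N|l lP] := witt_complete W_witt (u := fun N => \sum_(i < N) a i *+ p ^ i).
  exists (a N); rewrite big_ord_recr /= addrAC subrr add0r.
  by rewrite -natrX mulr_natl.
exists l => N; have [y ->] := lP N; exists y.
by rewrite -natrX mulr_natl.
Qed.

(** The inverse of the residue is lifted to W and corrected by successive
    approximation. *)
Lemma W_unit x : res x != 0 -> x \is a GRing.unit.
Proof.
move=> x0; have [v vx] := witt_surj W_witt (res x)^-1.
have [||E|y xy] := psolve (p := p) (L := GRing.mull_fun x idfun) _ _ _ 1.
- exact: W_complete.
- exact: W_separated.
- exists (v * E); have /res_eq0 [y e] : res (x * v - 1) = 0.
    by rewrite rmorphB rmorphM rmorph1 vx mulfV ?subrr.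
  exists (y * E); rewrite /= -[y * E *+ p]mulr_natl.
  have -> : p%:R * (y * E) = (x * v - 1) * E by rewrite e expr1 mulrA.
  by rewrite mulrBl mul1r addrC subrK mulrA.
by apply/unitrPr; exists y.
Qed.

Lemma pdvd_sep (x : W) : (forall N, pdvd N x) -> x = 0.
Proof. by move=> dx; apply: W_separated => N; apply/pdvd_natmul. Qed.

Lemma pdvd_cancel N N' (x : W) : pdvd (N + N') (p%:R ^+ N * x) -> pdvd N' x.
Proof.
move=> [y]; rewrite exprD -mulrA => /mulfI -> //; first by exists y.
by rewrite expf_neq0 ?p_neq0.
Qed.

(** Integers prime to p are units of W. *)
Lemma nat_pfactor d : (0 < d)%N ->
  exists2 u : W, u \is a GRing.unit & d%:R = p%:R ^+ logn p d * u.
Proof.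
move=> d_gt0; have [e pe {1}->] := pfactor_coprime p_prime d_gt0.
exists e%:R; last by rewrite natrM natrX mulrC.
apply: W_unit; rewrite rmorph_nat -(dvdn_pcharf char_k).
by rewrite -prime_coprime ?p_prime.
Qed.

Lemma natW_neq0 d : (0 < d)%N -> d%:R != 0 :> W.
Proof.
move=> /nat_pfactor [u uu ->]; rewrite mulf_neq0 ?expf_neq0 ?p_neq0 //.
by apply: contraTneq uu => ->; rewrite unitr0.
Qed.

Lemma pow_div_nat n d : (0 < d)%N -> (logn p d <= n)%N ->
  exists2 y : W, pdvd (n - logn p d) y & p%:R ^+ n = y * d%:R.
Proof.
move=> d_gt0 le; have [u uu ->] := nat_pfactor d_gt0.
exists (p%:R ^+ (n - logn p d) * u^-1); first exact: pdvd_pow.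
by rewrite mulrACA -exprD subnK // mulVr ?mulr1.
Qed.

Lemma logn_fact_le n : (logn p n`! <= n)%N.
Proof.
case: n => [|n]; first by rewrite logn1.
have := logn_fact_bound p_prime (ltn0Sn n); have := prime_gt1 p_prime.
by case: (p) => [|[|q]] // _; rewrite subSS subn0 mulSn; lia.
Qed.

Lemma pow_div_fact n :
  exists2 y : W, pdvd (0 < n)%N y & p%:R ^+ n = y * n`!%:R.
Proof.
have [y dy e] := pow_div_nat (fact_gt0 n) (logn_fact_le n); exists y => //.
apply: pdvd_le dy; case: n {e} => [|n] //=.
have := logn_fact_bound p_prime (ltn0Sn n); have := prime_gt1 p_prime.
by case: (p) => [|[|q]] // _; rewrite subSS subn0 mulSn; lia.
Qed.

Lemma natK_neq0 d : (0 < d)%N -> d%:R != 0 :> K.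
Proof. by move=> /natW_neq0; rewrite -(rmorph_nat F) tofrac_eq0. Qed.

Lemma fracE (x : K) : x = F \n_(repr x) / F \d_(repr x).
Proof.
have d0 : F \d_(repr x) != 0 by rewrite tofrac_eq0 denom_ratioP.
apply: (mulIf d0); rewrite divfK //.
rewrite -{1}(reprK x); unlock tofrac; rewrite -[LHS]FracField.pi_mul.
apply/eqmodP; rewrite /= FracField.equivfE /FracField.mulf.
by rewrite !numden_Ratio ?mulf_neq0 ?denom_ratioP ?oner_neq0 // !mulr1 mulrC.
Qed.

Definition Kdvd N (x : K) := exists2 w, pdvd N w & x = F w.

Lemma Kdvd_le N N' x : (N' <= N)%N -> Kdvd N x -> Kdvd N' x.
Proof. by move=> le [w dw ->]; exists w => //; apply: pdvd_le dw. Qed.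
Lemma KdvdD N x y : Kdvd N x -> Kdvd N y -> Kdvd N (x + y).
Proof. by move=> [a da ->] [b db ->]; exists (a + b); rewrite ?tofracD //; apply: pdvdD. Qed.
Lemma KdvdN N x : Kdvd N x -> Kdvd N (- x).
Proof. by move=> [a da ->]; exists (- a); rewrite ?tofracN //; apply: pdvdN. Qed.
Lemma Kdvd0 N : Kdvd N 0.
Proof. by exists 0; rewrite ?tofrac0 //; apply: pdvd0. Qed.
Lemma KdvdM N N' x y : Kdvd N x -> Kdvd N' y -> Kdvd (N + N') (x * y).
Proof. by move=> [a da ->] [b db ->]; exists (a * b); rewrite ?tofracM //; apply: pdvdM. Qed.
Lemma Kdvd_sum N I (s : seq I) (P : pred I) (G : I -> K) :
  (forall i, P i -> Kdvd N (G i)) -> Kdvd N (\sum_(i <- s | P i) G i).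
Proof. by move=> dG; apply: big_ind => //; [apply: Kdvd0 | apply: KdvdD]. Qed.
Lemma KdvdF N w : Kdvd N (F w) <-> pdvd N w.
Proof.
split=> [[a da /eqP]|]; last by exists w.
by rewrite tofrac_eq => /eqP ->.
Qed.
Lemma Kdvd_sep x : (forall N, Kdvd N x) -> x = 0.
Proof.
move=> dx; have [w _ e] := dx 0%N; rewrite e in dx *.
by rewrite (pdvd_sep (fun N => (KdvdF N w).1 (dx N))) tofrac0.
Qed.
Lemma Kdvd_nat_cancel N d x :
  (0 < d)%N -> Kdvd (logn p d + N) (d%:R * x) -> Kdvd N x.
Proof.
move=> d_gt0 [w dw e].
have [u uu ed] := nat_pfactor d_gt0; case: (dw) => y ey; exists (u^-1 * (p%:R ^+ N * y)).
  exact/pdvdMl/pdvd_pow.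
apply: (mulfI (natK_neq0 d_gt0)); rewrite e -(rmorph_nat F) -tofracM; congr F.
by rewrite ed ey exprD -!mulrA; congr (_ * _); rewrite mulVKr.
Qed.

(** W is separated with residue field W / pW, so that a nonzero denominator is
    a power of p times a unit. *)
Lemma Kdvd_denom x : exists v, Kdvd 0 (p%:R ^+ v * x).
Proof.
set d := \d_(repr x); have d0 : d != 0 by apply: denom_ratioP.
have [[|v] [nd md]] : exists N, ~ pdvd N d /\ forall N', (N' < N)%N -> pdvd N' d.
  have ex : exists N, `[< ~ pdvd N d >].
    apply: contrapT => h; case/eqP: d0; apply: pdvd_sep => N.
    by apply: contrapT => nN; apply: h; exists N; apply/asboolP.
  case: (ex_minnP ex) => N /asboolP nN minN; exists N; split=> // N' lt.
  by apply: contrapT => h; have := minN N' (introT (asboolP _) h); rewrite leqNgt lt.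
- by case: nd; apply: pdvd_all.
have [u e] := md v (ltnSn v); have uu : u \is a GRing.unit.
  apply: W_unit; apply/eqP => /res_eq0 [z ez]; apply: nd; exists z.
  by rewrite e ez mulrA -exprD addn1.
exists v; exists (u^-1 * \n_(repr x)); first exact: pdvd_all.
rewrite [in LHS](fracE x) -/d e; set n := \n_(repr x).
have u0 : F u != 0 by rewrite tofrac_eq0; apply: contraTneq uu => ->; rewrite unitr0.
have pv0 : F (p%:R ^+ v) != 0 by rewrite tofrac_eq0 expf_neq0 ?p_neq0.
rewrite tofracM invfM [p%:R ^+ v](_ : _ = F (p%:R ^+ v)); last first.
  by rewrite rmorphXn rmorph_nat.
rewrite mulrCA (mulrA (F (p%:R ^+ v))) mulfV // mul1r tofracM mulrC; congr (_ * _).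
by apply: (mulfI u0); rewrite mulfV // -tofracM mulrV ?tofrac1.
Qed.

Local Notation cvg := (@padic_cvg p W).

Lemma cvgP u l : cvg u l <->
  forall N, exists D0, forall D, (D0 <= D)%N -> Kdvd N (l - u D).
Proof.
split=> c N; have [D0 h] := c N; exists D0 => D /h.
  by move=> [w ->]; exists (p%:R ^+ N * w) => //; apply: pdvd_pow.
by move=> [w [y ->] ->]; exists y.
Qed.

Lemma cvg_unique u l l' : cvg u l -> cvg u l' -> l = l'.
Proof.
move=> /cvgP c /cvgP c'; apply/eqP; rewrite -subr_eq0; apply/eqP.
apply: Kdvd_sep => N; have [D0 h] := c N; have [D1 h'] := c' N.
pose D := maxn D0 D1; rewrite -[l](subrK (u D)) -addrA.
apply: KdvdD; first by apply: h; apply: leq_maxl.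
by rewrite -opprB; apply/KdvdN/h'/leq_maxr.
Qed.

Lemma padic_limE u l : cvg u l -> padic_lim p u = l.
Proof.
by move=> c; apply: (cvg_unique (u := u)) => //; rewrite /padic_lim;
  apply: (xgetPex 0 (P := [set l0 | cvg u l0])); exists l.
Qed.

Lemma cvg_ext u v l D0 :
  (forall D, (D0 <= D)%N -> u D = v D) -> cvg u l -> cvg v l.
Proof.
move=> e c N; have [D1 h] := c N; exists (maxn D0 D1) => D.
by rewrite geq_max => /andP [d0 d1]; rewrite -e //; apply: h.
Qed.

Lemma cvg_const l : cvg (fun _ => l) l.
Proof. by apply/cvgP => N; exists 0%N => D _; rewrite subrr; apply: Kdvd0. Qed.

Lemma cvgD u v l l' : cvg u l -> cvg v l' -> cvg (fun D => u D + v D) (l + l').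
Proof.
move=> /cvgP c /cvgP c'; apply/cvgP => N.
have [D0 h] := c N; have [D1 h'] := c' N; exists (maxn D0 D1) => D.
rewrite geq_max => /andP [d0 d1]; rewrite opprD addrACA.
by apply: KdvdD; [apply: h | apply: h'].
Qed.

Lemma cvgZ a u l : cvg u l -> cvg (fun D => a * u D) (a * l).
Proof.
move=> /cvgP c; apply/cvgP => N; have [v dv] := Kdvd_denom a.
have [D0 h] := c (v + N)%N; exists D0 => D /h; rewrite -mulrBr => -[w [y ->] ->].
rewrite exprD -mulrA tofracM mulrA rmorphXn rmorph_nat (mulrC a).
by apply: (KdvdM (N := 0) dv); exists (p%:R ^+ N * y) => //; apply: pdvd_pow.
Qed.

Lemma cvgN u l : cvg u l -> cvg (fun D => - u D) (- l).
Proof.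
move=> /(cvgZ (-1)); rewrite mulN1r; apply: (cvg_ext (D0 := 0)) => D _.
by rewrite mulN1r.
Qed.

Lemma cvgB u v l l' : cvg u l -> cvg v l' -> cvg (fun D => u D - v D) (l - l').
Proof. by move=> cu /cvgN; apply: cvgD. Qed.

Lemma cvg_sum I (s : seq I) (u : I -> nat -> K) (l : I -> K) :
  (forall i, cvg (u i) (l i)) ->
  cvg (fun D => \sum_(i <- s) u i D) (\sum_(i <- s) l i).
Proof.
move=> c; elim: s => [|i s IH].
  by rewrite big_nil; apply: (cvg_ext (D0 := 0)) (cvg_const 0) => D _; rewrite big_nil.
rewrite big_cons; apply: (cvg_ext (D0 := 0)) (cvgD (c i) IH) => D _.
by rewrite big_cons.
Qed.

Lemma cvg_shift u l d : cvg u l -> cvg (fun D => u (D - d)%N) l.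
Proof.
move=> c N; have [D0 h] := c N; exists (D0 + d)%N => D le; apply: h.
by rewrite -(addnK d D0) leq_sub2r.
Qed.

Lemma cvg_nat_cancel d u l : (0 < d)%N ->
  cvg (fun D => d%:R * u D) (d%:R * l) -> cvg u l.
Proof.
move=> d_gt0 /(cvgZ d%:R^-1); rewrite mulKf ?natK_neq0 //.
by apply: (cvg_ext (D0 := 0)) => D _; rewrite mulKf ?natK_neq0.
Qed.

Lemma cvg_series (a : nat -> W) :
  (forall N, exists n0, forall n, (n0 <= n)%N -> pdvd N (a n)) ->
  exists l, cvg (fun D => F (\sum_(n < D) a n)) (F l).
Proof.
move=> /choice [n0 n0P]; pose M N := (\sum_(i < N.+1) n0 i)%N.
pose u N := \sum_(n < M N) a n.
have le0 N : (n0 N <= M N)%N by rewrite /M big_ord_recr leq_addl.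
have diff N D : (M N <= D)%N -> pdvd N (\sum_(n < D) a n - u N).
  move=> le; rewrite /u -!(big_mkord xpredT) (big_cat_nat (leq0n _) le) //= addrAC subrr add0r.
  rewrite big_nat_cond; apply: pdvd_sum => n /andP [/andP [ge _] _].
  by apply: n0P; apply: leq_trans ge.
have [N|l lP] := witt_complete W_witt (u := u).
  by apply: diff; rewrite /M [in X in (_ <= X)%N]big_ord_recr leq_addr.
exists l; apply/cvgP => N; exists (M N) => D le; rewrite -tofracB; apply/KdvdF.
rewrite -[l](subrK (u N)) -addrA; apply: pdvdD; first exact: lP.
by rewrite -opprB; apply/pdvdN/diff.
Qed.

Lemma cvg_pdvd N (u : nat -> W) l D0 :
  (forall D, (D0 <= D)%N -> pdvd N (u D)) -> cvg (fun D => F (u D)) (F l) -> pdvd N l.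
Proof.
move=> du /cvgP /(_ N) [D1 h]; pose D := maxn D0 D1.
rewrite -[l](subrK (u D)); apply: pdvdD; last exact/du/leq_maxl.
by apply/KdvdF; rewrite tofracB; apply/h/leq_maxr.
Qed.

End WittRing.

(** * The Frobenius of W *)

Section PrimeField.
(** X ^ p - X has no more than the p roots 0, 1, .., p - 1. *)
Lemma frobenius_fixed (p : nat) (k : fieldType) (x : k) :
  p \in [pchar k] -> x ^+ p = x -> exists d : nat, x = d%:R.
Proof.
move=> ch xp; have p_pr := pcharf_prime ch; have p1 := prime_gt1 p_pr.
pose s : seq k := [seq i%:R | i <- iota 0 p]; have [xs|xs] := boolP (x \in s).
  by have /mapP [d _ ->] := xs; exists d.
pose P : {poly k} := 'X^p - 'X.
have sP : size P = p.+1 by rewrite size_polyDl ?size_polyN ?size_polyXn ?size_polyX.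
have Fr (y : k) : root P y = (y ^+ p == y).
  by rewrite rootE !hornerE subr_eq0.
have us : uniq (x :: s).
  rewrite /= xs map_inj_in_uniq ?iota_uniq // => i j.
  rewrite !mem_iota !add0n /= => ip jp.
  wlog le : i j ip jp / (i <= j)%N => [hw e|].
    by case/orP: (leq_total i j) => le; [apply: hw | apply/esym/hw].
  move/eqP; rewrite eq_sym -subr_eq0 -natrB // -(dvdn_pcharf ch) => d.
  apply/eqP; rewrite eqn_leq le /= -subn_eq0.
  by apply: contraTT d; rewrite -lt0n => lt; rewrite gtnNdvd //; lia.
have rs : all (root P) (x :: s).
  rewrite /= Fr xp eqxx /=; apply/allP => y /mapP [i _ ->]; rewrite Fr.
  by have := pFrobenius_autE ch (i%:R : k); rewrite pFrobenius_aut_nat => <-.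
have P0 : P != 0 by rewrite -size_poly_gt0 sP.
by have := max_poly_roots P0 rs us; rewrite sP /= size_map size_iota ltnn.
Qed.
End PrimeField.

Section WittFrobenius.
Variables (p : nat) (k : closedFieldType) (W : idomainType).
Variables (res : {rmorphism W -> k}) (sigma : {rmorphism W -> W}).
Hypothesis (char_k : p \in [pchar k]) (W_witt : witt_ring p res).
Hypothesis (sigma_frob : forall x, res (sigma x) = res x ^+ p).
Local Notation K := {fraction W}.
Local Notation F := (@tofrac W).
Local Notation pdvd := (pdvd p).
Local Notation Kdvd := (@Kdvd p W).
Let p_pr := p_prime char_k.

Lemma sigma_pdvd N x : pdvd N (sigma x) -> pdvd N x.
Proof.
elim: N x => [|N IH] x; first by move=> _; apply: pdvd_all.
move=> dx; have /(res_eq0 W_witt) r0 := pdvd_le (ltn0Sn N) dx.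
have : res x = 0 by apply/eqP; move/eqP: r0; rewrite sigma_frob expf_eq0 => /andP [].
move=> /(res_eq0 W_witt) [y ey]; move: dx.
rewrite ey -[N.+1]add1n rmorphM rmorphXn rmorph_nat => /(pdvd_cancel W_witt) /IH dy.
by apply: pdvdM dy; exists 1; rewrite mulr1.
Qed.

Lemma sigma_eq0 x : sigma x = 0 -> x = 0.
Proof.
by move=> e; apply: (pdvd_sep W_witt) => N; apply: sigma_pdvd; rewrite e; apply: pdvd0.
Qed.

Lemma sigma_neq0 x : x != 0 -> sigma x != 0.
Proof. by apply: contraNneq => /sigma_eq0 ->. Qed.

Lemma fracmap_frac a b : b != 0 ->
  fracmap sigma (F a / F b) = F (sigma a) / F (sigma b).
Proof.
move=> b0; rewrite /fracmap; set x := F a / F b.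
set n := \n_(repr x); set d := \d_(repr x).
have d0 : d != 0 by apply: denom_ratioP.
have /eqP e : F a / F b = F n / F d by rewrite -fracE.
apply/eqP; move: e; rewrite !eqr_div ?tofrac_eq0 ?sigma_neq0 // -!tofracM !tofrac_eq.
by rewrite -!rmorphM => /eqP <-.
Qed.

Lemma fracmapF w : fracmap sigma (F w) = F (sigma w).
Proof.
have := @fracmap_frac w 1 (oner_neq0 _).
by rewrite rmorph1 !tofrac1 !divr1.
Qed.

Fact fracmap_zmod : zmod_morphism (fracmap sigma).
Proof.
move=> x y; rewrite (fracE x) (fracE y); set a := \n__; set b := \d__.
set c := \n_(repr y); set d := \d_(repr y).
have [b0 d0] : b != 0 /\ d != 0 by split; apply: denom_ratioP.
rewrite -mulNr -tofracN addf_div ?tofrac_eq0 // -!tofracM -tofracD.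
rewrite !fracmap_frac ?mulf_neq0 // -mulNr -tofracN addf_div ?tofrac_eq0 ?sigma_neq0 //.
by rewrite -!tofracM -tofracD !(rmorphD, rmorphM, rmorphN).
Qed.

Fact fracmap_monoid : monoid_morphism (fracmap sigma).
Proof.
split=> [|x y]; first by rewrite -tofrac1 fracmapF rmorph1.
rewrite (fracE x) (fracE y); set a := \n__; set b := \d__.
set c := \n_(repr y); set d := \d_(repr y).
have [b0 d0] : b != 0 /\ d != 0 by split; apply: denom_ratioP.
rewrite mulf_div -!tofracM !fracmap_frac ?mulf_neq0 // mulf_div -!tofracM.
by rewrite !rmorphM.
Qed.

Definition fracmor : {rmorphism K -> K} :=
  HB.pack (fracmap sigma) (GRing.isZmodMorphism.Build K K _ fracmap_zmod)
    (GRing.isMonoidMorphism.Build K K _ fracmap_monoid).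

Lemma fracmorF w : fracmor (F w) = F (sigma w). Proof. exact: fracmapF. Qed.

Lemma Kdvd_fracmor N x : Kdvd N x -> Kdvd N (fracmor x).
Proof. by move=> [w dw ->]; exists (sigma w); rewrite ?fracmorF //; apply: pdvd_rmorph. Qed.

(** The residue of a fixed element is fixed by the p-power map, hence is an
    integer; removing it and dividing by p gives the next digit. *)
Lemma sigma_fixed_Zp c : sigma c = c -> in_Zp p c.
Proof.
move=> + N; elim: N c => [|N IH] c fc; first by exists 0, c; rewrite subr0 mul1r.
have [d ed] : exists d : nat, res c = d%:R.
  by apply: (frobenius_fixed char_k); rewrite -sigma_frob fc.
have /(res_eq0 W_witt) [c' ec] : res (c - d%:R) = 0.
  by rewrite rmorphB rmorph_nat ed subrr.
rewrite expr1 in ec; have [|z [w ew]] := IH c'.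
  apply: (mulfI (p_neq0 W_witt)); rewrite -ec -[p%:R](rmorph_nat sigma) -rmorphM -ec.
  by rewrite rmorphB fc rmorph_nat.
exists (d%:Z + p%:Z * z), w; rewrite intrD intrM -!pmulrn opprD addrA ec -mulrBr ew.
by rewrite mulrA -exprS.
Qed.

(** Modulo p the equation is x ^ p = u, which is solvable in k. *)
Lemma sigma_sub_p_surj u : exists x, sigma x - p%:R * x = u.
Proof.
pose L := (sigma : W -> W) \- GRing.mull_fun p%:R idfun.
have [||E|x <-] := psolve (p := p) (L := L) _ _ _ u; last by exists x.
- exact: W_complete W_witt.
- exact: W_separated W_witt.
have [y ey] : exists y, y ^+ p = res E.
  have p0 := prime_gt0 p_pr.
  have [y yP] := @solve_monicpoly k p (fun i => if i == 0%N then res E else 0) p0.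
  exists y; rewrite yP; case: (p) p0 => // q _.
  by rewrite big_ord_recl big1 ?addr0 ?mulr1 // => i _; rewrite mul0r.
have [C eC] := witt_surj W_witt y.
have /(res_eq0 W_witt) [z ez] : res (sigma C - E) = 0.
  by rewrite rmorphB sigma_frob eC ey subrr.
exists C, (z - C); rewrite /L /= -[sigma C](subrK E) ez expr1 -[RHS]addrC.
by rewrite -[(z - C) *+ p]mulr_natl mulrBr addrAC.
Qed.

(** If p ^ N divides w, then p ^ (N + 1) divides p w = sigma w, hence w. *)
Lemma sigma_eq_p w : sigma w = p%:R * w -> w = 0.
Proof.
move=> e; apply: (pdvd_sep W_witt) => N; elim: N => [|N IH]; first exact: pdvd_all.
apply: sigma_pdvd; rewrite e -[N.+1]add1n; apply: pdvdM IH.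
by exists 1; rewrite mulr1.
Qed.

End WittFrobenius.

Section SeriesUnits.
Variables (p m : nat) (k : closedFieldType) (W : idomainType).
Variables (res : {rmorphism W -> k}).
Hypothesis (char_k : p \in [pchar k]) (W_witt : witt_ring p res).
Local Notation A := (mseries m W).

(** The inverse is the geometric series: only finitely many powers of x
    contribute to a given coefficient. *)
Lemma geometric_inverse (R : comNzRingType) (x : mseries m R) :
  x 0%MM = 0 -> exists y, (1 - x) * y = 1.
Proof.
move=> /vanish1 x0; pose S N := \sum_(i < N) x ^+ i.
pose y := MSeries (fun l : 'X_{1..m} => S (mdeg l).+1 l).
exists y; apply: mseriesP => l.
have yS : eq_upto (mdeg l).+1 y (S (mdeg l).+1).
  move=> l' ; rewrite ltnS /y /= => le.
  rewrite /S -!(big_mkord xpredT) [in RHS](big_cat_nat (n := (mdeg l').+1)) // scoefD.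
  rewrite [X in _ + X](_ : _ = 0) ?addr0 // scoef_sum big_nat_cond big1 // => i.
  move=> /andP [/andP [ge _] _]; have := @vanishX _ _ 1 x i x0.
  by rewrite mul1n; apply.
rewrite (eq_uptoM (f := 1 - x) (f' := 1 - x) _ yS (ltnSn _)) //.
rewrite /S -(opprB x 1) mulNr -subrX1 opprB scoefB.
by have := @vanishX _ _ 1 x (mdeg l).+1 x0; rewrite mul1n => ->; rewrite ?subr0.
Qed.

Lemma series_unit (f : A) : res (f 0%MM) != 0 -> f \is a GRing.unit.
Proof.
move=> /(W_unit W_witt) u; set c := f 0%MM in u.
have [|y] := @geometric_inverse _ (1 - sconst m c^-1 * f).
  by rewrite scoefB scoef_sconstM scoef1 eqxx mulVr ?subrr.
rewrite opprB addrC subrK => e; apply/unitrPr; exists (sconst m c^-1 * y).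
by rewrite mulrCA mulrA.
Qed.

Lemma series_unit1p (y : A) : 1 + p%:R * y \is a GRing.unit.
Proof.
apply: series_unit; rewrite scoefD scoef_natM scoef1 eqxx rmorphD rmorph1 rmorphM.
by rewrite (res_p _ char_k) mul0r addr0 oner_neq0.
Qed.

Lemma tlog_unit r (i : 'I_m) : (r <= i)%N -> @tlog m W r i \is a GRing.unit.
Proof.
move=> ri; apply: series_unit; rewrite /tlog ifN -?leqNgt // scoefD scoef1 eqxx.
by rewrite scoef_var0 addr0 rmorph1 oner_neq0.
Qed.

Lemma series_complete : pcomplete p A.
Proof. exact/pcomplete_series/(W_complete W_witt). Qed.
Lemma series_separated : pseparated p A.
Proof. exact/pseparated_series/(W_separated W_witt). Qed.

Lemma seriesMn_eq0 (f : A) d : (0 < d)%N -> f *+ d = 0 -> f = 0.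
Proof.
move=> d0 e; apply: mseriesP => l; apply: (mulfI (natW_neq0 char_k W_witt d0)).
by rewrite scoef0 mulr0 mulr_natl -scoefMn e scoef0.
Qed.
Lemma seriesMn_inj d : (0 < d)%N -> injective (fun f : A => f *+ d).
Proof.
move=> d0 f g e; apply/eqP; rewrite -subr_eq0; apply/eqP/(seriesMn_eq0 d0).
by rewrite mulrnBl e subrr.
Qed.
End SeriesUnits.

(** * Lang's theorem for GL_n *)

Section Lang.
Variables (p : nat) (k : closedFieldType).
Hypothesis char_k : p \in [pchar k].
Let p_pr : prime p := pcharf_prime char_k.
Let p_gt1 : (1 < p)%N := prime_gt1 p_pr.
Let p_gt0 : (0 < p)%N := prime_gt0 p_pr.

Local Notation fr := (pFrobenius_aut char_k).
Local Notation frmx := (map_mx (pFrobenius_aut char_k)).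

Lemma artin_schreier (c : k) : exists y, fr y + c = y.
Proof.
have [y yP] := @solve_monicpoly k p (fun i => if i == 0%N then - c else (i == 1%N)%:R) p_gt0.
exists y; rewrite pFrobenius_autE yP -{2}[y]expr1.
case: (p) p_gt1 => [|[|q]] // _; rewrite big_ord_recl big_ord_recl big1 => [|i _].
  by rewrite /= mulr1 mul1r addr0 addrC addrA addrN add0r.
by rewrite /= mul0r.
Qed.

Lemma artin_schreier_mx m n (E : 'M[k]_(m, n)) : exists D, frmx D + E = D.
Proof.
have /choice [y yP] := fun ij : 'I_m * 'I_n => artin_schreier (E ij.1 ij.2).
by exists (\matrix_(i, j) y (i, j)); apply/matrixP => i j; rewrite !mxE yP.
Qed.

Section FixedVector.
Variables (n : nat) (P : 'M[k]_n.+1).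
Hypothesis P_unit : P \in unitmx.
Local Notation Fr := (fun v : 'cV[k]_n.+1 => P *m frmx v).

Let Fr0 v : Fr v = 0 -> v = 0.
Proof.
move=> /(congr1 (mulmx (invmx P))); rewrite mulKmx // mulmx0 => e.
apply/matrixP => i j; move/matrixP/(_ i j)/eqP: e.
by rewrite !mxE pFrobenius_autE expf_eq0 => /andP [_ /eqP].
Qed.

Variable v : 'cV[k]_n.+1.
Hypothesis v_neq0 : v != 0.
Let e i := iter i Fr v.
Let dependent M := exists c : nat -> k, e M = \sum_(i < M) c i *: e i.

Let e_neq0 i : e i <> 0.
Proof. by elim: i => [|i IH]; [apply/eqP | move=> /Fr0]. Qed.

Let dependent_ex : exists M, dependent M.
Proof.
pose X := fix X M := if M is M'.+1 then e M' :: X M' else [::].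
have coefs M w : w \in <<X M>>%VS -> exists c : nat -> k, w = \sum_(i < M) c i *: e i.
  elim: M w => [|M IH] w.
    by rewrite span_nil memv0 => /eqP ->; exists (fun _ => 0); rewrite big_ord0.
  rewrite span_cons => /memv_addP [_ /vlineP [a ->] [w' /IH [c ->] ->]].
  exists (fun i => if (i < M)%N then c i else a).
  rewrite big_ord_recr /= ltnn addrC; congr (_ + _).
  by apply: eq_bigr => i _; rewrite ltn_ord.
apply: contrapT => none.
have fX M : free (X M).
  elim: M => [|M IH] /=; first exact: nil_free.
  by rewrite free_cons IH andbT; apply/negP => /coefs h; apply: none; exists M.
have sX M : size (X M) = M by elim: M => [|M IH] //=; rewrite IH.
have := dimvS (subvf <<X n.+2>>%VS).
by move: (fX n.+2); rewrite /free => /eqP ->; rewrite sX dimvf dim_matrix; lia.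
Qed.

(** In a shortest relation e M = sum_(i < M) c i e i, the vector
    sum_(i < M) y i e i is fixed if y 0 = c 0 z ^ p and
    y (i + 1) = y i ^ p + c (i + 1) z ^ p, where z = y (M - 1).  Writing
    y i = z ^ p R i, this is the equation z ^ (p - 1) R (M - 1) = 1 in z. *)
Lemma fixed_vector_aux : exists x : 'cV_n.+1, x != 0 /\ P *m frmx x = x.
Proof.
have ex : exists M, `[< dependent M >].
  by have [M dM] := dependent_ex; exists M; apply/asboolP.
case: (ex_minnP ex) => M /asboolP [c cP] minM {ex}.
case: M => [|M] in cP minM *.
  by case: (e_neq0 (i := 0)); rewrite cP big_ord0.
pose R := fix R i : {poly k} :=
  if i is j.+1 then 'X^(p * p - p) * R j ^+ p + (c j.+1)%:P else (c 0%N)%:P.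
have pp : (0 < p * p - p)%N by rewrite subn_gt0; nia.
have R0 i : R i = 0 -> forall j, (j <= i)%N -> c j = 0.
  elim: i => [|i IH] Ri j.
    by rewrite leqn0 => /eqP ->; apply/eqP; rewrite -polyC_eq0 -[_%:P]/(R 0%N) Ri.
  have ci : c i.+1 = 0.
    move/(congr1 (fun Q : {poly k} => Q.[0])): Ri.
    by rewrite /= !hornerE expr0n eqn0Ngt pp mul0r add0r.
  rewrite leq_eqVlt ltnS => /orP [/eqP -> //|]; apply: IH.
  move/eqP: Ri; rewrite /= ci addr0 mulf_eq0 expf_eq0 polyX_eq0 andbF /=.
  by rewrite expf_eq0 => /andP [_ /eqP].
pose G := 'X^(p.-1) * R M - 1.
have G0 : G.[0] = -1.
  by rewrite /G !hornerE expr0n; case: (p) p_gt1 => [|[|q]] //= _; rewrite mul0r sub0r.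
have /closed_rootP [z /eqP] : size G != 1%N.
  apply/negP => /size_poly1P [a a0 Ga].
  have aE : a = -1 by rewrite -G0 Ga hornerC.
  case: (e_neq0 (i := M.+1)); rewrite cP big1 // => i _.
  rewrite (R0 M) ?scale0r // -1?ltnS //.
  move/eqP: Ga; rewrite /G aE polyCN -subr_eq0 opprK subrK mulf_eq0.
  by rewrite expf_eq0 polyX_eq0 andbF /= => /eqP.
rewrite /G !hornerE => /eqP; rewrite subr_eq0 => /eqP zR.
have z0 : z != 0.
  apply: contraTneq isT => z0; move/eqP: zR; rewrite z0 expr0n.
  by case: (p) p_gt1 => [|[|q]] //= _; rewrite mul0r eq_sym oner_eq0.
pose y i := z ^+ p * (R i).[z].
have yM : y M = z.
  by rewrite /y -{1}(prednK p_gt0) exprS -mulrA zR mulr1.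
have yS i : y i.+1 = y i ^+ p + c i.+1 * z ^+ p.
  rewrite /y /= !hornerE mulrDr exprMn -exprM mulrA -exprD (mulrC (c _)).
  by rewrite subnKC //; nia.
exists (\sum_(i < M.+1) y i *: e i); split.
  apply/eqP => x0; have : dependent M; last first.
    by move=> h; have := minM M (introT (asboolP _) h); rewrite ltnn.
  exists (fun i => - z^-1 * y i); apply: (scalerI z0).
  move/eqP: x0; rewrite big_ord_recr /= yM addr_eq0 -[X in _ == - X]opprK => /eqP.
  rewrite opprK => x0; rewrite -[LHS]opprK -x0 scaler_sumr -sumrN.
  by apply: eq_bigr => i _; rewrite scalerA mulrA mulrN mulfV // mulN1r scaleNr.
have FrD a b : frmx (a + b) = frmx a + frmx b :> 'cV[k]_n.+1 by rewrite map_mxD.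
have FrS (s : seq nat) (f : nat -> k) :
    Fr (\sum_(i <- s) f i *: e i) = \sum_(i <- s) f i ^+ p *: e i.+1.
  elim: s => [|i s IH]; first by rewrite !big_nil map_mx0 mulmx0.
  rewrite !big_cons /= map_mxD mulmxDr map_mxZ -scalemxAr [X in _ + X]IH.
  by rewrite /= pFrobenius_autE.
have := FrS (index_iota 0 M.+1) y; rewrite !(big_mkord xpredT) => ->.
have -> : \sum_(i < M.+1) y i ^+ p *: e i.+1 =
  \sum_(i < M) y i ^+ p *: e i.+1 + y M ^+ p *: e M.+1 by exact: big_ord_recr.
rewrite yM cP scaler_sumr [in X in _ + X]big_ord_recl [RHS]big_ord_recl.
rewrite addrCA; congr (_ + _); first by rewrite scalerA /y /= hornerC.
rewrite -big_split; apply: eq_bigr => i _ /=.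
by rewrite /bump /= add1n yS scalerDl scalerA mulrC.
Qed.
End FixedVector.

Lemma fixed_vector n (P : 'M[k]_n.+1) : P \in unitmx ->
  exists x : 'cV_n.+1, x != 0 /\ P *m frmx x = x.
Proof.
move=> uP; apply: (fixed_vector_aux uP (v := const_mx 1)).
apply/eqP => /matrixP /(_ ord0 ord0) /eqP; rewrite !mxE.
by rewrite oner_eq0.
Qed.

(** Lang's theorem for GL_n: a fixed vector splits off, and the extension that
    remains is an Artin-Schreier equation. *)
Theorem lang n (P : 'M[k]_n) : P \in unitmx ->
  exists2 B, B \in unitmx & P *m frmx B = B.
Proof.
elim: n P => [|n IH] P uP; first by exists 1%:M; rewrite ?unitmx1 // flatmx0 [RHS]flatmx0.
have [x [x0 Px]] := fixed_vector uP.
pose U : 'rV[k]_(1 + n) := delta_mx 0 0.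
have Utr : U *m U^T = 1%:M.
  by rewrite trmx_delta mul_delta_mx; apply/matrixP => i j; rewrite !mxE !ord1.
have Uf : U *m (U^T *m x^T) = x^T by rewrite mulmxA Utr mul1mx.
have U0 : U != 0.
  apply/eqP => e; move: Utr; rewrite e mul0mx => /matrixP /(_ 0 0) /eqP.
  by rewrite !mxE eq_sym oner_eq0.
have [|B1t uB1t B1x] := @complete_unitmx _ _ _ U (U^T *m x^T).
  by rewrite Uf !rank_rV U0 trmx_eq0 x0.
pose B1 := B1t^T; have uB1 : B1 \in unitmx by rewrite unitmx_tr.
have B1U : B1 *m U^T = x by rewrite -trmx_mul -B1x Uf trmxK.
have frU : frmx U^T = U^T by rewrite -matrix.map_trmx map_delta_mx.
pose P' := invmx B1 *m P *m frmx B1.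
have P'U : P' *m U^T = U^T.
  by rewrite -{1}frU -mulmxA -map_mxM B1U -mulmxA Px -B1U mulKmx.
have uP' : P' \in unitmx by rewrite !unitmx_mul unitmx_inv uB1 uP map_unitmx uB1.
have PB : P *m frmx B1 = B1 *m P' by rewrite /P' !mulmxA mulmxV // mul1mx.
clearbody P'.
have blockP : P' = block_mx 1%:M (ursubmx P') 0 (drsubmx P').
  have P'0 i : P' i 0 = (i == 0)%:R.
    by move/matrixP/(_ i 0): P'U; rewrite trmx_delta -colE !mxE andbT.
  have l0 : lshift n 0 = 0 :> 'I_(1 + n) by apply: val_inj.
  rewrite -{1}[P']submxK; congr block_mx; apply/matrixP => i j; rewrite !ord1 !mxE l0 P'0 //.
have uP2 : drsubmx P' \in unitmx.
  by move: uP'; rewrite !unitmxE {1}blockP det_ublock det1 mul1r.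
have [B2 uB2 B2P] := IH _ uP2.
have [y yP] := artin_schreier_mx (ursubmx P' *m frmx B2).
pose B' : 'M[k]_(1 + n) := block_mx 1%:M y 0 B2.
have uB' : B' \in unitmx by rewrite unitmxE det_ublock det1 mul1r -unitmxE.
exists (B1 *m B'); first by rewrite unitmx_mul uB1.
rewrite map_mxM mulmxA PB -mulmxA; congr (_ *m _).
have frB : frmx B' = block_mx 1%:M (frmx y) 0 (frmx B2) :> 'M_(1 + n).
  by rewrite matrix.map_block_mx map_mx1 map_mx0.
transitivity (block_mx 1%:M (ursubmx P') 0 (drsubmx P')
              *m block_mx 1%:M (frmx y) 0 (frmx B2)); first by rewrite -frB -blockP.
rewrite mulmx_block !(mul1mx, mulmx1, mul0mx, mulmx0, addr0, add0r).
by rewrite B2P yP.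
Qed.

(** A Frobenius-fixed basis reduces P to the identity matrix. *)
Lemma lang_affine n (P E : 'M[k]_n) : P \in unitmx ->
  exists C, P *m frmx C + E = C.
Proof.
move=> /lang [B uB PB]; have [D eD] := artin_schreier_mx (invmx B *m E).
by exists (B *m D); rewrite map_mxM mulmxA PB -{2}eD mulmxDr mulKVmx.
Qed.
End Lang.

(** * Fixed bases of Frobenius matrices over power series *)

Section FrobeniusMatrices.
Variables (p m : nat) (k : closedFieldType) (W : idomainType).
Variables (res : {rmorphism W -> k}).
Hypothesis (char_k : p \in [pchar k]) (W_witt : witt_ring p res).
Local Notation A := (mseries m W).
Local Notation pdvd := (pdvd p).
Variable phi : {rmorphism A -> A}.
Hypothesis phi_frob : forall x, exists y, phi x = x ^+ p + p%:R * y.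
Let p_pr := p_prime char_k.
Let p_gt1 : (1 < p)%N := prime_gt1 p_pr.

(** The ideals (p) + (t) ^ s. *)
Definition pt_ideal s (x : A) := forall l, (mdeg l < s)%N -> pdvd 1 (x l).

Lemma pt_idealD s x y : pt_ideal s x -> pt_ideal s y -> pt_ideal s (x + y).
Proof. by move=> dx dy l ls; rewrite scoefD; apply: pdvdD; [apply: dx | apply: dy]. Qed.
Lemma pt_idealN s x : pt_ideal s x -> pt_ideal s (- x).
Proof. by move=> dx l ls; rewrite scoefN; apply/pdvdN/dx. Qed.
Lemma pt_idealB s x y : pt_ideal s x -> pt_ideal s y -> pt_ideal s (x - y).
Proof. by move=> dx /pt_idealN; apply: pt_idealD. Qed.
Lemma pt_ideal_p s x : pt_ideal s (p%:R * x).
Proof. by move=> l _; rewrite scoef_natM; exists (x l); rewrite expr1. Qed.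
Lemma pt_ideal_le s s' x : (s' <= s)%N -> pt_ideal s x -> pt_ideal s' x.
Proof. by move=> le dx l ls; apply/dx/(leq_trans ls). Qed.
Lemma pt_idealM s s' x y : pt_ideal s x -> pt_ideal s' y -> pt_ideal (s + s') (x * y).
Proof.
move=> dx dy l ls; apply: scoefM_ind; [exact: pdvd0 | exact: pdvdD | ].
move=> l1 l2 e; case: (ltnP (mdeg l1) s) => d1; first exact/pdvdMr/dx.
by apply/pdvdMl/dy; move: ls; rewrite e mdegD; lia.
Qed.
Lemma pt_idealMl s x y : pt_ideal s y -> pt_ideal s (x * y).
Proof. by move=> dy; apply: (@pt_idealM 0). Qed.
Lemma pt_ideal_sum s I (r : seq I) (P : pred I) (F : I -> A) :
  (forall i, P i -> pt_ideal s (F i)) -> pt_ideal s (\sum_(i <- r | P i) F i).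
Proof.
move=> dF; apply: big_ind => //; last exact: pt_idealD.
by move=> l _; rewrite scoef0; apply: pdvd0.
Qed.
Lemma pt_ideal_phi s x : (0 < s)%N -> pt_ideal s x -> pt_ideal s.+1 (phi x).
Proof.
move=> s0 dx; have [y ->] := phi_frob x; apply: pt_idealD; last exact: pt_ideal_p.
apply: (@pt_ideal_le (s + s)); first by lia.
have -> : p = (p - 2).+2 by rewrite -addn2 subnK.
by rewrite exprSr exprSr -mulrA; apply/pt_idealMl/pt_idealM.
Qed.

Definition residue : A -> k := res \o (@const_coef m W).
HB.instance Definition _ := GRing.RMorphism.on residue.

Lemma residueE x : residue x = res (x 0%MM). Proof. by []. Qed.
Lemma residue_phi x : residue (phi x) = residue x ^+ p.
Proof.
have [y ->] := phi_frob x.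
by rewrite rmorphD rmorphXn rmorphM rmorph_nat (pcharf0 char_k) mul0r addr0.
Qed.
Lemma residue_eq0 x : residue x = 0 <-> pt_ideal 1 x.
Proof.
rewrite residueE (res_eq0 W_witt); split=> [d l|]; last by apply; rewrite mdeg0.
by rewrite ltnS leqn0 mdeg_eq0 => /eqP ->.
Qed.

Lemma residue_surj (n : nat) (B : 'M[k]_n) : exists C : 'M[A]_n, map_mx residue C = B.
Proof.
have /choice [c cP] := fun ij : 'I_n * 'I_n => witt_surj W_witt (B ij.1 ij.2).
exists (\matrix_(i, j) sconst m (c (i, j))); apply/matrixP => i j.
by rewrite !mxE residueE /= eqxx cP.
Qed.

Lemma residue_unitmx n (B : 'M[A]_n) : map_mx residue B \in unitmx -> B \in unitmx.
Proof.
rewrite !unitmxE det_map_mx unitfE => u.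
by apply: series_unit u; apply: W_witt.
Qed.

Lemma residue_map_phi n (B : 'M[A]_n) :
  map_mx residue (map_mx phi B) = map_mx (pFrobenius_aut char_k) (map_mx residue B).
Proof. by apply/matrixP => i j; rewrite !mxE residue_phi pFrobenius_autE. Qed.

Section Equation.
Variables (n : nat) (P : 'M[A]_n).

(** Modulo p, phi is the p-th power map, which is contracting for the t-adic
    topology on series without constant term. *)
Lemma solve_mod_p (E C0 : 'M[A]_n) :
  (forall i j, pt_ideal 1 ((P *m map_mx phi C0 + E - C0) i j)) ->
  exists C E' : 'M[A]_n, P *m map_mx phi C + E - C = E' *+ p /\
    (forall i j, pt_ideal 1 ((C - C0) i j)).
Proof.
move=> start; pose T (C : 'M[A]_n) : 'M[A]_n := P *m map_mx phi C + E.
pose Cs := fix Cs j : 'M[A]_n := if j is j'.+1 then T (Cs j') else C0.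
have TP s (C C' : 'M[A]_n) : (0 < s)%N -> (forall i j, pt_ideal s ((C - C') i j)) ->
    forall i j, pt_ideal s.+1 ((T C - T C') i j).
  move=> s0 h i j; have -> : T C - T C' = P *m map_mx phi (C - C').
    by rewrite map_mxB mulmxBr /T opprD addrACA (subrr E) addr0.
  rewrite mxE.
  by apply: pt_ideal_sum => l _; apply: pt_idealMl; rewrite mxE; apply/pt_ideal_phi/h.
have dCs s i j : pt_ideal s.+1 ((Cs s.+1 - Cs s) i j).
  by elim: s i j => [|s IH]; [exact: start | exact: TP].
have dCsn s d i j : pt_ideal s.+1 ((Cs (s + d)%N - Cs s) i j).
  elim: d => [|d IH] in i j *.
    by rewrite addn0 subrr mxE => l _; rewrite scoef0; apply: pdvd0.
  rewrite addnS -[Cs _.+1](subrK (Cs (s + d)%N)) -addrA mxE; apply: pt_idealD => //.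
  by apply: pt_ideal_le (dCs _ _ _); rewrite ltnS leq_addr.
pose C : 'M[A]_n := \matrix_(i, j) MSeries (fun l => Cs (mdeg l) i j l).
have dC s i j : pt_ideal s.+1 ((C - Cs s) i j).
  move=> l; rewrite ltnS => ls; rewrite !mxE scoefB /=.
  have := dCsn (mdeg l) (s - mdeg l)%N i j l (ltnSn _); rewrite subnKC //.
  by rewrite !mxE scoefB => /pdvdN; rewrite opprB.
have dR s i j : pt_ideal s.+1 ((T C - C) i j).
  have -> : T C - C = T C - Cs s.+1 - (C - Cs s.+1) by rewrite opprB addrA subrK.
  rewrite mxE [X in _ + X]mxE; apply: pt_idealB; last exact: pt_ideal_le (dC s.+1 i j).
  have h := TP s.+1 C (Cs s) isT (dC s) i j.
  exact: pt_ideal_le (leqnSn s.+1) h.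
exists C; have /choice [r rP] : forall ij : 'I_n * 'I_n, exists r, (T C - C) ij.1 ij.2 = r *+ p.
  move=> ij; have [|r er] := (pdvd_coef p 1 ((T C - C) ij.1 ij.2)).2.
    by move=> l; apply: (dR (mdeg l)).
  by exists r; rewrite er expr1 mulr_natl.
exists (\matrix_(i, j) r (i, j)); split=> [|i j]; last exact: (dC 0%N).
by apply/matrixP => i j; rewrite mulmxnE [in RHS]mxE -rP.
Qed.

Hypothesis P_unit : P \in unitmx.

Let rP_unit : map_mx residue P \in unitmx.
Proof.
by move: P_unit; rewrite !unitmxE det_map_mx => u; apply: rmorph_unit.
Qed.

Let residue_start (E C0 : 'M[A]_n) :
  map_mx residue P *m map_mx (pFrobenius_aut char_k) (map_mx residue C0)
    + map_mx residue E = map_mx residue C0 ->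
  forall i j, pt_ideal 1 ((P *m map_mx phi C0 + E - C0) i j).
Proof.
move=> e i j; apply/residue_eq0.
move/matrixP/(_ i j): e; rewrite -residue_map_phi -map_mxM -map_mxD => /eqP.
by rewrite -subr_eq0 !mxE -rmorphB => /eqP.
Qed.

Let phi_scale (M : 'M[A]_n) d : map_mx phi (M *+ d) = map_mx phi M *+ d.
Proof. by rewrite raddfMn. Qed.

(** Modulo p and t this is an affine Lang equation over k; solve_mod_p makes the
    solution exact modulo p, and psolve makes it exact. *)
Lemma solve_affine (E : 'M[A]_n) : exists C, P *m map_mx phi C + E = C.
Proof.
pose L (C : 'M[A]_n) : 'M[A]_n := P *m map_mx phi C - C.
have LD : zmod_morphism L.
  by move=> C C'; rewrite /L map_mxB mulmxBr !opprB addrACA [RHS]addrACA [- _ - _]addrC.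
pose L' : {additive 'M[A]_n -> 'M[A]_n} := HB.pack L (GRing.isZmodMorphism.Build _ _ L LD).
have [||E'|C LC] := psolve (p := p) (L := L') _ _ _ (- E).
- exact/pcomplete_matrix/series_complete/W_witt.
- exact/pseparated_matrix/series_separated/W_witt.
- have [c ec] := lang_affine char_k (- map_mx residue E') rP_unit.
  have [C0 eC0] := residue_surj c.
  have [|C [E'' [e _]]] := @solve_mod_p (- E') C0.
    by apply: residue_start; rewrite eC0 map_mxN.
  by exists C, E''; rewrite -e /= /L [_ - E' - C]addrAC [RHS]addrC subrK.
have -> : E = C - P *m map_mx phi C by rewrite -[LHS]opprK -LC /= /L opprB.
by exists C; rewrite addrC subrK.
Qed.

(** Lang's theorem over k gives B modulo p and t, solve_mod_p corrects it modulo
    p, and solve_affine removes the error that is left. *)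
Lemma frobenius_fixed_basis : exists2 B, B \in unitmx & P *m map_mx phi B = B.
Proof.
have [b ub Pb] := lang char_k rP_unit; have [C0 eC0] := residue_surj b.
have [|C [E' [e dC]]] := @solve_mod_p 0 C0.
  by apply: residue_start; rewrite eC0 map_mx0 addr0.
have [D eD] := solve_affine E'.
have eB : map_mx residue (C + D *+ p) = b.
  rewrite -eC0; apply/matrixP => i j; rewrite !mxE rmorphD mulmxnE rmorphMn /=.
  rewrite -mulr_natl (pcharf0 char_k) mul0r addr0; apply/eqP.
  rewrite -subr_eq0 -rmorphB; apply/eqP/residue_eq0.
  by have := dC i j; rewrite !mxE.
exists (C + D *+ p); first by apply: residue_unitmx; rewrite eB.
rewrite map_mxD phi_scale mulmxDr -[P *m (_ *+ p)]/(mulmx P _) raddfMn /=.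
have -> : P *m map_mx phi C = C + E' *+ p by rewrite -e addr0 addrC subrK.
by rewrite -addrA -mulrnDl (addrC E') eD.
Qed.
End Equation.
End FrobeniusMatrices.

(** * Log derivations and liftings of the Frobenius *)

Section Theta.
Variables (m r : nat) (R : comNzRingType).
Local Notation A := (mseries m R).
Local Notation theta := (@theta m R r).
Local Notation t' := (@tlog m R r).
Implicit Types f g : A.

Lemma thetaD i f g : theta i (f + g) = theta i f + theta i g.
Proof. by rewrite /Defs.theta sderivD mulrDr. Qed.
Lemma thetaN i f : theta i (- f) = - theta i f.
Proof. by rewrite /Defs.theta sderivN mulrN. Qed.
Lemma thetaB i f g : theta i (f - g) = theta i f - theta i g.
Proof. by rewrite thetaD thetaN. Qed.
Lemma thetaMn i f d : theta i (f *+ d) = theta i f *+ d.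
Proof. by rewrite /Defs.theta sderivMn mulrnAr. Qed.
Lemma theta_sum i I (s : seq I) (P : pred I) (F : I -> A) :
  theta i (\sum_(j <- s | P j) F j) = \sum_(j <- s | P j) theta i (F j).
Proof. by rewrite /Defs.theta sderiv_sum mulr_sumr. Qed.
Lemma theta_const i c : theta i (sconst m c) = 0.
Proof. by rewrite /Defs.theta sderiv_const mulr0. Qed.
Lemma theta1 i : theta i 1 = 0. Proof. exact: theta_const. Qed.
Lemma thetaM i f g : theta i (f * g) = theta i f * g + f * theta i g.
Proof. by rewrite /Defs.theta sderivM mulrDr mulrA mulrCA. Qed.
Lemma theta_natM i d f : theta i (d%:R * f) = d%:R * theta i f.
Proof. by rewrite !mulr_natl thetaMn. Qed.
Lemma sderiv_tlog i j : sderiv i (t' j) = (i == j)%:R.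
Proof.
by rewrite /tlog; case: ifP => _; rewrite ?sderivD ?sderiv1 ?add0r sderiv_var.
Qed.
Lemma theta_tlogX i j d : theta i (t' j ^+ d) = (t' j ^+ d *+ d) *+ (i == j).
Proof.
rewrite /Defs.theta sderivX sderiv_tlog; case: eqP => [->|_].
  rewrite mulr1 mulr1n mulrnAr; case: d => [|d]; first by rewrite !mulr0n.
  by rewrite -exprS.
by rewrite mulr0 mul0rn mulr0 mulr0n.
Qed.

Lemma tlogX_inj i d f g : t' i ^+ d * f = t' i ^+ d * g -> f = g.
Proof.
elim: d f g => [|d IH] f g; first by rewrite !mul1r.
rewrite exprSr -!mulrA => /IH; rewrite /tlog; case: ifP => _; first exact: smono_inj.
have [|y e] := @geometric_inverse m R (- svar R i).
  by rewrite scoefN scoef_var0 oppr0.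
rewrite opprK in e; move/(congr1 (fun h => y * h)).
by rewrite !mulrA (mulrC y) e !mul1r.
Qed.
Lemma tlog_inj i f g : t' i * f = t' i * g -> f = g.
Proof. exact: (@tlogX_inj i 1). Qed.
End Theta.

Section Liftings.
Variables (p r m : nat) (k : closedFieldType) (W : idomainType).
Variables (res : {rmorphism W -> k}) (sigma : {rmorphism W -> W}).
Hypothesis (char_k : p \in [pchar k]) (W_witt : witt_ring p res).
Local Notation A := (mseries m W).
Local Notation pdvd := (pdvd p).
Local Notation t' := (@tlog m W r).
Local Notation lifting := (lifting p r m sigma).
Implicit Types phi : lifting.

Lemma pdvd1P (x : A) : pdvd 1 x <-> exists y, x = p%:R * y.
Proof. by split=> -[y ->]; exists y; rewrite expr1. Qed.

Lemma unit_const_coef (v : A) : v \is a GRing.unit -> ~ pdvd 1 (v 0%MM).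
Proof.
move=> /(rmorph_unit (@const_coef m W)) /(rmorph_unit res) u /(res_eq0 W_witt) e.
by have : res (v 0%MM) \is a GRing.unit := u; rewrite e unitr0.
Qed.

(** For a logarithmic coordinate t i, phi (t i) is a monomial times a unit,
    and it is congruent to t i ^ p; so the monomial is t i ^ p. *)
Lemma lfac_exists phi i :
  exists f, (exists y, f = 1 + p%:R * y) /\ phi (t' i) = t' i ^+ p * f.
Proof.
have [y ey] := lift_frobenius phi (t' i).
case: (ltnP i r) => ir; last first.
  have u := tlog_unit W_witt ir; exists (1 + p%:R * (t' i ^- p * y)).
  split; first by eexists.
  by rewrite mulrDr mulr1 ey mulrCA mulVKr ?unitrX.
have ti : t' i = smono W U_(i)%MM by rewrite /tlog ir.
have [|n [v [n0 uv ev]]] := lift_log phi (x := t' i).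
  exists U_(i)%MM, 1; split; rewrite ?unitr1 ?mulr1 // => j jr.
  by rewrite mnm1E; case: eqP => // e; move: ir; rewrite e ltnNge jr.
have tp : t' i ^+ p = smono W (U_(i) *+ p)%MM.
  by rewrite ti -!of_mpolyX -rmorphXn -mpolyXn.
have coefs l : v l = (smono W (U_(i) *+ p)%MM + p%:R * y) (n + l)%MM.
  by rewrite -tp -ey ev scoef_smonoDM.
have en : n = (U_(i) *+ p)%MM.
  apply/eqP; apply: contraT => ne; case: (unit_const_coef uv).
  rewrite coefs addm0 scoefD scoef_natM scoef_smono (negbTE ne) add0r.
  by exists (y n); rewrite expr1.
exists v; split; last by rewrite tp -en ev.
have /pdvd1P [z ez] : pdvd 1 (v - 1).
  apply/pdvd_coef => l; rewrite scoefB coefs en scoefD scoef_natM.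
  have -> : smono W (U_(i) *+ p)%MM (U_(i) *+ p + l)%MM = (1 : A) l.
    by rewrite -[smono W _]mulr1 scoef_smonoDM.
  by rewrite addrAC subrr add0r; exists (y (U_(i) *+ p + l)%MM); rewrite expr1.
by exists z; rewrite -ez addrC subrK.
Qed.

Lemma lfacP phi i :
  (exists y, lfac phi i = 1 + p%:R * y) /\ phi (t' i) = t' i ^+ p * lfac phi i.
Proof.
exact: (xgetPex 1 (P := [set f | (exists y, f = 1 + p%:R * y) /\
  phi (t' i) = t' i ^+ p * f]%classic) (lfac_exists phi i)).
Qed.

Lemma lfac_unique phi i f : phi (t' i) = t' i ^+ p * f -> lfac phi i = f.
Proof. by move=> e; apply: (@tlogX_inj _ r _ i p); rewrite -e (lfacP phi i).2. Qed.

Lemma lfac_unit phi i : lfac phi i \is a GRing.unit.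
Proof. by have [[y ->] _] := lfacP phi i; apply: (series_unit1p char_k W_witt). Qed.

(** Both p dlog t' and dlog (1 + p y) are divisible by p. *)
Lemma dlog_pull_dvd phi l : exists w, dlog_pull phi l = w *+ p.
Proof.
have [[y ey] _] := lfacP phi l.
exists (delta_mx 0 l + (lfac phi l)^-1 *: sd r y); rewrite mulrnDl; congr (_ + _).
rewrite scalerMnr; congr (_ *: _); apply/rowP => j.
by rewrite mulmxnE !mxE ey thetaD theta1 add0r theta_natM mulr_natl.
Qed.

Lemma theta_lift phi i l :
  theta r i (phi (t' l)) = phi (t' l) * dlog_pull phi l 0 i.
Proof.
have [_ e] := lfacP phi l; rewrite e thetaM theta_tlogX /dlog_pull !mxE.
rewrite mulrDr; congr (_ + _); last first.
  by rewrite -mulrA; congr (_ * _); rewrite mulVKr ?lfac_unit.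
rewrite mulmxnE mxE eqxx /= mulrnAr; case: eqP => _.
  by rewrite mulr1n mulr1 mulrnAl.
by rewrite mulr0n mul0r mulr0 mul0rn.
Qed.

Lemma divpowP (c : A) n : pdvd 1 c -> divpow c n *+ n`! = c ^+ n.
Proof.
move=> [y ->]; apply: (xgetPex 0 (P := [set d | d *+ n`! = (p%:R ^+ 1 * y) ^+ n]%classic)).
have [w _ e] := pow_div_fact char_k W_witt n; exists (sconst m w * y ^+ n) => /=.
rewrite expr1 exprMn -mulrnAl; congr (_ * _).
by rewrite -(rmorph_nat (@sconst m W)) -rmorphXn e rmorphM rmorph_nat mulr_natr.
Qed.

Lemma divpow0 (c : A) : pdvd 1 c -> divpow c 0 = 1.
Proof. by move=> /(divpowP 0); rewrite mulr1n. Qed.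

Lemma lfac_ratio phi phi' i : pdvd 1 (lfac phi i / lfac phi' i - 1).
Proof.
have [[y ey] _] := lfacP phi i; have [[y' ey'] _] := lfacP phi' i.
apply/pdvd1P; exists ((y - y') / lfac phi' i).
apply: (mulIr (lfac_unit phi' i)); rewrite mulrBl divrK ?lfac_unit // -!mulrA.
rewrite mulVr ?lfac_unit // mulr1 mul1r mulrBr ey ey'.
by rewrite opprD addrACA subrr add0r.
Qed.

Lemma chi_coef0 phi phi' : chi_coef phi phi' 0%MM = 1.
Proof.
by rewrite /chi_coef big1 // => i _; rewrite mnm0E divpow0 //; apply: lfac_ratio.
Qed.

Lemma box0 D : box [ffun _ : 'I_m => ord0 : 'I_D.+1] = 0%MM.
Proof. by apply/mnmP => i; rewrite mnmE ffunE mnm0E. Qed.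

Lemma box_eq0 D (n : {ffun 'I_m -> 'I_D.+1}) :
  (box n == 0%MM) = (n == [ffun _ => ord0]).
Proof.
apply/eqP/eqP => [e|->]; last exact: box0.
apply/ffunP => i; apply: val_inj; rewrite ffunE /=.
by move/mnmP/(_ i): e; rewrite mnmE mnm0E.
Qed.
End Liftings.

(** * Free modules and unit-root crystals *)

Section Bases.
Variables (A : comUnitRingType) (H : lmodType A).
Local Open Scope classical_set_scope.
Implicit Types (U : set H) (x : H).

Lemma lincombB n (c c' : {ffun 'I_n -> A}) (s : 'I_n -> H) :
  lincomb (c - c') s = lincomb c s - lincomb c' s.
Proof.
rewrite /lincomb -sumrB; apply: eq_bigr => i _.
by rewrite !ffunE scalerDl scaleNr.
Qed.

Lemma lincomb_ffun n (c : 'I_n -> A) (s : 'I_n -> H) :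
  lincomb [ffun i => c i] s = \sum_i c i *: s i.
Proof. by apply: eq_bigr => i _; rewrite ffunE. Qed.

Lemma lincombMn n (c : {ffun 'I_n -> A}) (s : 'I_n -> H) d :
  lincomb (c *+ d) s = lincomb c s *+ d.
Proof.
rewrite /lincomb -sumrMnl; apply: eq_bigr => i _.
by rewrite ffunMnE -scalerMnl.
Qed.

Lemma submod0 U : submod U -> U 0. Proof. by case. Qed.
Lemma submodZ U (a : A) x : submod U -> U x -> U (a *: x).
Proof. by move=> [U0 UP] Ux; rewrite -[a *: x]addr0; apply: UP. Qed.
Lemma submodD U x y : submod U -> U x -> U y -> U (x + y).
Proof. by move=> [U0 UP] Ux Uy; rewrite -[x]scale1r; apply: UP. Qed.
Lemma submodB U x y : submod U -> U x -> U y -> U (x - y).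
Proof. by move=> [U0 UP] Ux Uy; rewrite addrC -scaleN1r; apply: UP. Qed.
Lemma submod_sum U n (F : 'I_n -> H) : submod U -> (forall i, U (F i)) -> U (\sum_i F i).
Proof.
move=> sU UF; apply: big_ind => //; first exact: submod0.
by move=> x y; apply: submodD.
Qed.
Lemma submod_lincomb U n (c : {ffun 'I_n -> A}) (s : 'I_n -> H) :
  submod U -> (forall i, U (s i)) -> U (lincomb c s).
Proof. by move=> sU Us; apply: submod_sum => // i; apply: submodZ. Qed.
Lemma submodT : submod [set: H]. Proof. by []. Qed.

Lemma basis_span U n (s : 'I_n -> H) x : Defs.basis U s -> U x ->
  exists c : {ffun 'I_n -> A}, x = lincomb c s.
Proof.
move=> [_ bs] /bs [c [/= e _]]; exists c.
by apply/eqP; rewrite -subr_eq0; apply/eqP.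
Qed.
Lemma basis_spanT n (s : 'I_n -> H) x : Defs.basis [set: H] s ->
  exists c : {ffun 'I_n -> A}, x = lincomb c s.
Proof. by move=> bs; apply: (basis_span bs). Qed.
Lemma basis_indep U n (s : 'I_n -> H) (c : {ffun 'I_n -> A}) :
  submod U -> Defs.basis U s -> lincomb c s = 0 -> c = 0.
Proof.
move=> [U0 _] [_ bs] e; have [c' [_ uc]] := bs 0 U0.
rewrite -(uc c); last by rewrite /= e subrr.
by apply: uc; rewrite /= [lincomb _ _]big1 ?subrr // => i _; rewrite ffunE scale0r.
Qed.
Lemma basis_inj U n (s : 'I_n -> H) (c c' : {ffun 'I_n -> A}) :
  submod U -> Defs.basis U s -> lincomb c s = lincomb c' s -> c = c'.
Proof.
move=> sU bs e; apply/eqP; rewrite -subr_eq0; apply/eqP/(basis_indep sU bs).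
by rewrite lincombB e subrr.
Qed.
Lemma basis_sum_inj U n (s : 'I_n -> H) (c c' : 'I_n -> A) :
  submod U -> Defs.basis U s ->
  \sum_i c i *: s i = \sum_i c' i *: s i -> forall i, c i = c' i.
Proof.
move=> sU bs; rewrite -!lincomb_ffun => /(basis_inj sU bs) e i.
by move/ffunP/(_ i): e; rewrite !ffunE.
Qed.
Lemma basis_intro U n (s : 'I_n -> H) :
  (forall i, U (s i)) ->
  (forall x, U x -> exists c : {ffun 'I_n -> A}, x = lincomb c s) ->
  (forall c : {ffun 'I_n -> A}, lincomb c s = 0 -> c = 0) -> Defs.basis U s.
Proof.
move=> Us sp fr; split=> // x /sp [c ->]; exists c; split=> [|c']; first exact: subrr.
move=> /= /eqP e; apply/eqP; rewrite -subr_eq0; apply/eqP/fr.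
by rewrite lincombB; apply/eqP.
Qed.

Lemma lincomb_mx n (B : 'M[A]_n) (c : {ffun 'I_n -> A}) (s : 'I_n -> H) :
  \sum_j c j *: (\sum_i B i j *: s i) = \sum_i (B *m \col_j c j) i 0 *: s i.
Proof.
under eq_bigr do rewrite scaler_sumr.
rewrite exchange_big; apply: eq_bigr => i _; rewrite mxE scaler_suml.
by apply: eq_bigr => j _; rewrite scalerA mxE mulrC.
Qed.

Lemma basis_unitmx U n (s : 'I_n -> H) (B : 'M[A]_n) :
  submod U -> Defs.basis U s -> B \in unitmx -> Defs.basis U (fun j => \sum_i B i j *: s i).
Proof.
move=> sU bs uB; apply: basis_intro => [j|x|c].
- by apply: submod_sum => // i; apply: submodZ => //; apply: bs.1.
- move=> /(basis_span bs) [c ->]; pose d := invmx B *m \col_j c j.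
  exists [ffun j => d j 0]; rewrite [RHS]lincomb_mx.
  have -> : \col_j [ffun j => d j 0] j = d.
    by apply/colP => j; rewrite !mxE ffunE mxE.
  by apply: eq_bigr => i _; rewrite mulKVmx // mxE.
rewrite [lincomb _ _]lincomb_mx => e.
have e0 : \sum_i (B *m \col_j c j) i 0 *: s i = \sum_i 0 *: s i.
  by rewrite e big1 // => i _; rewrite scale0r.
have /(congr1 (mulmx (invmx B))) : B *m \col_j c j = 0.
  by apply/colP => i; rewrite (basis_sum_inj sU bs e0) mxE.
rewrite mulKmx // mulmx0 => /colP c0.
by apply/ffunP => j; move: (c0 j); rewrite !mxE ffunE.
Qed.

Lemma basis_change_unitmx U n (s s' : 'I_n -> H) (P : 'M[A]_n) :
  submod U -> Defs.basis U s -> Defs.basis U s' ->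
  (forall j, s' j = \sum_i P i j *: s i) -> P \in unitmx.
Proof.
move=> sU bs bs' e.
have /choice [q qP] : forall j, exists c : {ffun 'I_n -> A}, s j = lincomb c s'.
  by move=> j; apply: (basis_span bs'); apply: bs.1.
have PQ : P *m \matrix_(i, j) q j i = 1%:M.
  apply/matrixP => i j.
  have : \sum_l (P *m \col_l q j l) l 0 *: s l = \sum_l (l == j)%:R *: s l.
    rewrite -lincomb_mx [RHS](bigD1 j) //= eqxx scale1r [X in _ = _ + X]big1 ?addr0.
      by rewrite [RHS]qP; apply: eq_bigr => l _; rewrite e.
    by move=> l /negbTE ->; rewrite scale0r.
  move=> /(basis_sum_inj sU bs) /(_ i); rewrite [in X in _ -> X]mxE => e'.
  by rewrite [RHS]mxE -e' [RHS]mxE; apply: eq_bigr => l _; rewrite !mxE.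
by have [] := mulmx1_unit PQ.
Qed.
End Bases.

Section FreeModules.
Variables (p m : nat) (k : closedFieldType) (W : idomainType).
Variables (res : {rmorphism W -> k}).
Hypothesis (char_k : p \in [pchar k]) (W_witt : witt_ring p res).
Local Notation A := (mseries m W).
Variables (H : lmodType A) (n : nat) (s : 'I_n -> H).
Hypothesis bs : Defs.basis [set: H]%classic s.

Lemma free_torsion_free d (x : H) : (0 < d)%N -> x *+ d = 0 -> x = 0.
Proof.
move=> d0; have [c ->] := basis_spanT x bs.
rewrite -lincombMn => /(basis_indep (submodT _) bs) e.
rewrite [lincomb c s]big1 // => i _; have -> : c i = 0; last by rewrite scale0r.
apply: (seriesMn_eq0 char_k W_witt d0).
by move/ffunP/(_ i): e; rewrite ffunMnE ffunE.
Qed.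

Lemma free_separated (x : H) : (forall N, exists z, x = z *+ p ^ N) -> x = 0.
Proof.
move=> xP; have [c e] := basis_spanT x bs; rewrite e.
rewrite [lincomb c s]big1 // => i _; have -> : c i = 0; last by rewrite scale0r.
apply: (series_separated (m := m) W_witt) => N; have [z ez] := xP N.
have [d ed] := basis_spanT z bs; exists (d i).
move: ez; rewrite e ed -lincombMn => /(basis_inj (submodT _) bs) ->.
by rewrite ffunMnE.
Qed.
End FreeModules.

Section UnitRoot.
Variables (p r m : nat) (k : closedFieldType) (W : idomainType).
Variables (res : {rmorphism W -> k}) (sigma : {rmorphism W -> W}).
Hypothesis (char_k : p \in [pchar k]) (W_witt : witt_ring p res).
Local Notation A := (mseries m W).
Let p_pr := p_prime char_k.

Section Operators.
Variable X : Fcrystal p r m sigma.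
Implicit Types (x y : X) (a : A).

Lemma Fcrystal_torsion_free d x : (0 < d)%N -> x *+ d = 0 -> x = 0.
Proof.
by have [n [s bs]] := crys_free X; apply: (free_torsion_free char_k W_witt bs).
Qed.
Lemma Fcrystal_separated x : (forall N, exists z, x = z *+ p ^ N) -> x = 0.
Proof.
by have [n [s bs]] := crys_free X; apply: (free_separated W_witt bs).
Qed.

Lemma nablaE x y l : nabla (x + y) l = nabla x l + nabla y l.
Proof. by rewrite nablaD ffunE. Qed.
Lemma nabla_scale a x l : nabla (a *: x) l = theta r l a *: x + a *: nabla x l.
Proof. by rewrite nabla_leibniz !ffunE mxE. Qed.
Lemma nabla0 l : nabla (0 : X) l = 0.
Proof. by have := nablaE 0 0 l; rewrite addr0 => /eqP; rewrite -subr_eq subrr => /eqP. Qed.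
Lemma nablaMn x d l : nabla (x *+ d) l = nabla x l *+ d.
Proof. by elim: d => [|d IH]; rewrite ?mulr0n ?nabla0 // !mulrS nablaE IH. Qed.
Lemma nabla_sum n (F : 'I_n -> X) l : nabla (\sum_i F i) l = \sum_i nabla (F i) l.
Proof. by elim/big_rec2: _ => [|i y x _ <-]; rewrite ?nabla0 ?nablaE. Qed.
Lemma frob0 phi : frob phi (0 : X) = 0.
Proof. by have := frobD phi (0 : X) 0; rewrite addr0 => /eqP; rewrite -subr_eq subrr => /eqP. Qed.
Lemma frobMn phi x d : frob phi (x *+ d) = frob phi x *+ d.
Proof. by elim: d => [|d IH]; rewrite ?mulr0n ?frob0 // !mulrS frobD IH. Qed.
Lemma frob_sum phi n (F : 'I_n -> X) : frob phi (\sum_i F i) = \sum_i frob phi (F i).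
Proof. by elim/big_rec2: _ => [|i y x _ <-]; rewrite ?frob0 ?frobD. Qed.

Lemma frob_horizontalE phi x i :
  nabla (frob phi x) i = \sum_l dlog_pull phi l 0 i *: frob phi (nabla x l).
Proof.
rewrite frob_horizontal sum_ffunE; apply: eq_bigr => l _.
by rewrite ffunE.
Qed.

(** Frobenius is divisible by p on forms, so that for a fixed vector x
    divisibility of nabla x by p ^ N implies divisibility by p ^ (N + 1). *)
Lemma frob_fixed_horizontal phi x : frob phi x = x -> forall l, nabla x l = 0.
Proof.
move=> fx l; apply: Fcrystal_separated => N; elim: N l => [|N IH] l.
  by exists (nabla x l); rewrite mulr1n.
have [z zP] := choice IH; have [w wP] := choice (dlog_pull_dvd W_witt phi).
exists (\sum_j w j 0 l *: frob phi (z j)).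
rewrite -{1}fx frob_horizontalE -sumrMnl; apply: eq_bigr => j _.
by rewrite wP zP frobMn mulmxnE expnS mulrnA -scalerMnr -scalerMnl.
Qed.

Lemma nabla_prod_horizontal x n : (forall l, nabla x l = 0) ->
  nabla_prod n x = if n == 0%MM then x else 0.
Proof.
move=> hx; rewrite /nabla_prod.
have op0 d i : iteri d (fun j (z : X) => nabla z i - z *+ j) 0 = 0.
  by elim: d => [|d IH] //=; rewrite IH nabla0 mul0rn subrr.
have op d i : iteri d (fun j (z : X) => nabla z i - z *+ j) x = if d == 0%N then x else 0.
  case: d => [|d] //; elim: d => [|d IH]; first by rewrite /= hx mulr0n subrr.
  by rewrite iteriS IH /= nabla0 mul0rn subrr.
have gen (e : seq 'I_m) :
  foldr (fun i y => iteri (n i) (fun j (z : X) => nabla z i - z *+ j) y) x e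
    = if all (fun i => n i == 0%N) e then x else 0.
  elim: e => [|i e IH] //=; rewrite IH; case: ifP => _; last by rewrite op0 andbF.
  by rewrite op andbT.
rewrite gen; congr (if _ then _ else _).
apply/allP/eqP => [h|-> i _]; last by rewrite mnm0E.
by apply/mnmP => i; rewrite mnm0E; apply/eqP/h; rewrite mem_enum.
Qed.

(** On a horizontal vector only the term n = 0 of the comparison between two
    liftings is nonzero. *)
Lemma frob_fixed_all phi phi' x : frob phi x = x -> frob phi' x = x.
Proof.
move=> fx; have hx := frob_fixed_horizontal fx.
apply/eqP; rewrite -subr_eq0; apply/eqP/Fcrystal_separated => N.
have [D0 h] := frob_compat phi' phi x N.
have [z ez] := h (maxn D0 1) (leq_maxl _ _); exists z.
rewrite -ez; congr (_ - _); case: (maxn D0 1) (leq_maxr D0 1) => // D _.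
rewrite (bigD1 [ffun _ => ord0]) //= box0 (chi_coef0 char_k W_witt).
rewrite nabla_prod_horizontal // eqxx scale1r fx big1 ?addr0 // => n n0.
by rewrite nabla_prod_horizontal // box_eq0 (negbTE n0) frob0 scaler0.
Qed.
End Operators.

(** A Frobenius-fixed basis exists because the matrix of Frobenius is invertible;
    fixed vectors are horizontal, and are fixed for every lifting. *)
Theorem unit_root_horizontal_basis (V : Fcrystal p r m sigma) n (s : 'I_n -> V) :
  unit_root V -> Defs.basis [set: V]%classic s ->
  exists a : 'I_n -> V, [/\ Defs.basis [set: V]%classic a,
    forall j l, nabla (a j) l = 0 & forall phi j, frob phi (a j) = a j].
Proof.
move=> [phi iso] bs; have bFs := iso _ _ bs.
have /choice [P' P'P] : forall j, exists c : {ffun 'I_n -> A}, frob phi (s j) = lincomb c s.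
  by move=> j; apply: basis_spanT bs.
pose P : 'M[A]_n := \matrix_(i, j) P' j i.
have FsP j : frob phi (s j) = \sum_i P i j *: s i.
  by rewrite P'P; apply: eq_bigr => i _; rewrite mxE.
have uP := basis_change_unitmx (submodT _) bs bFs FsP.
have [B uB PB] := frobenius_fixed_basis char_k W_witt (lift_frobenius phi) uP.
pose a j := \sum_i B i j *: s i.
have fa j : frob phi (a j) = a j.
  rewrite frob_sum.
  transitivity (\sum_i [ffun i => phi (B i j)] i *: (\sum_l P l i *: s l)).
    by apply: eq_bigr => i _; rewrite frob_semilinear FsP ffunE.
  rewrite lincomb_mx; apply: eq_bigr => i _; congr (_ *: _).
  rewrite -[in RHS]PB !mxE; apply: eq_bigr => l _.
  by rewrite !mxE ffunE.
exists a; split; first exact: basis_unitmx.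
  by move=> j l; apply: (frob_fixed_horizontal (fa j)).
by move=> phi' j; apply: frob_fixed_all (fa j).
Qed.
End UnitRoot.

(** * Adapted bases *)

Section LinearOn.
Variables (A : comUnitRingType) (H V : lmodType A) (U : set H) (f : H -> V).
Local Open Scope classical_set_scope.
Hypothesis sU : submod U.
Hypothesis fP : forall (a : A) x y, U x -> U y -> f (a *: x + y) = a *: f x + f y.

Lemma linear_on0 : f 0 = 0.
Proof.
have := fP 1 (submod0 sU) (submod0 sU); rewrite !scale1r addr0 => /eqP.
by rewrite -subr_eq subrr => /eqP <-.
Qed.
Lemma linear_onZ a x : U x -> f (a *: x) = a *: f x.
Proof. by move=> Ux; have := fP a Ux (submod0 sU); rewrite linear_on0 !addr0. Qed.
Lemma linear_onD x y : U x -> U y -> f (x + y) = f x + f y.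
Proof. by move=> Ux Uy; have := fP 1 Ux Uy; rewrite !scale1r. Qed.
Lemma linear_onB x y : U x -> U y -> f (x - y) = f x - f y.
Proof. by move=> Ux Uy; rewrite addrC -scaleN1r fP // scaleN1r addrC. Qed.
Lemma linear_onMn x d : U x -> f (x *+ d) = f x *+ d.
Proof. by move=> Ux; rewrite -!scaler_nat linear_onZ. Qed.
Lemma linear_on_lincomb n (c : {ffun 'I_n -> A}) (s : 'I_n -> H) :
  (forall i, U (s i)) -> f (lincomb c s) = lincomb c (f \o s).
Proof.
move=> Us; suff [_ //] : U (lincomb c s) /\ f (lincomb c s) = lincomb c (f \o s).
rewrite /lincomb; elim/big_rec2: _ => [|i x y _ [Ux <-]].
  by split; [apply: submod0 | apply: linear_on0].
have Uc : U (c i *: s i) by apply: submodZ.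
split; first by rewrite -[X in U X]addrC; apply: submodD.
by rewrite linear_onD // linear_onZ.
Qed.

Variable S : set H.
Hypotheses (sS : submod S) (SU : forall x, S x -> U x).
Hypothesis f_surj : forall v, exists2 x, S x & f x = v.
Hypothesis f_inj : forall x, S x -> f x = 0 -> x = 0.

Let f_inj2 x y : S x -> S y -> f x = f y -> x = y.
Proof.
move=> Sx Sy e; apply/eqP; rewrite -subr_eq0; apply/eqP/f_inj; first exact: submodB.
by rewrite linear_onB ?e ?subrr; auto.
Qed.

Lemma basis_image n (s : 'I_n -> H) :
  Defs.basis S s -> Defs.basis [set: V] (f \o s).
Proof.
move=> bs; have Ss : forall i, S (s i) := bs.1; apply: basis_intro => //.
  move=> v _; have [x Sx <-] := f_surj v; have [c ->] := basis_span bs Sx.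
  by exists c; rewrite linear_on_lincomb; auto.
move=> c; rewrite -linear_on_lincomb; last by auto.
by move=> /(f_inj (submod_lincomb c sS Ss)) /(basis_indep sS bs).
Qed.

Lemma basis_lift n (a' : 'I_n -> V) : Defs.basis [set: V] a' ->
  exists a : 'I_n -> H, [/\ forall i, S (a i), forall i, f (a i) = a' i & Defs.basis S a].
Proof.
move=> ba; have /choice [a aP] : forall i, exists x, S x /\ f x = a' i.
  by move=> i; have [x Sx <-] := f_surj (a' i); exists x.
have Sa i : S (a i) := (aP i).1; have fa i : f (a i) = a' i := (aP i).2.
have fc c : f (lincomb c a) = lincomb c a'.
  rewrite linear_on_lincomb; last by auto.
  by apply: eq_bigr => i _ /=; rewrite fa.
exists a; split=> //; apply: basis_intro => // [x Sx|c].
  have [c e] := basis_spanT (f x) ba; exists c.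
  by apply: f_inj2 => //; [apply: submod_lincomb | rewrite fc].
move=> e; apply: (basis_indep (submodT V) ba).
by rewrite -fc e linear_on0.
Qed.
End LinearOn.

Section HodgeOrdinary.
Variables (p r m : nat) (k : closedFieldType) (W : idomainType).
Variables (res : {rmorphism W -> k}) (sigma : {rmorphism W -> W}).
Hypothesis (char_k : p \in [pchar k]) (W_witt : witt_ring p res).
Local Notation A := (mseries m W).
Let p_pr := p_prime char_k.
Variable H : hodge p r m sigma.
Local Open Scope classical_set_scope.

Lemma weight1_Fil2 : has_weight H 1 -> Fil H 2 = [set 0].
Proof.
move=> [rho1 [rho2 [[F1 _] [F2 max2] e]]]; apply: contrapT => n2.
have le2 := max2 _ n2; have r1 : rho1 = 0%N by lia.
by move: e; lia.
Qed.

Lemma sub_Fcrystal_stable (U : set H) : sub_Fcrystal U ->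
  [/\ submod U, forall x l, U x -> U (nabla x l) & forall phi x, U x -> U (frob phi x)].
Proof.
move=> [Y [f [[flin fnab ffrob] _ ->]]]; split.
- split=> [|a x y [x' _ <-] [y' _ <-]]; last first.
    by exists (a *: x' + y') => //; apply: flin.
  exists 0 => //; apply: (linear_on0 (U := [set: Y])) => //; exact: submodT.
- by move=> x l [x' _ <-]; exists (nabla x' l) => //; rewrite fnab.
- by move=> phi x [x' _ <-]; exists (frob phi x') => //; rewrite ffrob // mulr1n.
Qed.

Section UnitRootPart.
Variable U : set H.
Hypothesis U_unit_root : unit_root_part U.

Lemma unit_root_part_stable :
  [/\ submod U, forall x l, U x -> U (nabla x l) & forall phi x, U x -> U (frob phi x)].
Proof.
have [Us [sl <-]] := U_unit_root; have [_ sF _ _] := sl 0%N.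
exact: sub_Fcrystal_stable.
Qed.
Let sU : submod U. Proof. by have [] := unit_root_part_stable. Qed.

Lemma unit_root_decomposition x :
  exists yz : H * H, [/\ U yz.1, Fil H 1 yz.2 & x = yz.1 + yz.2].
Proof.
have [Us [sl <-]] := U_unit_root; have [_ _ _ dec] := sl 0%N.
by have [yz [h _]] := dec x; exists yz.
Qed.

Lemma unit_root_Fil1_disjoint x : U x -> Fil H 1 x -> x = 0.
Proof.
have [Us [sl <-]] := U_unit_root; have [_ sF _ dec] := sl 0%N => Ux Fx.
have [sU0 _ _] := sub_Fcrystal_stable sF; have [yz [_ uyz]] := dec x.
have e1 : yz = (x, 0).
  by apply: uyz; split=> //=; [apply: (submod0 (Fil_submod _ _)) | rewrite addr0].
have e2 : yz = (0, x).
  by apply: uyz; split=> //=; [apply: submod0 | rewrite add0r].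
by move: e1; rewrite e2 => -[].
Qed.

(** The submodule U has the complement Fil 1, and H has no torsion. *)
Lemma unit_root_saturated d x : (0 < d)%N -> U (x *+ d) -> U x.
Proof.
move=> d0; have [[y z] /= [Uy Fz ->]] := unit_root_decomposition x.
rewrite mulrnDl => Uyz.
have Uz : U (z *+ d).
  rewrite -[z *+ d](addrK (y *+ d)) addrC -[- _ + _]addrC (addrC (z *+ d)).
  by apply: submodB => //; rewrite -scaler_nat; apply: submodZ.
have : z *+ d = 0.
  apply: unit_root_Fil1_disjoint => //; rewrite -scaler_nat.
  exact: submodZ (Fil_submod _ _) Fz.
by move=> /(Fcrystal_torsion_free char_k W_witt d0) ->; rewrite addr0.
Qed.

(** In weight one the step U_1 of the slope filtration is H, so that Fil 1 is
    isomorphic to U_1 / U_0, a unit-root crystal up to the twist by -1.  The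
    basis a is fixed by Frobenius, b lifts a fixed basis of the quotient to
    Fil 1, and eta and u are the components in U of nabla b and of Frobenius
    on b. *)
Theorem adapted_bases_exist (g h : nat) :
  has_weight H 1 -> has_rank U g -> has_rank (Fil H 1) h ->
  exists (a : 'I_g -> H) (b : 'I_h -> H)
      (eta : 'I_h -> 'I_g -> 'rV[mseries m W]_m)
      (u : lifting p r m sigma -> 'I_h -> 'I_g -> mseries m W),
      adapted_bases U a b eta u.
Proof.
move=> wt1 [sa bsa] [sb bsb]; have [_ nabU frobU] := unit_root_part_stable.
have [Us [sl U0]] := U_unit_root.
have U1 x : Us 1%N x.
  have [_ _ _ dec] := sl 1%N; have [[y z] [[/= Uy]]] := dec x.
  by rewrite (weight1_Fil2 wt1) => -> -> _; rewrite addr0.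
have sF := Fil_submod H 1.
have [_ _ [V0 [f0 [ur0 [lin0 nab0 frob0] surj0 ker0]]] _] := sl 0%N.
have [_ _ [V1 [f1 [ur1 [lin1 nab1 frob1] surj1 ker1]]] _] := sl 1%N.
rewrite /pred_step U0 in lin0 nab0 frob0 surj0 ker0 ker1.
have lin1T : forall (c : A) x y, [set: H] x -> [set: H] y -> f1 (c *: x + y) = c *: f1 x + f1 y.
  by move=> c x y _ _; apply: lin1.
have inj0 x : U x -> f0 x = 0 -> x = 0 by move=> Ux /(ker0 _ Ux).
have surjF v : exists2 x, Fil H 1 x & f1 x = v.
  have [x _ <-] := surj1 v; have [[y z] /= [Uy Fz ->]] := unit_root_decomposition x.
  exists z => //; rewrite (linear_onD lin1T) //.
  by rewrite (ker1 y (U1 y)).2 ?add0r.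
have injF x : Fil H 1 x -> f1 x = 0 -> x = 0.
  by move=> Fx /(ker1 _ (U1 x)) Ux; apply: unit_root_Fil1_disjoint.
have [a' [ba' na' fa']] := unit_root_horizontal_basis char_k W_witt ur0
  (basis_image sU lin0 sU (fun x Ux => Ux) surj0 inj0 bsa).
have [a [Ua f0a ba]] := basis_lift sU lin0 sU (fun x Ux => Ux) surj0 inj0 ba'.
have na j l : nabla (a j) l = 0.
  by apply: inj0; [apply: nabU | rewrite nab0 // f0a na'].
have fa phi j : frob phi (a j) = a j.
  apply/eqP; rewrite -subr_eq0; apply/eqP/inj0.
    by apply: submodB => //; apply: frobU.
  rewrite (linear_onB lin0) ?frob0 ?f0a ?fa' ?mulr1n ?subrr //.
  exact: frobU.
(* f1 maps Fil 1 isomorphically onto V1, since Fil 1 is a complement of U *)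
have SU x : Fil H 1 x -> [set: H] x by [].
have [b' [bb' nb' fb']] := unit_root_horizontal_basis char_k W_witt ur1
  (basis_image (submodT H) lin1T sF SU surjF injF bsb).
have [b [Fb f1b bb]] := basis_lift (submodT H) lin1T sF SU surjF injF bb'.
have /choice [e eP] : forall il : 'I_h * 'I_m,
    exists c : {ffun 'I_g -> A}, nabla (b il.1) il.2 = lincomb c a.
  move=> [i l] /=; apply: (basis_span ba); apply: (ker1 _ (U1 _)).1.
  by rewrite nab1 // f1b nb'.
have /choice [u uP] : forall phi_i : lifting p r m sigma * 'I_h,
    exists c : {ffun 'I_g -> A},
      frob phi_i.1 (b phi_i.2) = b phi_i.2 *+ p + lincomb c a *+ p.
  move=> [phi i] /=; have [z ez] := Fil_frob phi (Fb i); rewrite expn1 in ez.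
  have Uz : U (z - b i).
    apply: (ker1 _ (U1 _)).1; apply: (Fcrystal_torsion_free char_k W_witt (prime_gt0 p_pr)).
    rewrite -(linear_onMn (submodT H) lin1T) // mulrnBl -ez.
    rewrite (linear_onB lin1T) // (linear_onMn (submodT H) lin1T) //.
    by rewrite frob1 // f1b fb' expn1 subrr.
  have [c ec] := basis_span ba Uz; exists c.
  by rewrite -ec -mulrnDl addrC subrK.
exists a, b, (fun i j => \row_l e (i, l) j), (fun phi i j => u (phi, i) j); split=> //.
- by move=> j; apply/ffunP => l; rewrite na ffunE.
- move=> i j l l'; rewrite !mxE.
  have nab l1 l2 : nabla (nabla (b i) l1) l2 = \sum_j theta r l2 (e (i, l1) j) *: a j.
    rewrite (eP (i, l1)) nabla_sum; apply: eq_bigr => j' _.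
    by rewrite nabla_scale na scaler0 addr0.
  have := nabla_integrable l l' (b i); rewrite !nab => /(basis_sum_inj sU ba) /(_ j) <-.
  done.
- move=> i; apply/ffunP => l; rewrite (eP (i, l)) sum_ffunE.
  by apply: eq_bigr => j _; rewrite ffunE mxE.
- by move=> phi; split=> [j|i]; rewrite ?fa // (uP (phi, i)).
Qed.

End UnitRootPart.

Section AdaptedBases.
Variables (U : set H) (g h : nat).
Variables (a : 'I_g -> H) (b : 'I_h -> H) (eta : 'I_h -> 'I_g -> 'rV[mseries m W]_m).
Variable (u : lifting p r m sigma -> 'I_h -> 'I_g -> mseries m W).
Hypotheses (U_unit_root : unit_root_part U) (ab : adapted_bases U a b eta u).
Let sU : submod U. Proof. by have [] := unit_root_part_stable U_unit_root. Qed.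
Let ba : Defs.basis U a. Proof. by have [[]] := ab. Qed.
Let na j l : nabla (a j) l = 0.
Proof. by have [_ -> _ _ _] := ab; rewrite ffunE. Qed.
Let nb i l : nabla (b i) l = \sum_j eta i j 0 l *: a j.
Proof.
have [_ _ _ -> _] := ab; rewrite sum_ffunE; apply: eq_bigr => j _.
by rewrite ffunE.
Qed.
Let fa phi j : frob phi (a j) = a j. Proof. by have [_ _ _ _ f] := ab; apply: (f phi).1. Qed.
Let fb phi i : frob phi (b i) = b i *+ p + (\sum_j u phi i j *: a j) *+ p.
Proof. by have [_ _ _ _ f] := ab; apply: (f phi).2. Qed.

(** Horizontality of Frobenius, read off in the coefficients of the a j. *)
Lemma adapted_form_pull phi i j :
  form_pull phi (eta i j) = eta i j *+ p + sd r (u phi i j) *+ p.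
Proof.
apply/rowP => l; rewrite /form_pull summxE !mxE !mulmxnE mxE.
have lhs : nabla (frob phi (b i)) l =
    \sum_j (eta i j 0 l *+ p + theta r l (u phi i j) *+ p) *: a j.
  rewrite fb nablaE !nablaMn nb nabla_sum -mulrnDl -big_split -sumrMnl /=.
  apply: eq_bigr => j' _; rewrite nabla_scale na scaler0 addr0 -scalerDl.
  by rewrite -mulrnDl -scalerMnl.
have rhs : nabla (frob phi (b i)) l =
    \sum_j (\sum_l' phi (eta i j 0 l') * dlog_pull phi l' 0 l) *: a j.
  rewrite frob_horizontalE; under [RHS]eq_bigr do rewrite scaler_suml.
  rewrite exchange_big; apply: eq_bigr => l' _ /=.
  rewrite nb frob_sum scaler_sumr; apply: eq_bigr => j' _.
  by rewrite frob_semilinear fa scalerA mulrC.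
have /(basis_sum_inj sU ba) /(_ j) <- := etrans (esym rhs) lhs.
by apply: eq_bigr => l' _; rewrite mxE.
Qed.
End AdaptedBases.
End HodgeOrdinary.

(** * The pullback of series with denominators and the logarithm *)

Section Monomials.
Variables (m : nat) (R : comNzRingType).
Local Notation A := (mseries m R).

(** Each monomial of f is divided by its first variable. *)
Lemma vanish_split N (f : A) : vanish N.+1 f ->
  exists g : 'I_m -> A, (forall i, vanish N (g i)) /\ f = \sum_i svar R i * g i.
Proof.
move=> vf.
pose g (i : 'I_m) : A := MSeries (fun l : 'X_{1..m} =>
  if [forall j : 'I_m, (j < i)%N ==> (l j == 0%N)] then f (l + U_(i))%MM else 0).
exists g; split=> [i l lN|].
  by rewrite /g /=; case: ifP => // _; rewrite vf // mdegD mdeg1 addn1.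
apply: mseriesP => l; rewrite scoef_sum.
under eq_bigr do rewrite scoef_smonoM.
have [l0|/eqP l0] := eqVneq l 0%MM.
  rewrite l0 vf ?mdeg0 // big1 // => i _; case: ifP => // /mnm_lepP /(_ i).
  by rewrite mnm0E mnm1E eqxx.
have [i0 i0P] := mnm_neq0 l0.
case: (@arg_minnP _ i0 (fun i => l i != 0%N) (fun i : 'I_m => i : nat) i0P) => i /= li mini.
rewrite (bigD1 i) //= big1 => [|j ji].
  rewrite mnm1_le li addr0 submK ?mnm1_le // ifT //.
  apply/forallP => j; apply/implyP => ji; rewrite mnmBE.
  have [->|lj] := eqVneq (l j) 0%N; first by [].
  by have := mini j lj; rewrite leqNgt ji.
rewrite mnm1_le; case: ifP => // lj; case: ifP => // /forallP /(_ i).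
have lt : (i < j)%N by rewrite ltn_neqAle mini // andbT eq_sym -(inj_eq val_inj) in ji *.
by rewrite lt mnmBE mnm1E [j == i]eq_sym (negbTE (_ : i != j)) ?subn0 ?(negbTE li) // eq_sym.
Qed.

Definition monomial (g : 'I_m -> A) (n : 'X_{1..m}) : A := \prod_i g i ^+ n i.

Lemma monomial0 g : monomial g 0%MM = 1.
Proof. by rewrite /monomial big1 // => i _; rewrite mnm0E. Qed.
Lemma monomialD g n l : monomial g (n + l)%MM = monomial g n * monomial g l.
Proof. by rewrite -big_split; apply: eq_bigr => i _; rewrite mnmDE exprD. Qed.
Lemma monomialU g i : monomial g U_(i)%MM = g i.
Proof.
rewrite /monomial (bigD1 i) //= mnm1E eqxx expr1 big1 ?mulr1 // => j ji.
by rewrite mnm1E eq_sym (negbTE ji).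
Qed.

Lemma sderiv_monomial g i n :
  sderiv i (monomial g n) =
    \sum_l (monomial g (n - U_(l))%MM * sderiv i (g l)) *+ n l.
Proof.
elim: {n}(mdeg n) {-2}n (leqnn (mdeg n)) => [|d IH] n nd.
  move: nd; rewrite leqn0 mdeg_eq0 => /eqP ->.
  by rewrite monomial0 sderiv1 big1 // => l _; rewrite mnm0E.
have [n0|/eqP n0] := eqVneq n 0%MM.
  by rewrite n0 monomial0 sderiv1 big1 // => l _; rewrite mnm0E.
have [j jn] := mnm_neq0 n0; have Ujn : (U_(j) <= n)%MM by rewrite mnm1_le.
pose n' := (n - U_(j))%MM; have en : n = (n' + U_(j))%MM by rewrite submK.
have dn' : (mdeg n' <= d)%N by move: nd; rewrite en mdegD mdeg1 addn1.
clearbody n'; rewrite {1}en monomialD monomialU sderivM IH // mulr_suml.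
rewrite [RHS](eq_bigr (fun l => (monomial g (n - U_(l))%MM * sderiv i (g l)) *+ n' l
   + (monomial g n' * sderiv i (g l)) *+ (l == j))); last first.
  move=> l _; rewrite {2}en mnmDE mnm1E mulrnDr [j == l]eq_sym.
  by case: eqP => [->|_]; rewrite ?mulr0n ?addr0 // {2}en addmK.
rewrite big_split /=; congr (_ + _); last first.
  rewrite (bigD1 j) //= eqxx mulr1n big1 ?addr0 // => l /negbTE ->.
  by rewrite mulr0n.
apply: eq_bigr => l _; have [->|nl] := eqVneq (n' l) 0%N; first by rewrite !mulr0n mul0r.
rewrite mulrnAl mulrAC; congr (_ *+ _); congr (_ * _).
rewrite -[X in _ * X](monomialU g) -monomialD; congr monomial.
rewrite [in RHS]en; apply/mnmP => i'; rewrite !(mnmDE, mnmBE, mnm1E).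
by case: (l =P i') => [<-|] /=; move: nl; lia.
Qed.
End Monomials.

Section Pullback.
Variables (p r m : nat) (k : closedFieldType) (W : idomainType).
Variables (res : {rmorphism W -> k}) (sigma : {rmorphism W -> W}).
Hypothesis (char_k : p \in [pchar k]) (W_witt : witt_ring p res).
Hypothesis (sigma_frob : forall x, res (sigma x) = res x ^+ p).
Local Notation A := (mseries m W).
Local Notation K := {fraction W}.
Local Notation F := (@tofrac W).
Local Notation toK := (smap (@tofrac W)).
Local Notation pdvd := (pdvd p).
Local Notation cvg := (@padic_cvg p W).
Local Notation lifting := (lifting p r m sigma).
Let p_pr := p_prime char_k.
Implicit Types phi : lifting.

(** The powers of the ideal (p, t). *)
Definition pt_pow N (f : A) := forall l, pdvd (N - mdeg l) (f l).

Lemma pt_powD N f g : pt_pow N f -> pt_pow N g -> pt_pow N (f + g).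
Proof. by move=> df dg l; rewrite scoefD; apply: pdvdD. Qed.
Lemma pt_powM N N' f g : pt_pow N f -> pt_pow N' g -> pt_pow (N + N') (f * g).
Proof.
move=> df dg l; apply: scoefM_ind; [exact: pdvd0 | exact: pdvdD | ].
move=> l1 l2 e; apply: pdvd_le (pdvdM (df l1) (dg l2)).
by rewrite e mdegD; lia.
Qed.
Lemma pt_powMr N f g : pt_pow N f -> pt_pow N (f * g).
Proof.
move=> df; rewrite -[N]addn0; apply: pt_powM => // l.
exact: pdvd_all.
Qed.
Lemma pt_pow_sum N I (s : seq I) (P : pred I) (G : I -> A) :
  (forall i, P i -> pt_pow N (G i)) -> pt_pow N (\sum_(i <- s | P i) G i).
Proof.
move=> dG; apply: big_ind => //; last exact: pt_powD.
by move=> l; rewrite scoef0; apply: pdvd0.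
Qed.

Lemma lift_var phi i : pt_pow 1 (phi (svar W i)).
Proof.
have [y ->] := lift_frobenius phi (svar W i); apply: pt_powD => l.
  case: (l =P 0%MM) => [->|/eqP l0]; last first.
    move: l0; rewrite -mdeg_eq0 => l0.
    by apply: (pdvd_le (N := 0)); [lia | apply: pdvd_all].
  by rewrite scoef0X scoef_var0 expr0n eqn0Ngt (prime_gt0 p_pr); apply: pdvd0.
apply: (pdvd_le (N := 1)); first by lia.
by rewrite scoef_natM -[p%:R]expr1; apply: pdvd_pow.
Qed.

(** Continuity of liftings for the (p, t)-adic topology: the variables are mapped
    into the ideal (p, t). *)
Lemma lift_vanish phi N f : vanish N f -> pt_pow N (phi f).
Proof.
elim: N f => [|N IH] f vf; first by move=> l; apply: pdvd_all.
have [g [vg ->]] := vanish_split vf; rewrite rmorph_sum.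
apply: pt_pow_sum => i _; rewrite rmorphM -add1n.
by apply: pt_powM; [apply: lift_var | apply: IH].
Qed.

Local Notation T phi := (monomial (fun i => phi (svar W i))).

Lemma lift_term phi c n :
  phi (sconst m c * smono W n) = sconst m (sigma c) * T phi n.
Proof.
rewrite rmorphM lift_semilinear smonoE rmorph_prod; congr (_ * _).
by apply: eq_bigr => i _; rewrite rmorphXn.
Qed.

(** Continuity in a form suited to sums over boxes of multi-indices, which are
    not truncations by degree. *)
Lemma lift_approx phi N (f : A) (I : finType) (c : I -> W) (n : I -> 'X_{1..m}) :
  (forall l, (mdeg l < N)%N -> f l = \sum_i c i *+ (l == n i)) ->
  pt_pow N (phi f - \sum_i sconst m (sigma (c i)) * T phi (n i)).
Proof.
move=> fP; have -> : phi f - \sum_i sconst m (sigma (c i)) * T phi (n i) =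
    phi (f - \sum_i sconst m (c i) * smono W (n i)).
  by rewrite rmorphB rmorph_sum; congr (_ - _); apply: eq_bigr => i _; rewrite lift_term.
apply: lift_vanish => l lN; rewrite scoefB scoef_sum fP //; apply/eqP.
rewrite subr_eq0; apply/eqP/eq_bigr => i _; rewrite scoef_sconstM scoef_smono.
by case: eqP => _; rewrite ?mulr1n ?mulr0n ?mulr1 ?mulr0.
Qed.

Lemma box_inj D : injective (@box m D).
Proof.
move=> n n' e; apply/ffunP => i; apply: val_inj.
by move/mnmP/(_ i): e; rewrite !mnmE.
Qed.

Lemma box_surj D (l : 'X_{1..m}) : (forall i, (l i < D)%N) ->
  exists n : {ffun 'I_m -> 'I_D}, box n = l.
Proof.
move=> lD; exists [ffun i => Ordinal (lD i)]; apply/mnmP => i.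
by rewrite mnmE ffunE.
Qed.

Lemma mdeg_ge (l : 'X_{1..m}) i : (l i <= mdeg l)%N.
Proof. by rewrite mdegE (bigD1 i) //= leq_addr. Qed.

Lemma cvg_pt_pow (f : nat -> A) (g : A) l :
  (forall D, pt_pow D (g - f D)) -> cvg (fun D => F (f D l)) (F (g l)).
Proof.
move=> h; apply/cvgP => N; exists (N + mdeg l)%N => D le.
rewrite -tofracB; apply/KdvdF; rewrite -scoefB; apply: pdvd_le (h D l).
by lia.
Qed.

Definition pull_sum phi (x : mseries m K) (l : 'X_{1..m}) D : K :=
  \sum_(n : {ffun 'I_m -> 'I_D}) fracmap sigma (x (box n)) * F (T phi (box n) l).

Lemma series_pullE phi x l z :
  cvg (pull_sum phi x l) z -> series_pull phi x l = z.
Proof. exact: (padic_limE W_witt). Qed.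

Section Derivative.
Variables (phi : lifting) (tau : mseries m K) (x : 'I_m -> A).
Hypothesis tau_deriv : forall l, sderiv l tau = toK (x l).

Local Notation sK := (fracmor W_witt sigma_frob).

(** The chain rule: up to an integer factor, a coefficient of the pullback of tau
    other than the constant term is one of phi applied to the derivatives of
    tau, which are integral, so that the continuity of phi applies. *)
Lemma pull_sum_deriv (i : 'I_m) (l : 'X_{1..m}) :
  cvg (fun D => (l i).+1%:R * pull_sum phi tau (l + U_(i))%MM D)
      (F ((\sum_j phi (x j) * sderiv i (phi (svar W j))) l)).
Proof.
pose c (j : 'I_m) D (n : {ffun 'I_m -> 'I_D}) : W :=
  if box n j == 0%N then 0 else x j (box n - U_(j))%MM.
pose approx j D : A := \sum_n sconst m (sigma (@c j D n)) * T phi (box n - U_(j))%MM.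
have approxP j D : pt_pow D.-1 (phi (x j) - approx j D).
  apply: lift_approx => l' l'D.
  have [i'|n en] := @box_surj D (l' + U_(j))%MM.
    rewrite mnmDE mnm1E; have := mdeg_ge l' i'; case: eqP; lia.
  rewrite (bigD1 n) //= /c en mnmDE mnm1E eqxx addn1 /= addmK eqxx mulr1n.
  rewrite big1 ?addr0 // => n' n'n; case: eqP => [_|/eqP nj]; first by rewrite mul0rn.
  case: eqP => // e; case/eqP: n'n; apply: box_inj; rewrite en e submK //.
  by rewrite mnm1_le.
pose approx' D : A := \sum_j approx j D.+1 * sderiv i (phi (svar W j)).
have lim : cvg (fun D => F (approx' D l))
    (F ((\sum_j phi (x j) * sderiv i (phi (svar W j))) l)).
  apply: cvg_pt_pow => D; rewrite /approx' -sumrB; apply: pt_pow_sum => j _.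
  by rewrite -mulrBl; apply: pt_powMr; apply: approxP.
apply: (cvg_ext (D0 := 1) _ (cvg_shift 1 lim)).
case=> // D _; rewrite (subn1 D.+1) -pred_Sn /approx' scoef_sum.
transitivity (\sum_(n : {ffun 'I_m -> 'I_D.+1})
    sK (tau (box n)) * F (sderiv i (T phi (box n)) l)); last first.
  rewrite mulr_sumr; apply: eq_bigr => n _.
  by rewrite mulrCA /= rmorphMn /= mulr_natl.
under [RHS]eq_bigr do rewrite sderiv_monomial scoef_sum rmorph_sum mulr_sumr /=.
rewrite [RHS]exchange_big rmorph_sum; apply: eq_bigr => j _.
rewrite /approx mulr_suml scoef_sum rmorph_sum; apply: eq_bigr => n _.
rewrite -mulrA scoef_sconstM (rmorphM F) scoefMn (rmorphMn F) [RHS]mulrnAr -[RHS]mulrnAl.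
rewrite -[fracmap sigma _]/(sK _) -(rmorphMn sK) /c; congr (_ * _).
case: eqP => [->|/eqP nj]; first by rewrite mulr0n !rmorph0.
have Ujn : (U_(j) <= box n)%MM by rewrite mnm1_le.
transitivity (sK (F (x j (box n - U_(j))%MM))); first by rewrite fracmorF.
congr (sK _).
transitivity (toK (x j) (box n - U_(j))%MM); first by [].
rewrite -tau_deriv /= submK // mnmBE mnm1E eqxx subn1 prednK // lt0n //.
Qed.

Lemma pull_sum_cvg (z : mseries m K) :
  (forall i, sderiv i z = toK (\sum_j phi (x j) * sderiv i (phi (svar W j)))) ->
  cvg (pull_sum phi tau 0%MM) (z 0%MM) ->
  forall l, cvg (pull_sum phi tau l) (z l).
Proof.
move=> zd z0 l; have [->//|/eqP l0] := eqVneq l 0%MM.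
have [i li] := mnm_neq0 l0; have Uil : (U_(i) <= l)%MM by rewrite mnm1_le.
pose l' := (l - U_(i))%MM; have el : l = (l' + U_(i))%MM by rewrite submK.
rewrite el; apply: (cvg_nat_cancel char_k W_witt (ltn0Sn (l' i))).
have := pull_sum_deriv i l'.
have -> // : F ((\sum_j phi (x j) * sderiv i (phi (svar W j))) l') =
  (l' i).+1%:R * z (l' + U_(i))%MM.
by rewrite [RHS]mulr_natl -[RHS]/(sderiv i z l') zd.
Qed.
End Derivative.

Section Logarithm.
Variable f : A.
Hypothesis f1p : exists y, f = 1 + p%:R * y.

Lemma one_sub_pow n : pdvd n ((1 - f) ^+ n).
Proof.
have [y ->] := f1p; rewrite opprD addrA subrr sub0r.
have := @pdvdX p A 1 (- (p%:R * y)) n; rewrite mul1n; apply.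
by apply: pdvdN; rewrite -[p%:R]expr1; apply: pdvd_pow.
Qed.

(** The n-th term is divisible by what is left of p ^ n after division by n. *)
Lemma series_log_cvg l :
  cvg (fun D => - \sum_(1 <= n < D) F (((1 - f) ^+ n) l) / n%:R) (series_log p f l).
Proof.
have /choice [a aP] : forall n, exists a : W, pdvd (n - logn p n) a /\
    (0 < n)%N%:R * F (((1 - f) ^+ n) l) / n%:R = F a.
  case=> [|n]; first by exists 0; rewrite mul0r mul0r tofrac0; split=> //; apply: pdvd0.
  have [y ey] := (pdvd_coef _ _ _).1 (one_sub_pow n.+1) l.
  have le : (logn p n.+1 <= n.+1)%N by have := logn_half p_pr n.+1; lia.
  have [w dw ew] := pow_div_nat char_k W_witt (ltn0Sn n) le.
  exists (w * y); split; first exact: pdvdMr.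
  rewrite ltn0Sn mul1r ey ew !tofracM rmorph_nat mulrAC mulfK //.
  exact: (natK_neq0 char_k W_witt).
have [N|s sP] := cvg_series W_witt (a := a).
  exists (2 * N)%N => n le; apply: pdvd_le (aP n).1.
  by have := logn_half p_pr n; lia.
have c : cvg (fun D => - \sum_(1 <= n < D) F (((1 - f) ^+ n) l) / n%:R) (F (- s)).
  rewrite tofracN; apply: (cvg_ext (D0 := 0) _ (cvgN W_witt sP)).
  move=> D _; congr (- _); rewrite rmorph_sum -(big_mkord xpredT (fun n => F (a n))).
  case: D => [|D]; first by rewrite !big_geq.
  rewrite big_ltn // -(aP 0%N).2 mul0r mul0r add0r; apply: eq_big_nat => n /andP [n0 _].
  by rewrite -(aP n).2 n0 mul1r.
by rewrite /series_log /= (padic_limE W_witt c).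
Qed.

(** The derivatives of the partial sums are geometric sums. *)
Lemma sderiv_series_log i : sderiv i (series_log p f) = toK (f^-1 * sderiv i f).
Proof.
have uf : f \is a GRing.unit by have [y ->] := f1p; apply: (series_unit1p char_k W_witt).
apply: mseriesP => l; rewrite [LHS]/= -mulr_natl.
set a := LHS; set b := RHS.
apply: (cvg_unique W_witt) (cvgZ W_witt (l i).+1%:R (series_log_cvg (l + U_(i))%MM)) _.
have -> : b = F ((f^-1 * sderiv i f) l) by [].
pose g D := (1 - (1 - f) ^+ D.-1) * (f^-1 * sderiv i f).
have gP D : (0 < D)%N -> F (g D l) =
    (l i).+1%:R * - \sum_(1 <= n < D) F (((1 - f) ^+ n) (l + U_(i))%MM) / n%:R.
  move=> D0; rewrite -sumrN mulr_sumr.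
  have -> : g D = \sum_(0 <= n < D.-1) (1 - f) ^+ n * sderiv i f.
    rewrite -mulr_suml /g mulrA; congr (_ * _).
    rewrite big_mkord -(opprB ((1 - f) ^+ _)) subrX1 -mulNr opprB subKr mulrC.
    by rewrite mulKr.
  rewrite scoef_sum rmorph_sum -(prednK D0) big_add1 /=; apply: eq_bigr => n _.
  have key : ((1 - f) ^+ n * sderiv i f) l *+ n.+1 =
      - (((1 - f) ^+ n.+1) (l + U_(i))%MM *+ (l i).+1).
    rewrite -[_ *+ (l i).+1]/(sderiv i ((1 - f) ^+ n.+1) l) sderivX sderivB sderiv1.
    by rewrite sub0r mulrN mulNrn scoefN opprK scoefMn.
  have e0 := natK_neq0 char_k W_witt (ltn0Sn n).
  apply: (mulIf e0); rewrite mulrN mulNr -mulrA divfK // mulr_natr mulr_natl.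
  by rewrite -[LHS](rmorphMn F) key (rmorphN F) (rmorphMn F).
apply: (cvg_ext (D0 := 1) gP); apply/cvgP => N; exists N.+1 => D le.
rewrite -tofracB; apply/KdvdF; rewrite -scoefB /g mulrBl mul1r opprB addrC subrK.
apply: (pdvd_coef _ _ _).1; apply: pdvdMr; apply: pdvd_le (one_sub_pow _).
by lia.
Qed.
End Logarithm.
End Pullback.

(** * Falling products of log derivations *)

Section Opfold.
Variable m : nat.

(** The iteration scheme of nabla_prod, for an arbitrary state, so that the same
    products can be compared on vectors, series and constants. *)
Definition opfold T (n : 'X_{1..m}) (step : 'I_m -> nat -> T -> T) (s : T) : T :=
  foldr (fun i y => iteri (n i) (step i) y) s (enum 'I_m).

Lemma opfold_rel T T' (Q : T -> T' -> Prop) n step step' s s' :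
  (forall i j x x', Q x x' -> Q (step i j x) (step' i j x')) ->
  Q s s' -> Q (opfold n step s) (opfold n step' s').
Proof.
move=> hs Qs; rewrite /opfold; elim: (enum 'I_m) => [|i e IH] //=.
by elim: (n i) => [|d IHd] //=; apply: hs.
Qed.

Section FallingDerivative.
Variables (r : nat) (R : comNzRingType).
Local Notation A := (mseries m R).
Local Notation t' := (@tlog m R r).

Definition falling_step (i : 'I_m) (j : nat) (x : A) : A := theta r i x - x *+ j.

Lemma falling_iteri i d x :
  iteri d (falling_step i) x = t' i ^+ d * iter d (sderiv i) x.
Proof.
elim: d => [|d IH]; first by rewrite mul1r.
rewrite iteriS IH /falling_step thetaM theta_tlogX eqxx mulr1n mulrnAl.
by rewrite addrAC subrr add0r /theta mulrA exprSr.
Qed.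

Lemma sderiv_tlogXM i j d x : i != j ->
  sderiv i (t' j ^+ d * x) = t' j ^+ d * sderiv i x.
Proof.
by move=> ij; rewrite sderivM sderivX sderiv_tlog (negbTE ij) mulr0 mul0rn mul0r add0r.
Qed.

Lemma falling_foldr (n : 'X_{1..m}) (e : seq 'I_m) x : uniq e ->
  foldr (fun i y => iteri (n i) (falling_step i) y) x e =
  \prod_(i <- e) t' i ^+ n i * foldr (fun i y => iter (n i) (sderiv i) y) x e.
Proof.
elim: e => [|i e IH] /=; first by rewrite big_nil mul1r.
move=> /andP [ie /IH ->]; rewrite falling_iteri big_cons -mulrA; congr (_ * _).
set y := foldr _ _ _; elim: (n i) => [|d IHd] //=; rewrite IHd.
move: (iter d _ y) => z; elim: e ie {IH y IHd} => [|j e IH] ie.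
  by rewrite big_nil !mul1r.
move: ie; rewrite inE negb_or => /andP [ij ie].
by rewrite big_cons -!mulrA sderiv_tlogXM // IH.
Qed.

Lemma iter_sderiv i d (x : A) (l : 'X_{1..m}) : l i = 0%N ->
  iter d (sderiv i) x l = x (l + U_(i) *+ d)%MM *+ d`!.
Proof.
move=> li; suff gen c : forall l0 : 'X_{1..m}, l0 i = c ->
    iter d (sderiv i) x l0 *+ c`! = x (l0 + U_(i) *+ d)%MM *+ (c + d)`!.
  by have := gen 0%N l li; rewrite mulr1n.
elim: d c => [|d IH] c l0 l0i; first by rewrite addn0 mulm0n addm0.
rewrite iterS /= l0i -mulrnA -factS IH; last by rewrite mnmDE mnm1E eqxx l0i addn1.
by rewrite addSnnS mulmS addmA.
Qed.

Lemma foldr_sderiv (n : 'X_{1..m}) (e : seq 'I_m) (x : A) (l : 'X_{1..m}) : uniq e ->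
  (forall i, i \in e -> l i = 0%N) ->
  foldr (fun i y => iter (n i) (sderiv i) y) x e l =
  x (l + \sum_(i <- e) U_(i) *+ n i)%MM *+ \prod_(i <- e) (n i)`!.
Proof.
elim: e l => [|i e IH] l /=; first by rewrite !big_nil addm0 mulr1n.
move=> /andP [ie ue] l0; rewrite iter_sderiv ?l0 ?inE ?eqxx // IH // => [|j je].
  by rewrite !big_cons addmA -mulrnA mulnC.
rewrite mnmDE mulmnE mnm1E l0 ?inE ?je ?orbT //.
by case: eqP => // e'; move: ie; rewrite e' je.
Qed.

(** The operator prod_i prod_(j < n i) (theta i - j) is t' ^ n times the n-th
    derivative. *)
Lemma falling_const (n : 'X_{1..m}) (x : A) :
  opfold n falling_step x 0%MM =
  x n * \prod_i ((t' i 0%MM) ^+ n i * (n i)`!%:R).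
Proof.
rewrite /opfold falling_foldr ?enum_uniq // scoef0M foldr_sderiv ?enum_uniq //; last first.
  by move=> i _; rewrite mnm0E.
rewrite add0m !big_enum /= -multinomUE_id big_split /=.
rewrite -const_coefE rmorph_prod mulrCA -mulr_natr natr_prod; congr (_ * (_ * _)).
by apply: eq_bigr => i _; rewrite rmorphXn.
Qed.
End FallingDerivative.

Section ConstantStates.
Variable R : comNzRingType.
Variable c : 'I_m -> R.

(** The operators theta i - j on the formal expressions e L + z with constant
    e and z, where theta i L = c i: the constant terms of logarithms. *)
Definition const_step (i : 'I_m) (j : nat) (s : R * R) : R * R :=
  (- (s.1 *+ j), s.1 * c i - s.2 *+ j).

(** For d > 0, the product of the - j with 0 < j < d: after theta, which maps a
    logarithm to a constant, each factor theta - j multiplies by - j. *)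
Definition log_coef d : R := if d is e.+1 then (-1) ^+ e * e`!%:R else 0.

Lemma const_iteri i d s :
  iteri d (const_step i) s =
    if d == 0%N then s else (0, s.1 * c i * log_coef d).
Proof.
elim: d => [|d IH] //; rewrite iteriS IH /const_step.
case: d {IH} => [|d] /=; first by rewrite !mulr0n !oppr0 addr0 fact0 !mulr1.
rewrite mul0rn mul0r oppr0 sub0r; congr (_, _).
by rewrite factS natrM mulrnAr -mulr_natr exprS; ring.
Qed.

(** The contribution of the coordinate l when the products act on a logarithm
    that varies along the coordinate i only. *)
Definition log_factor (i l : 'I_m) d : R :=
  if l == i then log_coef d else (d == 0%N)%:R.

Lemma const_foldr (n : 'X_{1..m}) (e : seq 'I_m) : uniq e ->
  foldr (fun i y => iteri (n i) (const_step i) y) (1, 0) e =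
  (\prod_(l <- e) (n l == 0%N)%:R,
   \sum_(i <- e) c i * \prod_(l <- e) log_factor i l (n l)).
Proof.
elim: e => [|i e IH] /=; first by rewrite !big_nil.
move=> /andP [ie ue]; rewrite IH // const_iteri !big_cons /=.
have ne l : l \in e -> (l == i) = false.
  by move=> le; apply/eqP => li; move: ie; rewrite -li le.
have sum_e : \sum_(j <- e) c j * \prod_(l <- i :: e) log_factor j l (n l) =
    (n i == 0%N)%:R * \sum_(j <- e) c j * \prod_(l <- e) log_factor j l (n l).
  rewrite mulr_sumr; apply: eq_big_seq => j je; rewrite big_cons mulrCA.
  by congr (_ * _); rewrite /log_factor eq_sym ne.
have lii : log_factor i i (n i) = log_coef (n i) by rewrite /log_factor eqxx.
rewrite sum_e lii {sum_e lii}.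
have -> : \prod_(l <- e) log_factor i l (n l) = \prod_(l <- e) (n l == 0%N)%:R.
  by apply: eq_big_seq => l le; rewrite /log_factor ne.
case: eqP => [->|n0] /=; first by rewrite !mul1r mul0r mulr0 add0r.
rewrite !mul0r addr0; congr (_, _).
by rewrite -mulrA mulrC -mulrA.
Qed.

Lemma const_opfold (n : 'X_{1..m}) :
  opfold n const_step (1, 0) =
  ((n == 0%MM)%:R, \sum_i c i * \prod_l log_factor i l (n l)).
Proof.
rewrite /opfold const_foldr ?enum_uniq // !big_enum /=; congr (_, _).
  have [->|n0] := eqVneq n 0%MM; first by rewrite big1 // => l _; rewrite mnm0E.
  have [i ni] := mnm_neq0 (elimN eqP n0).
  by rewrite (bigD1 i) //= (negbTE ni) mul0r.
by apply: eq_bigr => i _; rewrite big_enum.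
Qed.
End ConstantStates.
End Opfold.

(** * Primitives with logarithms *)

Section Origin.
Variables (p r m : nat) (k : closedFieldType) (W : idomainType).
Variables (res : {rmorphism W -> k}) (sigma : {rmorphism W -> W}).
Hypothesis (char_k : p \in [pchar k]) (W_witt : witt_ring p res).
Local Notation A := (mseries m W).
Local Notation t' := (@tlog m W r).
Local Notation lifting := (lifting p r m sigma).
Let p_pr := p_prime char_k.

Lemma tlog_const (R : comNzRingType) (i : 'I_m) : tlog R r i 0%MM = (r <= i)%N%:R.
Proof.
rewrite /tlog; case: (ltnP i r) => _; first exact: scoef_var0.
by rewrite scoefD scoef_var0 scoef1 eqxx addr0.
Qed.

Lemma lift_var_const (phi : lifting) i :
  phi (svar W i) 0%MM = (lfac phi i 0%MM - 1) * t' i 0%MM.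
Proof.
have [_ e] := lfacP W_witt phi i; rewrite tlog_const.
case: (ltnP i r) e => ir; rewrite /tlog ?ir.
  move=> ->; rewrite scoef0M scoef0X scoef_var0 expr0n eqn0Ngt (prime_gt0 p_pr).
  by rewrite mul0r mulr0.
rewrite ltnNge ir /= => e; rewrite mulr1; apply: (addrI 1); rewrite [RHS]addrC subrK.
have := congr1 (fun f : A => f 0%MM) e; rewrite rmorphD rmorph1 scoefD scoef1 eqxx => ->.
by rewrite scoef0M scoef0X scoefD scoef1 eqxx scoef_var0 addr0 expr1n mul1r.
Qed.

Variable phi0 : lifting.
Hypothesis phi0P : forall i, phi0 (t' i) = t' i ^+ p.

Lemma origin_lfac i : lfac phi0 i = 1.
Proof. by apply: (lfac_unique W_witt); rewrite mulr1. Qed.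

Lemma origin_var i : phi0 (svar W i) 0%MM = 0.
Proof. by rewrite lift_var_const origin_lfac scoef1 eqxx subrr mul0r. Qed.

Lemma origin_const f : phi0 f 0%MM = sigma (f 0%MM).
Proof.
have [g [_ eg]] : exists g : 'I_m -> A, (forall i, vanish 0 (g i)) /\
    f - sconst m (f 0%MM) = \sum_i svar W i * g i.
  by apply: vanish_split; apply/vanish1; rewrite scoefB /= eqxx subrr.
rewrite -{1}(subrK (sconst m (f 0%MM)) f) eg rmorphD lift_semilinear rmorph_sum.
rewrite scoefD scoef_sum big1 ?add0r /= ?eqxx // => i _.
by rewrite rmorphM [LHS]scoef0M origin_var mul0r.
Qed.
End Origin.

Section LogPrimitives.
Variables (p r m : nat) (k : closedFieldType) (W : idomainType).
Variables (res : {rmorphism W -> k}) (sigma : {rmorphism W -> W}).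
Hypothesis (char_k : p \in [pchar k]) (W_witt : witt_ring p res).
Hypothesis le_rm : (r <= m)%N.
Local Notation A := (mseries m W).
Local Notation K := {fraction W}.
Local Notation F := (@tofrac W).
Local Notation toK := (smap (@tofrac W)).
Local Notation t' := (@tlog m W r).

Lemma toK_inj (f g : A) : toK f = toK g -> f = g.
Proof.
move=> e; apply: mseriesP => l; have /eqP := congr1 (fun h : mseries m K => h l) e.
by rewrite /= tofrac_eq => /eqP.
Qed.

(** The residues c, extended by 0 to the coordinates that are not logarithmic. *)
Definition residues (c : 'rV[W]_r) (i : 'I_m) : W :=
  \sum_l c 0 l *+ (widen_ord le_rm l == i).

Lemma residues_widen c l : residues c (widen_ord le_rm l) = c 0 l.
Proof.
rewrite /residues (bigD1 l) //= eqxx big1 ?addr0 // => l' /negbTE l'l.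
by rewrite -(inj_eq val_inj) /= (inj_eq val_inj) l'l.
Qed.

Lemma residues_sum (S : comNzRingType) (f : {rmorphism W -> S}) (G : 'I_m -> S) c :
  \sum_i f (residues c i) * G i = \sum_l f (c 0 l) * G (widen_ord le_rm l).
Proof.
transitivity (\sum_i \sum_l (f (c 0 l) * G i) *+ (widen_ord le_rm l == i)).
  apply: eq_bigr => i _; rewrite rmorph_sum mulr_suml; apply: eq_bigr => l _.
  by rewrite rmorphMn mulrnAl.
rewrite exchange_big; apply: eq_bigr => l _.
rewrite (bigD1 (widen_ord le_rm l)) //= eqxx mulr1n big1 ?addr0 // => i.
by rewrite eq_sym => /negbTE ->; rewrite mulr0n.
Qed.

Lemma log_dE c (tau : mseries m K) i :
  log_d le_rm (c, tau) 0 i = sconst m (F (residues c i)) + theta r i tau.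
Proof.
rewrite /log_d mxE [X in _ + X]mxE; congr (_ + _).
rewrite summxE /residues !rmorph_sum; apply: eq_bigr => l _.
rewrite !mxE eqxx /= [i == _]eq_sym; case: eqP => _; rewrite ?mulr1 ?mulr1n //.
by rewrite mulr0 mulr0n !rmorph0.
Qed.

Section Primitive.
Variables (eta : 'rV[A]_m) (c : 'rV[W]_r) (tau : mseries m K).
Hypothesis tauP : map_mx toK eta = log_d le_rm (c, tau).

Lemma primitive_theta i : toK (eta 0 i) = sconst m (F (residues c i)) + theta r i tau.
Proof. by rewrite -log_dE -tauP mxE. Qed.

Lemma primitive_residue l : c 0 l = eta 0 (widen_ord le_rm l) 0%MM.
Proof.
have := congr1 (fun h : mseries m K => h 0%MM) (primitive_theta (widen_ord le_rm l)).
rewrite scoefD /theta scoef0M tlog_const leqNgt /= ltn_ord mul0r addr0 eqxx.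
by rewrite residues_widen => /eqP; rewrite tofrac_eq => /eqP.
Qed.

(** Without its residue, the component of the form at a log coordinate is
    divisible by this coordinate; the other t' l are units. *)
Lemma primitive_integral : exists x : 'I_m -> A,
  (forall l, sderiv l tau = toK (x l)) /\
  (forall l, t' l * x l = eta 0 l - sconst m (residues c l)).
Proof.
have th l : theta r l tau = toK (eta 0 l - sconst m (residues c l)).
  by rewrite rmorphB /= smap_const primitive_theta addrC addKr.
have /choice [x xP] : forall l, exists x, sderiv l tau = toK x.
  move=> l; case: (ltnP l r) => lr.
    exists (MSeries (fun n => (eta 0 l - sconst m (residues c l)) (U_(l) + n)%MM)).
    apply: mseriesP => n; have := congr1 (fun h : mseries m K => h (U_(l) + n)%MM) (th l).
    by rewrite /theta /tlog lr scoef_smonoDM.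
  exists ((t' l)^-1 * (eta 0 l - sconst m (residues c l))).
  apply: (@tlog_inj m r K l); rewrite -[LHS]/(theta r l tau) th.
  by rewrite -(smap_tlog F r l) -rmorphM mulVKr // (tlog_unit W_witt).
exists x; split=> // l; apply: toK_inj.
by rewrite -th rmorphM /= -xP smap_tlog.
Qed.

Variables (phi : lifting p r m sigma) (u : A).
Hypothesis eta_pull : form_pull phi eta = eta *+ p + sd r u *+ p.
Hypothesis sigma_c : forall l, sigma (c 0 l) = c 0 l.

(** The value that the functional equation of tau prescribes for the pullback of
    its power series part. *)
Definition pull_target : mseries m K := tau *+ p + toK u *+ p -
  \sum_l sconst m (F (sigma (c 0 l))) * series_log p (lfac phi (widen_ord le_rm l)).

(** This is the relation between eta and u, once the residues, which are fixed by
    sigma, have been separated from the derivatives of tau. *)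
Lemma pull_target_deriv (x : 'I_m -> A) :
  (forall l, t' l * x l = eta 0 l - sconst m (residues c l)) ->
  forall i, sderiv i pull_target =
    toK (\sum_j phi (x j) * sderiv i (phi (svar W j))).
Proof.
move=> xP i; apply: (@tlog_inj m r K i).
rewrite -[LHS]/(theta r i pull_target) -(smap_tlog F r i) -rmorphM /=.
have -> : t' i * (\sum_j phi (x j) * sderiv i (phi (svar W j))) =
    \sum_j phi (eta 0 j) * dlog_pull phi j 0 i
    - \sum_j sconst m (sigma (residues c j)) * dlog_pull phi j 0 i.
  rewrite mulr_sumr -sumrB; apply: eq_bigr => j _.
  rewrite -mulrBl -(lift_semilinear phi) -rmorphB -xP rmorphM.
  rewrite [phi (t' j) * _]mulrC -mulrA -(theta_lift char_k W_witt) mulrCA; congr (_ * _).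
  rewrite /theta; congr (_ * _); rewrite /tlog; case: ifP => _ //.
  by rewrite rmorphD rmorph1 sderivD sderiv1 add0r.
have -> : \sum_j phi (eta 0 j) * dlog_pull phi j 0 i = eta 0 i *+ p + theta r i u *+ p.
  move/rowP/(_ i): eta_pull; rewrite /form_pull summxE !mxE !mulmxnE !mxE => <-.
  by apply: eq_bigr => j _; rewrite [RHS]mxE.
pose lg j := (lfac phi j)^-1 * theta r i (lfac phi j).
have -> : \sum_j sconst m (sigma (residues c j)) * dlog_pull phi j 0 i =
    sconst m (residues c i) *+ p + \sum_l sconst m (sigma (c 0 l)) * lg (widen_ord le_rm l).
  have rs : sigma (residues c i) = residues c i.
    by rewrite rmorph_sum; apply: eq_bigr => l _; rewrite rmorphMn sigma_c.
  pose f : {rmorphism W -> A} := (@sconst m W) \o sigma.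
  rewrite -(residues_sum f) -{1}rs -[X in X *+ p + _]mulr1.
  have -> : (sconst m (sigma (residues c i)) * 1) *+ p =
      \sum_j f (residues c j) * (1 *+ (i == j) *+ p).
    rewrite (bigD1 i) //= eqxx mulr1n big1 ?addr0 ?mulrnAr // => j ji.
    by rewrite eq_sym (negbTE ji) mulr0n mul0rn mulr0.
  rewrite -big_split; apply: eq_bigr => j _ /=; rewrite -mulrDr; congr (_ * _).
  by rewrite /dlog_pull !mxE mulmxnE mxE eqxx.
rewrite /pull_target thetaB thetaD !thetaMn theta_sum opprD addrA.
rewrite !(rmorphD, rmorphB, rmorphN, rmorphMn) /= smap_theta smap_const.
rewrite (primitive_theta i); congr (_ - _).
  by rewrite mulrnDl [RHS]addrAC (addrC (_ *+ p) (theta r i tau *+ p)) addrK.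
rewrite rmorph_sum; apply: eq_bigr => l _; rewrite thetaM theta_const mul0r add0r rmorphM /= smap_const.
congr (_ * _); rewrite /theta (sderiv_series_log char_k W_witt); last first.
  exact: (lfacP W_witt _ _).1.
by rewrite /lg /theta !rmorphM /= smap_tlog mulrCA.
Qed.
End Primitive.
End LogPrimitives.

(** * Comparison of liftings at the origin *)

Section ConstantTerm.
Variables (p r m : nat) (k : closedFieldType) (W : idomainType).
Variables (res : {rmorphism W -> k}) (sigma : {rmorphism W -> W}).
Hypothesis (char_k : p \in [pchar k]) (W_witt : witt_ring p res).
Hypothesis (sigma_frob : forall x, res (sigma x) = res x ^+ p).
Local Notation A := (mseries m W).
Local Notation K := {fraction W}.
Local Notation F := (@tofrac W).
Local Notation lifting := (lifting p r m sigma).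
Local Notation t' := (@tlog m W r).
Local Notation sK := (fracmor W_witt sigma_frob).

Variables phi phi0 : lifting.
Hypothesis phi0P : forall i, phi0 (t' i) = t' i ^+ p.
Variables (c : 'I_m -> W) (tau : mseries m K) (y : 'X_{1..m} -> W).
Hypothesis yP : forall n, F (y n) + (n == 0%MM)%:R * tau 0%MM =
  opfold n (@falling_step m r K) tau 0%MM + F (opfold n (const_step c) (1, 0)).2.

Let d l j : W := divpow (lfac phi l / lfac phi0 l - 1) j 0%MM.

Let dP l j : d l j * j`!%:R = (lfac phi l 0%MM - 1) ^+ j.
Proof.
have := divpowP char_k W_witt j (lfac_ratio char_k W_witt phi phi0 l).
rewrite (origin_lfac W_witt phi0P) divr1 => /(congr1 (fun f : A => f 0%MM)).
rewrite scoefMn mulr_natr /d (origin_lfac W_witt phi0P) divr1 => ->.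
by rewrite scoef0X scoefB scoef1 eqxx.
Qed.

Let chiE n : chi_coef phi phi0 n 0%MM = \prod_l d l (n l).
Proof. by rewrite /chi_coef -const_coefE rmorph_prod. Qed.

Let d0 l : d l 0 = 1.
Proof. by have := dP l 0; rewrite expr0 fact0 mulr1. Qed.

Let log_term l D : (0 < D)%N ->
  F (\sum_(j < D) d l j * log_coef W j) =
    - \sum_(1 <= j < D) F (((1 - lfac phi l) ^+ j) 0%MM) / j%:R.
Proof.
case: D => // D _; rewrite -(big_mkord xpredT (fun j => d l j * log_coef W j)).
rewrite big_ltn // mulr0 add0r rmorph_sum -sumrN; apply: eq_big_nat => -[|j] // _.
apply: (mulIf (natK_neq0 char_k W_witt (ltn0Sn j))).
rewrite mulNr divfK ?(natK_neq0 char_k W_witt) // -(rmorph_nat F) -(rmorphM F) -(rmorphN F).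
congr F; rewrite scoef0X scoefB scoef1 eqxx -opprB exprNn -dP factS natrM /=.
by rewrite exprS; ring.
Qed.

(** Taylor's formula at the origin: the terms of the compatibility between the
    Frobenius maps of phi and phi0 are those of the pullback of tau by phi and
    of the logarithms of the factors of phi. *)
Lemma pull_sum_const D : (0 < D)%N ->
  pull_sum phi tau 0%MM D =
    F (\sum_(n : {ffun 'I_m -> 'I_D}) chi_coef phi phi0 (box n) 0%MM * sigma (y (box n)))
    + sK (tau 0%MM)
    - \sum_i F (sigma (c i)) *
        - \sum_(1 <= j < D) F (((1 - lfac phi i) ^+ j) 0%MM) / j%:R.
Proof.
move=> D0; pose X (n : {ffun 'I_m -> 'I_D}) := \prod_l d l (n l).
have XE n : chi_coef phi phi0 (box n) 0%MM = X n.
  by rewrite chiE; apply: eq_bigr => l _; rewrite mnmE.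
have termE n : fracmap sigma (tau (box n)) *
    F (monomial (fun i => phi (svar W i)) (box n) 0%MM) =
    F (X n * sigma (y (box n))) + (F (X n) * (box n == 0%MM)%:R) * sK (tau 0%MM)
    - F (X n * sigma (opfold (box n) (const_step c) (1, 0)).2).
  have -> : monomial (fun i => phi (svar W i)) (box n) 0%MM =
      X n * \prod_i ((t' i 0%MM) ^+ box n i * (box n i)`!%:R).
    rewrite /monomial -const_coefE rmorph_prod -big_split; apply: eq_bigr => i _.
    rewrite rmorphXn /= const_coefE (lift_var_const char_k W_witt) exprMn -dP mnmE.
    by rewrite mulrA mulrAC.
  rewrite -[fracmap sigma _]/(sK _) tofracM mulrCA.
  have -> : sK (tau (box n)) * F (\prod_i ((t' i 0%MM) ^+ box n i * (box n i)`!%:R)) =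
      sK (opfold (box n) (@falling_step m r K) tau 0%MM).
    rewrite falling_const (rmorphM sK); congr (_ * _).
    rewrite !rmorph_prod; apply: eq_bigr => i _.
    by rewrite !rmorphM !rmorphXn !rmorph_nat !tlog_const !rmorph_nat.
  have -> : opfold (box n) (@falling_step m r K) tau 0%MM =
      F (y (box n)) + (box n == 0%MM)%:R * tau 0%MM - F (opfold (box n) (const_step c) (1, 0)).2.
    by rewrite yP addrK.
  rewrite (rmorphB sK) (rmorphD sK) (rmorphM sK) rmorph_nat !fracmorF !tofracM.
  by rewrite mulrBr mulrDr mulrA.
rewrite /pull_sum (eq_bigr _ (fun n _ => termE n)) sumrB big_split /=.
congr (_ + _ - _).
- by rewrite rmorph_sum; apply: eq_bigr => n _; rewrite XE.
- transitivity (\sum_(n : {ffun 'I_m -> 'I_D}) (box n == 0%MM)%:R * sK (tau 0%MM)).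
    apply: eq_bigr => n _; congr (_ * _); case: eqP => [e|_]; rewrite ?mulr0 // mulr1.
    by rewrite -XE e (chi_coef0 char_k W_witt) scoef1 eqxx tofrac1.
  case: (D) D0 => // D' _.
  rewrite (bigD1 [ffun _ => ord0]) //= box0 eqxx mul1r big1 ?addr0 // => n /negbTE n0.
  by rewrite box_eq0 n0 mul0r.
rewrite -rmorph_sum.
transitivity (F (\sum_i sigma (c i) * \sum_(j < D) d i j * log_coef W j)); last first.
  by rewrite rmorph_sum; apply: eq_bigr => i _; rewrite rmorphM /= log_term.
congr F; transitivity (\sum_(n : {ffun 'I_m -> 'I_D}) \sum_i
    sigma (c i) * \prod_l (d l (n l) * log_factor W i l (n l))).
  apply: eq_bigr => n _; rewrite const_opfold /= rmorph_sum mulr_sumr.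
  apply: eq_bigr => i _; rewrite rmorphM mulrCA big_split /=; congr (_ * (_ * _)).
  rewrite rmorph_prod; apply: eq_bigr => l _; rewrite mnmE /log_factor.
  case: (l == i); last by rewrite rmorph_nat.
  by case: (nat_of_ord (n l)) => [|e] /=; rewrite ?rmorph0 // rmorphM rmorphXn rmorphN1 rmorph_nat.
rewrite exchange_big; apply: eq_bigr => i _; rewrite -mulr_sumr; congr (_ * _).
rewrite -(bigA_distr_bigA (fun l (j : 'I_D) => d l j * log_factor W i l j)) /=.
rewrite (bigD1 i) //= [X in _ * X]big1 ?mulr1 => [|l /negbTE li].
  by apply: eq_bigr => j _; rewrite /log_factor eqxx.
rewrite /log_factor li; case: (D) D0 => // D' _.
by rewrite big_ord_recl /= d0 mulr1 big1 ?addr0 // => j _; rewrite mulr0.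
Qed.
End ConstantTerm.

Section CrystalExpansion.
Variables (p r m : nat) (k : closedFieldType) (W : idomainType).
Variables (res : {rmorphism W -> k}) (sigma : {rmorphism W -> W}).
Hypothesis (char_k : p \in [pchar k]) (W_witt : witt_ring p res).
Local Notation A := (mseries m W).
Local Notation K := {fraction W}.
Local Notation F := (@tofrac W).
Local Notation toK := (smap (@tofrac W)).
Local Notation pdvd := (pdvd p).
Let p_pr := p_prime char_k.
Variable H : hodge p r m sigma.
Local Open Scope classical_set_scope.
Variables (U : set H) (g h : nat).
Variables (a : 'I_g -> H) (b : 'I_h -> H) (eta : 'I_h -> 'I_g -> 'rV[mseries m W]_m).
Variable (u : lifting p r m sigma -> 'I_h -> 'I_g -> mseries m W).
Hypotheses (U_unit_root : unit_root_part U) (ab : adapted_bases U a b eta u).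

(** The operators nabla i - j on the vectors e b + sum_l y l a l with constant
    e, written in terms of (e, y). *)
Definition adapted_step (eta_i : 'I_g -> 'rV[A]_m) (i : 'I_m) (j : nat)
    (s : W * ('I_g -> A)) : W * ('I_g -> A) :=
  (- (s.1 *+ j), fun l => sconst m s.1 * eta_i l 0 i + theta r i (s.2 l) - s.2 l *+ j).

Definition nabla_coord i n := opfold n (adapted_step (eta i)) (1, fun=> 0).

Lemma nabla_coord1 i n : (nabla_coord i n).1 = (n == 0%MM)%:R.
Proof.
have := const_opfold (fun=> 0 : W) n => /(congr1 fst) /= <-.
apply: (opfold_rel (Q := fun s s' => s.1 = s'.1)) => // i' j s s' /= e.
by rewrite e.
Qed.

Lemma nabla_prod_adapted i n : nabla_prod n (b i) =
  sconst m (nabla_coord i n).1 *: b i + \sum_l (nabla_coord i n).2 l *: a l.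
Proof.
pose Q (z : H) (s : W * ('I_g -> A)) := z = sconst m s.1 *: b i + \sum_l s.2 l *: a l.
apply: (opfold_rel (Q := Q)); last first.
  by rewrite /Q /= rmorph1 scale1r big1 ?addr0 // => l _; rewrite scale0r.
move=> i' j z s; rewrite /Q => -> /=.
have [_ na _ nb _] := ab.
rewrite nablaE nabla_scale theta_const scale0r add0r nb sum_ffunE nabla_sum.
rewrite rmorphN rmorphMn /= mulrnDl opprD addrCA; congr (_ + _).
  by rewrite scaleNr scalerMnl.
rewrite -addrA -sumrMnl -sumrB scaler_sumr -big_split; apply: eq_bigr => l _ /=.
rewrite nabla_scale na !ffunE scaler0 addr0 scalerA scalerMnl.
by rewrite -scalerBl -scalerDl addrA.
Qed.

(** The comparison of the Frobenius maps on b i, in the coefficients of the a j: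
    divisibility by p ^ N in H passes to U because U is saturated. *)
Lemma adapted_compat phi phi0 i j N : exists D0, forall D, (D0 <= D)%N ->
  pdvd N ((u phi i j - u phi0 i j) *+ p -
    \sum_(n : {ffun 'I_m -> 'I_D})
      chi_coef phi phi0 (box n) * phi0 ((nabla_coord i (box n)).2 j)).
Proof.
have [sU _ _] := unit_root_part_stable U_unit_root.
have [[ba _] _ _ _ fP] := ab.
have [D0 hD] := frob_compat phi phi0 (b i) N; exists (maxn D0 1) => D.
rewrite geq_max => /andP [/hD [z ez] D1].
have fa ph l : frob ph (a l) = a l by apply: (fP ph).1.
have fb ph : frob ph (b i) = b i *+ p + (\sum_j u ph i j *: a j) *+ p by apply: (fP ph).2.
pose cf l := (u phi i l - u phi0 i l) *+ p -
    \sum_(n : {ffun 'I_m -> 'I_D})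
      chi_coef phi phi0 (box n) * phi0 ((nabla_coord i (box n)).2 l).
have e : z *+ p ^ N = \sum_l cf l *: a l.
  rewrite -ez.
  have -> : \sum_(n : {ffun 'I_m -> 'I_D})
      chi_coef phi phi0 (box n) *: frob phi0 (nabla_prod (box n) (b i)) =
      frob phi0 (b i) + \sum_l (\sum_(n : {ffun 'I_m -> 'I_D})
        chi_coef phi phi0 (box n) * phi0 ((nabla_coord i (box n)).2 l)) *: a l.
    under eq_bigr do rewrite nabla_prod_adapted frobD frob_semilinear frob_sum scalerDr.
    rewrite big_split; congr (_ + _).
      case: (D) D1 => // D' _; rewrite (bigD1 [ffun _ => ord0]) //= big1.
        rewrite nabla_coord1 box0 eqxx !rmorph_nat scale1r addr0.
        by rewrite (chi_coef0 char_k W_witt) scale1r.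
      move=> n /negbTE n0; rewrite nabla_coord1 box_eq0 n0 !rmorph_nat.
      by rewrite scale0r scaler0.
    under [RHS]eq_bigr do rewrite scaler_suml.
    rewrite [RHS]exchange_big; apply: eq_bigr => n _ /=.
    rewrite scaler_sumr; apply: eq_bigr => l _.
    by rewrite frob_semilinear fa scalerA.
  rewrite opprD addrA !fb [b i *+ p + _]addrC addrKA -mulrnBl -sumrB -sumrMnl -sumrB.
  by apply: eq_bigr => l _; rewrite -scalerBl scalerMnl -scalerBl.
have Uz : U z.
  apply: (unit_root_saturated char_k W_witt U_unit_root (d := p ^ N)).
    by rewrite expn_gt0 prime_gt0.
  rewrite e; apply: submod_sum => // l; apply: submodZ => //; exact: ba.1.
have [c' ec] := basis_span ba Uz.
have : \sum_l cf l *: a l = \sum_l (c' l *+ p ^ N) *: a l.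
  rewrite -e ec /lincomb -sumrMnl; apply: eq_bigr => l _.
  by rewrite scalerMnl.
move=> /(basis_sum_inj sU ba) /(_ j) ec'.
by apply/pdvd_natmul; exists (c' j).
Qed.

(** Formally b i - sum_j tau i j a j is horizontal, so that the operators change
    the coordinate of b i along a j as they change tau i j.  The power series
    part of tau and its logarithms are followed separately. *)
Lemma nabla_coord_primitive (le_rm : (r <= m)%N) i j (c : 'rV[W]_r) tau n :
  map_mx toK (eta i j) = log_d le_rm (c, tau) ->
  F ((nabla_coord i n).2 j 0%MM) + (n == 0%MM)%:R * tau 0%MM =
  opfold n (@falling_step m r K) tau 0%MM +
    F (opfold n (const_step (residues le_rm c)) (1, 0)).2.
Proof.
move=> tauP.
pose Q (s : W * ('I_g -> A)) (s' : mseries m K * (W * W)) :=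
  s.1 = s'.2.1 /\ toK (s.2 j) + sconst m (F s.1) * tau = s'.1 + sconst m (F s'.2.2).
pose stp i' j' (s' : mseries m K * (W * W)) :=
  (@falling_step m r K i' j' s'.1, const_step (residues le_rm c) i' j' s'.2).
have [_ qn] : Q (nabla_coord i n) (opfold n stp (tau, (1, 0))).
  apply: opfold_rel; last first.
    by split=> //=; rewrite tofrac1 rmorph1 tofrac0 rmorph0 mul1r rmorph0 add0r addr0.
  move=> i' j' [e y] [x [e' ka]] [/= -> q]; split=> //=.
  have -> : x = toK (y j) + sconst m (F e') * tau - sconst m (F ka) by rewrite q addrK.
  have e1 : toK (sconst m e' * eta i j 0 i' + theta r i' (y j) - y j *+ j') =
      sconst m (F e') * toK (eta i j 0 i') + theta r i' (toK (y j)) - toK (y j) *+ j'.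
    by rewrite rmorphB rmorphD rmorphM rmorphMn /= smap_const smap_theta.
  have e2 : sconst m (F (- (e' *+ j'))) = - (sconst m (F e') *+ j') :> mseries m K.
    by rewrite (rmorphN F) (rmorphMn F) rmorphN rmorphMn.
  have e3 : sconst m (F (e' * residues le_rm c i' - ka *+ j')) =
      sconst m (F e') * sconst m (F (residues le_rm c i')) - sconst m (F ka) *+ j'
      :> mseries m K.
    by rewrite (rmorphB F) (rmorphM F) (rmorphMn F) rmorphB rmorphM rmorphMn.
  rewrite e1 e2 e3 /falling_step thetaB thetaD thetaM !theta_const mul0r add0r subr0.
  rewrite (primitive_theta tauP).
  move: (sconst m (F e')) (sconst m (F (residues _ _ _))) (theta r i' tau)
    (theta r i' (toK (y j))) (toK (y j)) (sconst m (F ka)) => X1 X2 X3 X4 X5 X6.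
  rewrite mulrnBl mulrnDl -mulrnAl mulrDr mulNr opprB opprD addrACA.
  by ring.
have -> : opfold n (@falling_step m r K) tau = (opfold n stp (tau, (1, 0))).1.
  by apply: (opfold_rel (Q := fun x s => x = s.1)) => // i' j' x s ->.
have -> : opfold n (const_step (residues le_rm c)) (1, 0) = (opfold n stp (tau, (1, 0))).2.
  by apply: (opfold_rel (Q := fun x s => x = s.2)) => // i' j' x s ->.
have := congr1 (fun f : mseries m K => f 0%MM) qn.
rewrite nabla_coord1 !scoefD scoef_sconstM rmorph_nat /= => ->.
by rewrite eqxx.
Qed.
End CrystalExpansion.

(** * Existence and uniqueness of the primitives *)

Section Poincare.
Variables (p r m : nat) (k : closedFieldType) (W : idomainType).
Variables (res : {rmorphism W -> k}).
Hypothesis (char_k : p \in [pchar k]) (W_witt : witt_ring p res).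
Hypothesis le_rm : (r <= m)%N.
Local Notation A := (mseries m W).
Local Notation K := {fraction W}.
Local Notation F := (@tofrac W).
Local Notation toK := (smap (@tofrac W)).
Local Notation t' := (@tlog m W r).

Lemma euler_coef (R : comNzRingType) (f : mseries m R) i l :
  (svar R i * sderiv i f) l = f l *+ l i.
Proof.
rewrite scoef_smonoM mnm1_le; have [->|li] := eqVneq (l i) 0%N; first by rewrite mulr0n.
by rewrite /= submK ?mnm1_le // mnmBE mnm1E eqxx subn1 prednK // lt0n.
Qed.

(** The forms are integrated after passing to the Euler operators t i d / d t i,
    which act on monomials by scalars: closedness says that l j omega i and
    l i omega j have the same coefficients at t ^ l, so that omega i / l i does
    not depend on i. *)
Lemma poincare (eta : 'rV[A]_m) : closed_form r eta ->
  exists tau : mseries m K, tau 0%MM = 0 /\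
    map_mx toK eta = log_d le_rm (\row_l eta 0 (widen_ord le_rm l) 0%MM, tau).
Proof.
move=> closed; set c := \row_l _.
have /choice [lam lamP] : forall i, exists lam, lam * t' i = svar W i.
  move=> i; case: (ltnP i r) => ir; first by exists 1; rewrite mul1r /tlog ir.
  by exists (svar W i / t' i); rewrite divrK // (tlog_unit W_witt).
pose xi i := eta 0 i - sconst m (residues le_rm c i).
pose om i := lam i * xi i.
have lam_theta i (f : A) : svar W i * sderiv i f = lam i * theta r i f.
  by rewrite -lamP mulrA.
have lam_const i j : i != j -> theta r i (lam j) = 0.
  move=> ij; apply: (@tlog_inj m r W j); rewrite mulr0.
  have := congr1 (theta r i) (lamP j); rewrite thetaM (@theta_tlogX m r W i j 1) (negbTE ij).
  by rewrite mulr0n mulr0 addr0 mulrC => ->; rewrite /theta sderiv_var (negbTE ij) mulr0.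
have sym i j l : om j l *+ l i = om i l *+ l j.
  rewrite -!euler_coef; congr (_ l); have [->//|ij] := eqVneq i j.
  rewrite !lam_theta !thetaM !lam_const // 1?eq_sym // !mul0r !add0r.
  by rewrite !thetaB !theta_const !subr0 (closed i j) mulrCA.
have om0 j : om j 0%MM = 0.
  rewrite scoef0M; case: (ltnP j r) => jr.
    have -> : xi j 0%MM = 0; last by rewrite mulr0.
    have -> : j = widen_ord le_rm (Ordinal jr) by apply: val_inj.
    by rewrite /xi residues_widen mxE scoefB /= eqxx subrr.
  have := congr1 (fun f : A => f 0%MM) (lamP j).
  by rewrite scoef0M tlog_const jr scoef_var0 mulr1 => ->; rewrite mul0r.
have /choice [tc tcP] : forall l : 'X_{1..m}, exists x : K, (forall j, x *+ l j = F (om j l)) /\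
    (l = 0%MM -> x = 0).
  move=> l; have [->|/eqP l0] := eqVneq l 0%MM.
    by exists 0; split=> // j; rewrite mul0rn om0 tofrac0.
  have [i li] := mnm_neq0 l0; have n0 := natK_neq0 char_k W_witt (_ : 0 < l i)%N.
  exists (F (om i l) / (l i)%:R); split=> // j.
  apply: (mulIf (n0 _)); first by rewrite lt0n.
  rewrite mulrnAl divfK ?n0 ?lt0n // mulr_natr -!(rmorphMn F); congr F.
  by rewrite sym.
exists (MSeries tc); split; first exact: (tcP 0%MM).2.
apply/rowP => i; rewrite log_dE mxE; set tau := MSeries tc.
have eul : svar K i * sderiv i tau = toK (om i).
  by apply: mseriesP => l; rewrite euler_coef /tau /= (tcP l).1.
have lamK : toK (lam i) * tlog K r i = svar K i.
  by rewrite -(smap_tlog F r i) -rmorphM lamP; apply: smap_smono.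
have : svar K i * theta r i tau = svar K i * toK (xi i).
  have eom : svar K i * sderiv i tau = toK (lam i) * toK (xi i) by rewrite eul rmorphM.
  by rewrite -[in RHS]lamK [RHS]mulrAC -eom /theta mulrCA mulrC.
move=> /(@smono_inj m K U_(i)%MM) ->.
by rewrite /xi rmorphB /= smap_const addrC subrK.
Qed.
End Poincare.

Section Existence.
Variables (p r m : nat) (k : closedFieldType) (W : idomainType).
Variables (res : {rmorphism W -> k}) (sigma : {rmorphism W -> W}).
Hypothesis (char_k : p \in [pchar k]) (W_witt : witt_ring p res).
Hypothesis (sigma_frob : forall x, res (sigma x) = res x ^+ p).
Hypothesis le_rm : (r <= m)%N.
Local Notation A := (mseries m W).
Local Notation K := {fraction W}.
Local Notation F := (@tofrac W).
Local Notation toK := (smap (@tofrac W)).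
Local Notation pdvd := (pdvd p).
Local Notation cvg := (@padic_cvg p W).
Local Notation t' := (@tlog m W r).
Local Notation sK := (fracmor W_witt sigma_frob).
Let p_pr := p_prime char_k.
Let p_gt0 := prime_gt0 p_pr.
Variable phi0 : lifting p r m sigma.
Hypothesis phi0P : forall i, phi0 (t' i) = t' i ^+ p.

Lemma origin_form_pull (eta : 'rV[A]_m) i :
  form_pull phi0 eta 0 i = phi0 (eta 0 i) *+ p.
Proof.
rewrite /form_pull summxE (bigD1 i) //= big1 ?addr0 => [|j ji].
  rewrite mxE /dlog_pull (origin_lfac W_witt phi0P) invr1 scale1r !mxE theta1 addr0.
  by rewrite mulmxnE mxE !eqxx mulrnAr mulr1.
rewrite mxE /dlog_pull (origin_lfac W_witt phi0P) invr1 scale1r !mxE theta1 addr0.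
by rewrite mulmxnE mxE eqxx /= eq_sym (negbTE ji) mul0rn mulr0.
Qed.

Lemma pairMn (U V : zmodType) (x : U * V) d : x *+ d = (x.1 *+ d, x.2 *+ d).
Proof. by elim: d => [|d IH] //; rewrite !mulrS IH. Qed.

Lemma log_pull_equation (phi : lifting p r m sigma) (c : 'rV[W]_r) (tau : mseries m K) (u : A) :
  log_pull le_rm phi (c, tau) - (c, tau) *+ p - ((0, toK u) : log_series r m W) *+ p = 0 <->
  map_mx sigma c *+ p = c *+ p /\
  \sum_l sconst m (F (sigma (c 0 l))) * series_log p (lfac phi (widen_ord le_rm l))
   + series_pull phi tau - tau *+ p - toK u *+ p = 0.
Proof.
rewrite /log_pull !pairMn /=; split=> [e|[e1 e2]].
  have e1 := congr1 fst e; have e2 := congr1 snd e; split=> //.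
  by move: e1; rewrite /= mul0rn subr0 => /eqP; rewrite subr_eq0 => /eqP.
congr (_, _); last exact: e2.
by rewrite /= mul0rn subr0 e1 subrr.
Qed.

Variable H : hodge p r m sigma.
Variables (U : set H) (g h : nat).
Variables (a : 'I_g -> H) (b : 'I_h -> H) (eta : 'I_h -> 'I_g -> 'rV[mseries m W]_m).
Variable (u : lifting p r m sigma -> 'I_h -> 'I_g -> mseries m W).
Hypotheses (U_unit_root : unit_root_part U) (ab : adapted_bases U a b eta u).

(** The residues are fixed by sigma, as the constant terms of the relation between
    eta and u at phi0 show, and the constant of integration is chosen to satisfy
    the equation of phi0 at the origin.  For another lifting phi, pull_target has
    the derivatives of the pullback, and its constant term is that of the
    pullback by the comparison of phi with phi0. *)
Theorem log_primitive_exists i j :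
  exists tau, log_primitive le_rm (eta i j) (fun phi => u phi i j) tau.
Proof.
have [_ _ closed _ _] := ab.
have [tau1 [tau10 tau1P]] := poincare char_k W_witt le_rm (closed i j).
set c := \row_l _ in tau1P; have cE l : c 0 l = eta i j 0 (widen_ord le_rm l) 0%MM by rewrite mxE.
have pull phi := adapted_form_pull U_unit_root ab phi i j.
have sc l : sigma (c 0 l) = c 0 l.
  have /rowP /(_ (widen_ord le_rm l)) := pull phi0.
  rewrite origin_form_pull !mxE !mulmxnE !mxE -mulrnDl.
  move=> /(seriesMn_inj char_k W_witt p_gt0) /(congr1 (fun f : A => f 0%MM)).
  rewrite (origin_const char_k W_witt phi0P) scoefD /theta scoef0M tlog_const leqNgt /=.
  by rewrite ltn_ord mul0r addr0.
have [w wP] := sigma_sub_p_surj char_k W_witt sigma_frob (u phi0 i j 0%MM).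
pose tau := tau1 + sconst m (F (p%:R * w)).
have tau0 : tau 0%MM = F (p%:R * w) by rewrite scoefD tau10 /= eqxx add0r.
have tauP : map_mx toK (eta i j) = log_d le_rm (c, tau).
  by rewrite tau1P; apply/rowP => l; rewrite 2!log_dE (thetaD _ l tau1) theta_const addr0.
have stau0 : sK (tau 0%MM) = tau 0%MM *+ p + F (u phi0 i j 0%MM) *+ p.
  rewrite tau0 fracmorF -wP -mulrnDl -tofracD addrC subrK -(rmorphMn F) rmorphM rmorph_nat.
  by rewrite mulr_natl.
exists (c, tau); split=> //=; first by move=> l; apply: (sigma_fixed_Zp char_k W_witt sigma_frob).
  by exists w.
move=> phi; apply/log_pull_equation; split.
  by congr (_ *+ p); apply/rowP => l; rewrite mxE sc.
have [x [xd xP]] := primitive_integral W_witt tauP.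
pose z := pull_target le_rm c tau phi (u phi i j).
suff -> : series_pull phi tau = z.
  rewrite /z /pull_target [X in X - _ - _]addrC subrK.
  by rewrite -addrA -opprD subrr.
apply: mseriesP; suff cz : forall l, cvg (pull_sum phi tau l) (z l).
  by move=> l; apply: (series_pullE W_witt).
apply: (pull_sum_cvg char_k W_witt sigma_frob xd).
  by move=> i'; apply: (pull_target_deriv char_k W_witt tauP) => //; apply: pull.
pose y n : W := (nabla_coord r eta i n).2 j 0%MM.
have yP n := nabla_coord_primitive n tauP.
pose S D := \sum_(n : {ffun 'I_m -> 'I_D}) chi_coef phi phi0 (box n) 0%MM * sigma (y (box n)).
have cS : cvg (fun D => F (S D)) (F (((u phi i j - u phi0 i j) *+ p) 0%MM)).
  apply/cvgP => N.
  have [D0 hD] := adapted_compat char_k W_witt U_unit_root ab phi phi0 i j N.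
  exists D0 => D /hD /pdvd_coef /(_ 0%MM); rewrite -tofracB => dN; apply/KdvdF.
  suff -> : S D = (\sum_(n : {ffun 'I_m -> 'I_D})
      chi_coef phi phi0 (box n) * phi0 ((nabla_coord r eta i (box n)).2 j)) 0%MM by [].
  rewrite scoef_sum; apply: eq_bigr => n _.
  by rewrite scoef0M (origin_const char_k W_witt phi0P).
pose L i' D := F (sigma (residues le_rm c i')) *
  - \sum_(1 <= n < D) F (((1 - lfac phi i') ^+ n) 0%MM) / n%:R.
have cL : cvg (fun D => \sum_i' L i' D)
    (\sum_i' F (sigma (residues le_rm c i')) * series_log p (lfac phi i') 0%MM).
  apply: cvg_sum => i'; apply: (cvgZ W_witt); apply: (series_log_cvg char_k W_witt).
  exact: (lfacP W_witt _ _).1.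
have -> : z 0%MM = F (((u phi i j - u phi0 i j) *+ p) 0%MM) + sK (tau 0%MM) -
    \sum_i' F (sigma (residues le_rm c i')) * series_log p (lfac phi i') 0%MM.
  rewrite stau0 /z /pull_target scoefB scoefD !scoefMn scoef_sum; congr (_ - _).
    rewrite scoefB (rmorphMn F) rmorphB mulrnBl [RHS]addrC addrACA.
    by rewrite subrr addr0.
  pose f : {rmorphism W -> K} := F \o sigma.
  have rs := residues_sum le_rm f (fun i' => series_log p (lfac phi i') 0%MM) c.
  by rewrite [RHS]rs; apply: eq_bigr => l _; rewrite scoef_sconstM.
apply: (cvg_ext (D0 := 1) _ (cvgB W_witt (cvgD cS (cvg_const _ (sK (tau 0%MM)))) cL)).
move=> D D1; apply/esym.
have e := pull_sum_const char_k W_witt sigma_frob phi phi0P (y := y) yP D1.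
exact: e.
Qed.

(** Two primitives have the same residues, hence differ by a constant w in pW,
    and Frobenius forces sigma w = p w. *)
Theorem log_primitive_unique (etaij : 'rV[A]_m) (uij : lifting p r m sigma -> A) tau tau' :
  log_primitive le_rm etaij uij tau -> log_primitive le_rm etaij uij tau' -> tau = tau'.
Proof.
case: tau tau' => [c x] [c' x'] [/= _ tP [w xw] eq] [/= _ tP' [w' xw'] eq'].
have cc : c = c'.
  by apply/rowP => l; rewrite (primitive_residue tP) (primitive_residue tP').
rewrite -{}cc in tP' eq' *; congr (_, _).
have dx l : sderiv l (x - x') = 0.
  apply: (@tlog_inj m r K l); rewrite mulr0 -[LHS]/(theta r l (x - x')) thetaB.
  apply/eqP; rewrite subr_eq0; apply/eqP; apply: (addrI (sconst m (F (residues le_rm c l)))).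
  by rewrite -(primitive_theta tP) -(primitive_theta tP').
have hx l : l <> 0%MM -> x l = x' l.
  move=> /mnm_neq0 [i li]; apply/eqP; rewrite -subr_eq0; apply/eqP.
  apply: (mulfI (natK_neq0 char_k W_witt (_ : 0 < l i)%N)); first by rewrite lt0n.
  by rewrite mulr0 mulr_natl -scoefB -euler_coef dx mulr0 scoef0.
have pull0 y : series_pull phi0 y 0%MM = sK (y 0%MM).
  apply: (series_pullE W_witt); apply: (cvg_ext (D0 := 1) _ (cvg_const _ (sK (y 0%MM)))).
  case=> // D _; rewrite /pull_sum (bigD1 [ffun _ => ord0]) //= box0 monomial0.
  rewrite scoef1 eqxx tofrac1 mulr1 big1 ?addr0 // => n n0.
  have [i ni] : exists i, box n i != 0%N by apply: mnm_neq0; apply/eqP; rewrite box_eq0.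
  rewrite [monomial _ _ _](_ : _ = 0) ?tofrac0 ?mulr0 // /monomial (bigD1 i) // scoef0M.
  by rewrite scoef0X (origin_var char_k W_witt phi0P) expr0n (negbTE ni) mul0r.
pose S := \sum_l sconst m (F (sigma (c 0 l))) * series_log p (lfac phi0 (widen_ord le_rm l)).
have const (y : mseries m K) v : y 0%MM = F v ->
    log_pull le_rm phi0 (c, y) - (c, y) *+ p - ((0, toK (uij phi0)) : log_series r m W) *+ p = 0 ->
    F (sigma v - p%:R * v) = (toK (uij phi0) *+ p - S) 0%MM.
  move=> yv /log_pull_equation [_ /(congr1 (fun f : mseries m K => f 0%MM))].
  rewrite -/S !(scoefD, scoefN) scoef0 pull0 yv fracmorF (scoefMn y) yv => e.
  have -> : F (sigma v - p%:R * v) = S 0%MM + F (sigma v) - F v *+ p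
      - (toK (uij phi0) *+ p) 0%MM + ((toK (uij phi0) *+ p) 0%MM - S 0%MM).
    rewrite tofracB tofracM (rmorph_nat F) mulr_natl.
    by move: (F v *+ p) (S _) (F (sigma v)) ((toK _ *+ p) _) => X1 X2 X3 X4; ring.
  by rewrite e add0r.
have e : F (sigma (p%:R * w) - p%:R * (p%:R * w)) = F (sigma (p%:R * w') - p%:R * (p%:R * w')).
  by rewrite (const _ _ xw (eq phi0)) (const _ _ xw' (eq' phi0)).
have ww : p%:R * w = p%:R * w'.
  apply/eqP; rewrite -subr_eq0; apply/eqP/(sigma_eq_p W_witt sigma_frob).
  move/eqP: e; rewrite tofrac_eq rmorphB mulrBr => /eqP e.
  apply/eqP; rewrite -subr_eq0.
  have -> : sigma (p%:R * w) - sigma (p%:R * w') - (p%:R * (p%:R * w) - p%:R * (p%:R * w')) =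
    sigma (p%:R * w) - p%:R * (p%:R * w) - (sigma (p%:R * w') - p%:R * (p%:R * w')) by ring.
  by rewrite e subrr.
apply: mseriesP => l; have [->|/eqP/hx //] := eqVneq l 0%MM.
by rewrite xw xw' ww.
Qed.
End Existence.

(** * Dwork's integrality argument *)

Section TruncatedExponential.
Variables (m : nat) (W : idomainType).
Local Notation K := {fraction W}.
Hypothesis K0 : forall d, (0 < d)%N -> d%:R != 0 :> K.
Local Notation B := (mseries m K).
Implicit Types x y z : B.

Definition exp_trunc N x : B := \sum_(i < N) sconst m (i`!%:R^-1) * x ^+ i.
(** For x without constant term; the powers of x of degree greater than that of
    the coefficient do not contribute to it. *)
Definition sexp x : B := MSeries (fun l : 'X_{1..m} => exp_trunc (mdeg l).+1 x l).

Lemma sexpE x l : sexp x l = exp_trunc (mdeg l).+1 x l. Proof. by []. Qed.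

Lemma sexp_upto N x : x 0%MM = 0 -> eq_upto N (sexp x) (exp_trunc N x).
Proof.
move=> /vanish1 x0 l lN; rewrite /sexp /= /exp_trunc.
rewrite -!(big_mkord xpredT (fun i => sconst m (i`!%:R^-1) * x ^+ i)).
rewrite [in RHS](big_cat_nat (n := (mdeg l).+1)) // scoefD [X in _ + X](_ : _ = 0) ?addr0 //.
rewrite scoef_sum big_nat_cond big1 // => i /andP [/andP [ge _] _].
by rewrite scoef_sconstM; have := @vanishX _ _ 1 x i x0; rewrite mul1n => ->; rewrite ?mulr0.
Qed.

Lemma sexp0 x : sexp x 0%MM = 1.
Proof.
rewrite /sexp /= mdeg0 /exp_trunc big_ord_recl big_ord0 addr0 scoef_sconstM.
by rewrite scoef1 eqxx fact0 invr1 mulr1.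
Qed.

Lemma sderiv_exp_trunc N i x :
  sderiv i (exp_trunc N.+1 x) = exp_trunc N x * sderiv i x.
Proof.
rewrite /exp_trunc sderiv_sum mulr_suml big_ord_recl [x ^+ _]expr0 mulr1 sderiv_const add0r.
apply: eq_bigr => j _.
rewrite !lift0 sderivM sderiv_const mul0r add0r sderivX mulrnAr -mulrnAl.
rewrite mulrA; congr (_ * _ * _); rewrite -rmorphMn; congr (sconst m _).
rewrite factS natrM invfM -mulr_natr mulrAC mulVf ?mul1r //; exact: K0.
Qed.

Lemma sderiv_sexp i x : x 0%MM = 0 -> sderiv i (sexp x) = sexp x * sderiv i x.
Proof.
move=> x0; apply: mseriesP => l.
rewrite (sderiv_eq_upto i (@sexp_upto (mdeg l).+2 x x0) (ltnSn _)) sderiv_exp_trunc.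
exact: (eq_uptoM (fun l' lt => esym (@sexp_upto (mdeg l).+1 x x0 l' lt)) (fun _ _ => erefl) (ltnSn _)).
Qed.

(** The coefficients of z are determined by those of lower degree. *)
Lemma ode_unique z (v : 'I_m -> B) :
  (forall i, sderiv i z = z * v i) -> z 0%MM = 0 -> z = 0.
Proof.
move=> ode z0; have vz N : vanish N z.
  elim: N => [|N IH] l; first by [].
  have [->|/eqP l0] := eqVneq l 0%MM; first by rewrite z0.
  have [i li] := mnm_neq0 l0; rewrite ltnS => lN.
  have Uil : (U_(i) <= l)%MM by rewrite mnm1_le.
  apply: (mulIf (K0 (_ : 0 < l i)%N)); first by rewrite lt0n.
  rewrite mul0r mulr_natr -euler_coef ode scoef_smonoM Uil mulrC.
  apply: (vanishMl (v i) IH); have := mdegD (l - U_(i)) U_(i); rewrite submK // mdeg1.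
  by move: lN; lia.
by apply: mseriesP => l; rewrite scoef0 (vz (mdeg l).+1).
Qed.

Lemma sexp_unique x z : x 0%MM = 0 -> z 0%MM = 1 ->
  (forall i, sderiv i z = z * sderiv i x) -> z = sexp x.
Proof.
move=> x0 z1 ode; apply/eqP; rewrite -subr_eq0; apply/eqP.
apply: (ode_unique (v := fun i => sderiv i x)).
  by move=> i; rewrite sderivB ode sderiv_sexp // mulrBl.
by rewrite scoefB z1 sexp0 subrr.
Qed.
End TruncatedExponential.

Lemma eq_upto_monomials m (R : comNzRingType) N (f : mseries m R) :
  eq_upto N f (\sum_(n : 'X_{1..m < N}) sconst m (f n) * smono R n).
Proof.
move=> n nl; rewrite scoef_sum (bigD1 (BMultinom nl)) // scoef_sconstM scoef_smono eqxx.
rewrite mulr1 big1 => [|n' /andP [_ n'n]]; first by rewrite [RHS]addr0.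
rewrite scoef_sconstM scoef_smono.
by case: eqP => [e|]; rewrite ?mulr0 //; case/eqP: n'n; apply: val_inj.
Qed.

Lemma expr_first_order (S : comNzRingType) (b e : S) n :
  exists Z, (b + e) ^+ n = b ^+ n + (b ^+ n.-1 * e) *+ n + e ^+ 2 * Z.
Proof.
elim: n => [|n [Z IHn]]; first by exists 0; rewrite !expr0 mulr0n mulr0 !addr0.
exists (b ^+ n.-1 *+ n + b * Z + e * Z); rewrite exprS IHn.
case: n {IHn} => [|n] /=; first by rewrite !mulr0n !expr0; ring.
rewrite (mulrSr _ n.+1) !exprS; move: (b ^+ n) => c; ring.
Qed.

Section LeadingTerms.
Variables (p m : nat) (W : idomainType).
Local Notation A := (mseries m W).
Local Notation pdvd := (pdvd p).

Lemma lead_coefM (R : comNzRingType) N (f g : mseries m R) l :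
  vanish N g -> mdeg l = N -> (f * g) l = f 0%MM * g l.
Proof.
move=> vg lN; rewrite -[f in LHS](subrK (sconst m (f 0%MM))) mulrDl scoefD.
rewrite scoef_sconstM (_ : _ l = 0) ?add0r //.
have v1 : vanish 1 (f - sconst m (f 0%MM)) by apply/vanish1; rewrite scoefB /= eqxx subrr.
by apply: (vanishM v1 vg); rewrite lN.
Qed.

Definition lead_dvd N (f : A) := vanish N f /\ forall l, mdeg l = N -> pdvd N (f l).

Lemma lead_dvdM N N' f g : lead_dvd N f -> lead_dvd N' g -> lead_dvd (N + N') (f * g).
Proof.
move=> [vf df] [vg dg]; split=> [|l lN]; first exact: vanishM.
apply: scoefM_ind; [exact: pdvd0 | exact: pdvdD | move=> l1 l2 e].
case: (ltngtP (mdeg l1) N) => d1; first by rewrite vf // mul0r; apply: pdvd0.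
  rewrite vg ?mulr0; first exact: pdvd0.
  by move: lN; rewrite e mdegD; lia.
by apply: pdvdM; [apply: df | apply: dg; move: lN; rewrite e mdegD; lia].
Qed.

Lemma lead_dvd1 : lead_dvd 0 1.
Proof. by split=> [l|l _] //; apply: pdvd_all. Qed.

Lemma lead_dvd_monomial (G : 'I_m -> A) n : (forall i, lead_dvd 1 (G i)) ->
  lead_dvd (mdeg n) (monomial G n).
Proof.
move=> dG; rewrite mdegE /monomial.
apply: (big_rec2 (fun N f => lead_dvd N f)); first exact: lead_dvd1.
move=> i N f _ df; apply: lead_dvdM => //.
elim: (n i) => [|d IH]; first exact: lead_dvd1.
by rewrite exprS -add1n; apply: lead_dvdM.
Qed.
End LeadingTerms.

Section Substitution.
Variables (p r m : nat) (k : closedFieldType) (W : idomainType).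
Variables (res : {rmorphism W -> k}) (sigma : {rmorphism W -> W}).
Hypothesis (char_k : p \in [pchar k]) (W_witt : witt_ring p res).
Hypothesis (sigma_frob : forall x, res (sigma x) = res x ^+ p).
Local Notation A := (mseries m W).
Local Notation K := {fraction W}.
Local Notation B := (mseries m K).
Local Notation F := (@tofrac W).
Local Notation toK := (smap (@tofrac W)).
Local Notation pdvd := (pdvd p).
Local Notation Kdvd := (@Kdvd p W).
Local Notation t' := (@tlog m W r).
Local Notation sK := (fracmor W_witt sigma_frob).
Let p_pr := p_prime char_k.
Let p_gt0 := prime_gt0 p_pr.
Variable phi0 : lifting p r m sigma.
Hypothesis phi0P : forall i, phi0 (t' i) = t' i ^+ p.
Local Notation T := (monomial (fun i => phi0 (svar W i))).
Local Opaque sexp.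

(** The series phi0 (t i) is t i ^ p plus a multiple of p, and has no constant
    term. *)
Lemma origin_lead_dvd n : lead_dvd p (mdeg n) (T n).
Proof.
apply: lead_dvd_monomial => i; split=> [|l l1].
  by apply/vanish1; apply: (origin_var char_k W_witt phi0P).
have [y ->] := lift_frobenius phi0 (svar W i); rewrite scoefD scoef_natM.
have v1 : vanish 1 (svar W i) by apply/vanish1/scoef_var0.
rewrite (@vanishX _ _ 1 _ p v1) ?add0r ?mul1n ?l1 ?prime_gt1 //.
by exists (y l); rewrite expr1.
Qed.

(** Since phi0 fixes the origin, substitution makes sense for all series over K
    and is a ring endomorphism; its coefficients are those of substitution into
    truncated series, where it is evaluation of polynomials. *)
Definition subst_coef : {rmorphism K -> B} := (@sconst m K) \o sK.
Definition subst_poly (P : {mpoly K[m]}) : B :=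
  mmap subst_coef (fun i => toK (phi0 (svar W i))) P.
Fact subst_poly_zmod : zmod_morphism subst_poly.
Proof. exact: mmap_is_additive. Qed.
Fact subst_poly_monoid : monoid_morphism subst_poly.
Proof. by have [h1 h2] := mmap_is_multiplicative (fun i => toK (phi0 (svar W i))) subst_coef. Qed.
HB.instance Definition _ :=
  GRing.isZmodMorphism.Build {mpoly K[m]} B subst_poly subst_poly_zmod.
HB.instance Definition _ :=
  GRing.isMonoidMorphism.Build {mpoly K[m]} B subst_poly subst_poly_monoid.

Lemma subst_poly_monomial (P : {mpoly K[m]}) :
  subst_poly P = \sum_(n <- msupp P) sconst m (sK P@_n) * toK (T n).
Proof.
apply: eq_bigr => n _; rewrite /mmap1 /monomial rmorph_prod; congr (_ * _).
by apply: eq_bigr => i _; rewrite rmorphXn.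
Qed.

Lemma subst_poly_const c : subst_poly c%:MP = sconst m (sK c).
Proof. exact: mmapC. Qed.
Lemma subst_poly_X n : subst_poly 'X_[n] = toK (T n).
Proof.
rewrite /subst_poly mmapX /mmap1 /monomial rmorph_prod.
by apply: eq_bigr => i _; rewrite rmorphXn.
Qed.
Lemma subst_poly_scale c P : subst_poly (c *: P) = sconst m (sK c) * subst_poly P.
Proof. exact: mmapZ. Qed.
Lemma subst_poly_rmorphB P Q : subst_poly (P - Q) = subst_poly P - subst_poly Q.
Proof. exact: rmorphB. Qed.
Lemma subst_poly_rmorphM P Q : subst_poly (P * Q) = subst_poly P * subst_poly Q.
Proof. exact: rmorphM. Qed.
Lemma subst_poly_sum I (e : seq I) (P : I -> {mpoly K[m]}) :
  subst_poly (\sum_(i <- e) P i) = \sum_(i <- e) subst_poly (P i).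
Proof. exact: rmorph_sum. Qed.
Local Opaque subst_poly trunc.

Lemma toK_vanish N (f : A) : vanish N f -> vanish N (toK f).
Proof. by move=> vf l lN; rewrite /= vf ?tofrac0. Qed.

Lemma subst_poly_vanish N (P : {mpoly K[m]}) :
  (forall n, (mdeg n < N)%N -> P@_n = 0) -> vanish N (subst_poly P).
Proof.
move=> PN l lN; rewrite subst_poly_monomial scoef_sum big1 // => n _.
rewrite scoef_sconstM; have [nN|nN] := ltnP (mdeg n) N; first by rewrite PN // rmorph0 mul0r.
have [vT _] := origin_lead_dvd n.
by rewrite (toK_vanish vT) ?mulr0 //; apply: leq_trans nN.
Qed.

Lemma subst_poly_upto N (P Q : {mpoly K[m]}) :
  (forall n, (mdeg n < N)%N -> P@_n = Q@_n) -> eq_upto N (subst_poly P) (subst_poly Q).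
Proof.
move=> PQ; apply/eq_uptoP; rewrite -subst_poly_rmorphB; apply: subst_poly_vanish => n nN.
by rewrite mcoeffB PQ ?subrr.
Qed.

Definition subst (x : B) : B :=
  MSeries (fun l : 'X_{1..m} => subst_poly (trunc (mdeg l).+1 x) l).

Lemma subst_upto N x : eq_upto N (subst x) (subst_poly (trunc N x)).
Proof.
move=> l lN; rewrite /subst /=; apply: (@subst_poly_upto (mdeg l).+1) => // n nl.
by rewrite !mcoeff_trunc nl (leq_trans nl).
Qed.

Lemma subst_of_mpoly P : subst (of_mpoly P) = subst_poly P.
Proof.
apply: mseriesP => l; apply: (@subst_poly_upto (mdeg l).+1) => // n nl.
by rewrite mcoeff_trunc nl.
Qed.

Local Opaque subst.

Lemma subst_eq_upto N x y : eq_upto N x y -> eq_upto N (subst x) (subst y).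
Proof.
move=> xy l lN; rewrite [LHS](subst_upto x lN) [RHS](subst_upto y lN).
apply: (@subst_poly_upto N) => // n nN.
by rewrite !mcoeff_trunc nN xy.
Qed.

Fact subst_zmod : zmod_morphism subst.
Proof.
move=> x y; apply: mseriesP => l; have lt := ltnSn (mdeg l).
transitivity (subst_poly (trunc (mdeg l).+1 x - trunc (mdeg l).+1 y) l).
  rewrite [LHS](subst_upto (x - y) lt).
  apply: (@subst_poly_upto (mdeg l).+1) => // n nl.
  by rewrite mcoeffB !mcoeff_trunc nl.
by rewrite subst_poly_rmorphB [LHS]scoefB [RHS]scoefB; congr (_ - _).
Qed.
Fact subst_monoid : monoid_morphism subst.
Proof.
split=> [|x y].
  have -> : (1 : B) = of_mpoly 1 by rewrite (rmorph1 (@of_mpoly m K)).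
  by rewrite subst_of_mpoly -mpolyC1 subst_poly_const !rmorph1.
apply: mseriesP => l; have lt := ltnSn (mdeg l).
rewrite [RHS](eq_uptoM (@subst_upto _ x) (@subst_upto _ y) lt).
rewrite -subst_poly_rmorphM -subst_of_mpoly.
apply: (subst_eq_upto _ lt); rewrite of_mpolyM; apply: eq_uptoM; exact: truncK.
Qed.
HB.instance Definition _ := GRing.isZmodMorphism.Build B B subst subst_zmod.
HB.instance Definition _ := GRing.isMonoidMorphism.Build B B subst subst_monoid.

Lemma subst_const c : subst (sconst m c) = sconst m (sK c).
Proof.
have -> : sconst m c = of_mpoly c%:MP.
  by apply: mseriesP => l; rewrite /= mcoeffC eq_sym; case: eqP; rewrite ?mulr1 ?mulr0.
by rewrite subst_of_mpoly subst_poly_const.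
Qed.

Lemma origin_vanish N f : vanish N f -> vanish N (phi0 f).
Proof.
elim: N f => [|N IH] f vf; first by [].
have [g [vg ->]] := vanish_split vf; rewrite rmorph_sum => l lN.
rewrite scoef_sum big1 // => i _; rewrite rmorphM.
have v1 : vanish 1 (phi0 (svar W i)) by apply/vanish1/(origin_var char_k W_witt phi0P).
exact: (vanishM v1 (IH _ (vg i))).
Qed.

Lemma subst_toK (f : A) : subst (toK f) = toK (phi0 f).
Proof.
apply: mseriesP => l; have lt := ltnSn (mdeg l).
pose P := trunc (mdeg l).+1 f.
have e1 : eq_upto (mdeg l).+1 (toK f) (\sum_(n : 'X_{1..m < (mdeg l).+1})
    sconst m (F (f n)) * smono K n).
  exact: (eq_upto_monomials (toK f)).
have e2 : eq_upto (mdeg l).+1 (phi0 f) (\sum_(n : 'X_{1..m < (mdeg l).+1})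
    sconst m (sigma (f n)) * T n).
  apply/eq_uptoP; under eq_bigr do rewrite -lift_term.
  rewrite -rmorph_sum -rmorphB; apply: origin_vanish; apply/eq_uptoP.
  exact: eq_upto_monomials.
rewrite (subst_eq_upto e1 lt) [RHS]/= (e2 l lt) rmorph_sum !scoef_sum rmorph_sum.
apply: eq_bigr => n _.
transitivity ((sconst m (F (sigma (f n))) * toK (T n)) l); last first.
  by rewrite !scoef_sconstM (rmorphM F).
congr (scoef _ l); rewrite rmorphM /= subst_const -of_mpolyX subst_of_mpoly subst_poly_X.
by rewrite fracmorF.
Qed.

(** The p-adic limits defining the pullback by phi0 are eventually constant. *)
Lemma series_pull_subst (x : B) : series_pull phi0 x = subst x.
Proof.
apply: mseriesP => l; apply: (series_pullE W_witt).
apply: (cvg_ext (D0 := (mdeg l).+1) _ (cvg_const _ (subst x l))) => D lD.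
pose P := \sum_(n : {ffun 'I_m -> 'I_D}) x (box n) *: 'X_[box n] : {mpoly K[m]}.
have -> : pull_sum phi0 x l D = subst_poly P l.
  rewrite /P subst_poly_sum scoef_sum; apply: eq_bigr => n _.
  by rewrite subst_poly_scale subst_poly_X scoef_sconstM.
rewrite (subst_upto x (ltnSn _)); apply: (@subst_poly_upto (mdeg l).+1) => // n nl.
rewrite mcoeff_trunc nl /P raddf_sum /=.
have [i|n' en] := @box_surj m D n.
  by apply: leq_trans lD; apply: leq_ltn_trans nl; apply: mdeg_ge.
rewrite (bigD1 n') //= mcoeffZ mcoeffX en eqxx mulr1 big1 ?addr0 // => n'' ne.
rewrite mcoeffZ mcoeffX; case: eqP => [e|_]; last by rewrite mulr0.
by case/eqP: ne; apply: box_inj; rewrite e en.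
Qed.

Lemma subst_sexp (x : B) : x 0%MM = 0 -> subst (sexp x) = sexp (subst x).
Proof.
move=> x0; have sx0 : subst x 0%MM = 0.
  have v1 : eq_upto 1 x 0 by apply/eq_uptoP; rewrite subr0; apply/vanish1.
  by rewrite (subst_eq_upto v1) ?mdeg0 // rmorph0 scoef0.
apply: mseriesP => l; have lt := ltnSn (mdeg l).
rewrite (subst_eq_upto (@sexp_upto m W _ x x0) lt) (@sexp_upto m W _ _ sx0 l lt).
rewrite /exp_trunc rmorph_sum; congr (scoef _ l); apply: eq_bigr => i _.
by rewrite rmorphM rmorphXn /= subst_const fmorphV rmorph_nat.
Qed.

(** The quotient p ^ n / n! lies in pW for n > 0. *)
Lemma sexp_p (v : A) : v 0%MM = 0 -> exists g, sexp (toK v *+ p) = toK (1 + p%:R * g).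
Proof.
move=> v0; have x0 : (toK v *+ p) 0%MM = 0 by rewrite scoefMn /= v0 tofrac0 mul0rn.
have /choice [y yP] : forall i, exists y : W, pdvd (0 < i)%N y /\ p%:R ^+ i = y * i`!%:R.
  by move=> i; have [y dy e] := pow_div_fact char_k W_witt i; exists y.
have term i : sconst m (i`!%:R^-1) * (toK v *+ p) ^+ i = toK (sconst m (y i) * v ^+ i).
  have f0 : i`!%:R != 0 :> K by apply: (natK_neq0 char_k W_witt); apply: fact_gt0.
  rewrite -[toK v *+ p]mulr_natl exprMn mulrA rmorphM /= smap_const rmorphXn; congr (_ * _).
  rewrite -(rmorph_nat (@sconst m K)) -rmorphXn -rmorphM; congr (sconst m _).
  have := congr1 F (yP i).2; rewrite (rmorphXn F) (rmorphM F) !(rmorph_nat F) => ->.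
  by rewrite mulrC mulfK.
pose G N := \sum_(i < N) sconst m (y i) * v ^+ i.
have GE l : sexp (toK v *+ p) l = F (G (mdeg l).+1 l).
  rewrite sexpE.
  rewrite -[RHS]/(toK (G (mdeg l).+1) l); congr (scoef _ l).
  by rewrite /exp_trunc rmorph_sum; apply: eq_bigr => i _; apply: term.
have y0 : y 0%N = 1 by have := (yP 0%N).2; rewrite expr0 fact0 mulr1.
have /choice [g gP] : forall l, exists g, G (mdeg l).+1 l - (1 : A) l = p%:R * g.
  move=> l; suff [g eg] : pdvd 1 (G (mdeg l).+1 l - (1 : A) l) by exists g; rewrite eg expr1.
  rewrite /G big_ord_recl y0 rmorph1 mul1r expr0 scoefD addrAC subrr add0r scoef_sum.
  by apply: pdvd_sum => i _; rewrite scoef_sconstM; apply: pdvdMr; apply: (yP _).1.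
exists (MSeries g); apply: mseriesP => l; rewrite GE -[RHS]/(F ((1 + p%:R * MSeries g) l)).
by rewrite scoefD scoef_natM /= -gP addrC subrK.
Qed.

(** Dwork's lemma: q = exp x satisfies subst q = q ^ p exp (p v), so that the
    coefficients of q are integral by induction on the degree.  The leading
    terms of phi0 (t i) are divisible by p; in degree 1 this gives no
    information, and integrality must be assumed. *)
Theorem dwork (x : B) (v : A) : x 0%MM = 0 -> v 0%MM = 0 ->
  subst x = x *+ p + toK v *+ p ->
  (forall l, mdeg l = 1%N -> exists w, x l = F w) ->
  exists q : A, sexp x = toK q.
Proof.
move=> x0 v0 sx int1; set Q := sexp x.
have [g gP] := sexp_p v0.
have pv0 : (toK v *+ p) 0%MM = 0 by rewrite scoefMn /= v0 tofrac0 mul0rn.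
have K0 := natK_neq0 char_k W_witt.
have Q0 : Q 0%MM = 1 by apply: sexp0.
have SQ : subst Q = Q ^+ p * toK (1 + p%:R * g).
  rewrite -gP /Q subst_sexp // sx; apply/esym/(sexp_unique K0).
  - by rewrite scoefD pv0 scoefMn x0 mul0rn addr0.
  - by rewrite scoef0M scoef0X [X in X ^+ _]sexp0 expr1n mul1r sexp0.
  move=> i; have := sderiv_sexp K0 i x0; have := sderiv_sexp K0 i pv0.
  move: (sexp (toK v *+ p)) (sexp x) => e2 e1 d2 d1.
  have ep : e1 ^+ p = e1 ^+ p.-1 * e1 by rewrite -exprSr prednK.
  rewrite sderivM sderivX d1 d2 sderivD [sderiv i (x *+ p)]sderivMn {}ep.
  by move: (e1 ^+ p.-1) (sderiv i x) (sderiv i _) => e4 e5 e6; ring.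
suff int d : forall l, mdeg l = d -> exists w, Q l = F w.
  have /choice [q qP] : forall l, exists w, Q l = F w by move=> l; apply: (int (mdeg l)).
  by exists (MSeries q); apply: mseriesP => l; rewrite qP.
elim/ltn_ind: d => d IH.
case: d IH => [|[|d']] IH.
- by move=> l /eqP; rewrite mdeg_eq0 => /eqP ->; exists 1; rewrite tofrac1.
- move=> l l1; have [w ew] := int1 l l1; exists w; rewrite -ew.
  rewrite /Q (@sexp_upto m W 2 x x0) ?l1 // /exp_trunc !big_ord_recl big_ord0 addr0.
  rewrite scoefD !scoef_sconstM scoef1 ifN ?mulr0 ?add0r; last by rewrite -mdeg_eq0 l1.
  by rewrite lift0 expr1 (_ : 1`! = 1%N) // invr1 mul1r.
set d := d'.+2 in IH *.
have /choice [w wP] : forall l, exists w, ((mdeg l < d)%N -> Q l = F w) /\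
    ((d <= mdeg l)%N -> w = 0).
  move=> l; case: (ltnP (mdeg l) d) => ld; last by exists 0; split=> //; rewrite ltnNge ld.
  by have [w ->] := IH _ ld l erefl; exists w.
pose Bw : A := MSeries w; pose R := Q - toK Bw.
have vR : vanish d R by move=> l ld; rewrite scoefB (wP l).1 // subrr.
have RQ l : mdeg l = d -> R l = Q l.
  by move=> ld; rewrite scoefB /= (wP l).2 ?ld // tofrac0 subr0.
have [Z powE] := expr_first_order (toK Bw) R p.
have QE : toK Bw + R = Q by rewrite addrC subrK.
rewrite QE in powE.
have [y phiB] := lift_frobenius phi0 Bw.
pose v' := y - Bw ^+ p * g.
(* In degree d the functional equation is linear in the terms of degree d of Q,
   up to integral terms. *)
have eqd l : mdeg l = d -> subst R l + F (p%:R * v' l) = p%:R * Q l.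
  move=> ld; rewrite -(RQ l ld).
  have lhs : subst Q l = F (phi0 Bw l) + subst R l.
    have -> : Q = toK Bw + R by rewrite addrC subrK.
    by rewrite rmorphD scoefD /= subst_toK.
  have rhs : (Q ^+ p * toK (1 + p%:R * g)) l =
      F ((Bw ^+ p * (1 + p%:R * g)) l) + p%:R * R l.
    have -> : Q ^+ p * toK (1 + p%:R * g) = toK (Bw ^+ p * (1 + p%:R * g))
        + (toK Bw ^+ p.-1 * toK (1 + p%:R * g)) *+ p * R + Z * toK (1 + p%:R * g) * R ^+ 2.
      rewrite powE [toK (Bw ^+ p * _)]rmorphM /= [toK (Bw ^+ p)]rmorphXn /= !mulrDl !mulrnAl.
      congr (_ + _ *+ _ + _); first by rewrite mulrAC.
      by rewrite [RHS]mulrC mulrA.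
    have vR2 := @vanishX _ _ d R 2 vR.
    rewrite !scoefD (vanishMl _ vR2) ?addr0; last by rewrite ld /d; lia.
    rewrite (lead_coefM _ vR ld) -[toK (_ * _) l]/(F _); congr (_ + _ * _).
    rewrite scoefMn scoef0M scoef0X -gP sexp0 mulr1 /=.
    by rewrite -(wP 0%MM).1 ?mdeg0 // Q0 expr1n.
  have := etrans (esym lhs) (etrans (congr1 (fun f : B => f l) SQ) rhs).
  rewrite phiB => e.
  have -> : p%:R * v' l = (Bw ^+ p + p%:R * y) l - (Bw ^+ p * (1 + p%:R * g)) l.
    rewrite -scoefB -scoef_natM; congr (scoef _ l); rewrite /v'.
    by move: (Bw ^+ p) => c; ring.
  by rewrite tofracB addrA [subst R l + _]addrC e addrAC subrr add0r.
(* On the terms of degree d, subst multiplies by p ^ d.  As d > 1, dividing the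
   equation by p leaves a factor p, which lowers the denominators. *)
have descent a : (forall n, mdeg n = d -> Kdvd 0 (p%:R ^+ a * Q n)) ->
    forall n, mdeg n = d -> Kdvd 0 (Q n).
  elim: a => [|a IHa] h; first by move=> n /h; rewrite mul1r.
  apply: IHa => l ld; apply: (Kdvd_nat_cancel char_k W_witt p_gt0).
  rewrite logn_prime // eqxx addn0 mulrCA -(eqd l ld) mulrDr; apply: KdvdD; last first.
    exists (p%:R ^+ a * (p%:R * v' l)); last by rewrite [RHS](rmorphM F) (rmorphXn F) (rmorph_nat F).
    by apply: pdvdMl; rewrite -[p%:R]expr1; apply: pdvd_pow.
  rewrite (subst_upto R (_ : (mdeg l < d.+1)%N)) ?ld // subst_poly_monomial scoef_sum mulr_sumr.
  apply: Kdvd_sum => n _; rewrite scoef_sconstM mcoeff_trunc.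
  case: ifP => nd; last by rewrite rmorph0 mul0r mulr0; apply: Kdvd0.
  case: (ltngtP (mdeg n) d) => nd'.
  - by rewrite vR // rmorph0 mul0r mulr0; apply: Kdvd0.
  - by move: nd; rewrite ltnS leqNgt nd'.
  rewrite (RQ n nd') -[toK (T n) l]/(F (T n l)).
  have [_ /(_ l)] := origin_lead_dvd n; rewrite nd' ld => /(_ erefl) [s ->].
  have -> : p%:R ^+ a * (sK (Q n) * F (p%:R ^+ d * s)) =
      sK (p%:R ^+ a.+1 * Q n) * F (p%:R ^+ d'.+1 * s).
    rewrite (rmorphM sK) (rmorphXn sK) (rmorph_nat sK) !tofracM !(rmorphXn F) !(rmorph_nat F).
    rewrite exprS exprS.
    by move: (sK _) (F s) => e1 e2; ring.
  apply: (@Kdvd_le _ _ (0 + d'.+1)) => //; apply: KdvdM.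
    exact/(Kdvd_fracmor W_witt sigma_frob)/h.
  by exists (p%:R ^+ d'.+1 * s) => //; apply: pdvd_pow.
have /choice [v1 v1P] := fun n : 'X_{1..m < d.+1} => Kdvd_denom W_witt (Q n).
move=> l ld; suff [w' _ ->] : Kdvd 0 (Q l) by exists w'.
apply: (descent (\sum_n v1 n)%N) => // n nd.
have nl : (mdeg n < d.+1)%N by rewrite nd.
rewrite (bigD1 (BMultinom nl)) //= addnC exprD -mulrA.
apply: (KdvdM (N := 0) (N' := 0)); last exact: (v1P (BMultinom nl)).
exists (p%:R ^+ (\sum_(i | i != BMultinom nl) v1 i)%N); first exact: pdvd_all.
by rewrite (rmorphXn F) (rmorph_nat F).
Qed.
End Substitution.

(** * The exponential of the primitives *)

Lemma sum_convolution (V : zmodType) (f : nat -> nat -> V) D :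
  \sum_(n < D) \sum_(i < n.+1) f i (n - i)%N = \sum_(i < D) \sum_(j < D - i) f i j.
Proof.
elim: D => [|D IH]; first by rewrite !big_ord0.
rewrite !big_ord_recr /= subSnn big_ord1 subnn IH addrA; congr (_ + _).
rewrite -big_split; apply: eq_bigr => i _ /=.
by rewrite subSn ?big_ord_recr // ltnW.
Qed.

Lemma binomial_term (L : fieldType) (b b1 b2 y z : L) : b1 != 0 -> b2 != 0 -> b != 0 ->
  y * z * b / (b * (b1 * b2)) = z / b1 * (y / b2).
Proof. by move=> h1 h2 h; field; rewrite h h1 h2. Qed.

Section Exponential.
Variables (p m : nat) (k : closedFieldType) (W : idomainType).
Variables (res : {rmorphism W -> k}).
Hypothesis (char_k : p \in [pchar k]) (W_witt : witt_ring p res).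
Local Notation K := {fraction W}.
Local Notation B := (mseries m K).
Local Notation F := (@tofrac W).
Local Notation pdvd := (pdvd p).
Local Notation cvg := (@padic_cvg p W).

(** For p odd, p ^ n / n! tends to 0, since the valuation of n! is at most
    n / (p - 1) and p - 1 > 1. *)
Lemma exp_const_cvg (w : W) : p <> 2%N ->
  exists2 q : W, pdvd 1 (q - 1) &
    cvg (fun D => \sum_(n < D) F (p%:R * w) ^+ n / n`!%:R) (F q).
Proof.
move=> p2; have p_pr := p_prime char_k.
have p_gt2 : (2 < p)%N by rewrite ltn_neqAle eq_sym prime_gt1 // andbT; apply/eqP.
have /choice [y yP] : forall n, exists y : W,
    [/\ pdvd (n - logn p n`!) y, pdvd (0 < n)%N y & p%:R ^+ n = y * n`!%:R].
  move=> n; have [y dy e] := pow_div_nat char_k W_witt (fact_gt0 n) (logn_fact_le char_k n).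
  have [y' dy' e'] := pow_div_fact char_k W_witt n.
  exists y; split=> //; suff -> : y = y' by [].
  by apply: (mulIf (natW_neq0 char_k W_witt (fact_gt0 n))); rewrite -e -e'.
pose a n := y n * w ^+ n.
have aE n : F (p%:R * w) ^+ n / n`!%:R = F (a n).
  rewrite -(rmorphXn F) exprMn; have [_ _ ->] := yP n.
  rewrite mulrAC (rmorphM F) (rmorph_nat F) mulfK //.
  exact: (natK_neq0 char_k W_witt (fact_gt0 n)).
have [N|q cq] := cvg_series W_witt (a := a).
  exists (2 * N)%N => n nN; apply: pdvdMr; have [dy _ _] := yP n; apply: pdvd_le dy.
  case: n nN => [|n] nN; first by move: nN; rewrite leqn0 muln_eq0 => /eqP ->.
  have := logn_fact_bound p_pr (ltn0Sn n); case: (p) p_gt2 => [|[|[|p']]] // _.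
  by move: nN (logn _ _) => nN v; rewrite !subSS subn0; nia.
have c' : cvg (fun D => \sum_(n < D) F (p%:R * w) ^+ n / n`!%:R) (F q).
  by apply: (cvg_ext (D0 := 0%N) _ cq) => D _; rewrite (rmorph_sum F); apply: eq_bigr => n _; rewrite aE.
exists q => //; apply: (cvg_pdvd (D0 := 1) (u := fun D => \sum_(n < D) a n - 1)); last first.
  rewrite tofracB tofrac1; apply: (cvg_ext (D0 := 0%N) _ (cvgB W_witt cq (cvg_const p 1))) => D _.
  by rewrite tofracB tofrac1.
case=> // D _; rewrite big_ord_recl {1}/a expr0 mulr1.
have -> : y 0%N = 1 by have [_ _] := yP 0%N; rewrite expr0 fact0 mulr1.
rewrite addrAC subrr add0r; apply: pdvd_sum => n _.
by apply: pdvdMr; have [_ dy _] := yP (lift ord0 n).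
Qed.

(** The exponential of a sum is a product; only finitely many powers of x
    contribute to a coefficient, so that only the factor exp c is a limit. *)
Lemma exp_translate (x : B) (c qc : K) : x 0%MM = 0 ->
  cvg (fun D => \sum_(n < D) c ^+ n / n`!%:R) qc ->
  forall l, cvg (fun D => \sum_(n < D) ((sconst m c + x) ^+ n) l / n`!%:R) (qc * sexp x l).
Proof.
move=> x0 cc l; have n0 n := natK_neq0 char_k W_witt (fact_gt0 n).
pose e D := \sum_(n < D) c ^+ n / n`!%:R.
pose g i := (x ^+ i) l / i`!%:R.
have -> : qc * sexp x l = \sum_(i < (mdeg l).+1) g i * qc.
  rewrite sexpE /exp_trunc scoef_sum mulr_sumr; apply: eq_bigr => i _.
  by rewrite scoef_sconstM mulrC /g [_ / _]mulrC.
apply: (cvg_ext (D0 := (mdeg l).+1) _ (cvg_sum _ (fun i : 'I_(mdeg l).+1 =>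
  cvgZ W_witt (g i) (cvg_shift i cc)))) => D lD.
pose f i j := g i * (c ^+ j / j`!%:R).
have -> : \sum_(n < D) ((sconst m c + x) ^+ n) l / n`!%:R =
    \sum_(n < D) \sum_(i < n.+1) f i (n - i)%N.
  apply: eq_bigr => n _; rewrite exprDn scoef_sum mulr_suml; apply: eq_bigr => i _.
  have le : (i <= n)%N by rewrite -ltnS.
  rewrite scoefMn -[_ *+ 'C(n, i)]mulr_natr -(rmorphXn (@sconst m K)) scoef_sconstM /f /g -(bin_fact le) !natrM.
  by apply: binomial_term; rewrite (natK_neq0 char_k W_witt) ?fact_gt0 ?bin_gt0.
rewrite sum_convolution -!(big_mkord xpredT (fun i => \sum_(j < D - i) f i j)).
rewrite (big_cat_nat (n := (mdeg l).+1)) // [X in _ = _ + X](_ : _ = 0) ?addr0.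
  by rewrite big_mkord; apply: eq_bigr => i _; rewrite mulr_sumr.
rewrite big_nat_cond big1 // => i /andP [/andP [ge _] _].
rewrite big1 // => j _; rewrite /f /g.
have v1 : vanish 1 x by apply/vanish1.
by rewrite (@vanishX _ _ 1 x i v1) ?mul1n // !mul0r.
Qed.
End Exponential.

Section PrimitiveExponential.
Variables (p r m : nat) (k : closedFieldType) (W : idomainType).
Variables (res : {rmorphism W -> k}) (sigma : {rmorphism W -> W}).
Hypothesis (char_k : p \in [pchar k]) (W_witt : witt_ring p res).
Hypothesis (sigma_frob : forall x, res (sigma x) = res x ^+ p).
Variable le_rm : (r <= m)%N.
Local Notation A := (mseries m W).
Local Notation K := {fraction W}.
Local Notation B := (mseries m K).
Local Notation F := (@tofrac W).
Local Notation toK := (smap (@tofrac W)).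
Local Notation t' := (@tlog m W r).
Variable phi0 : lifting p r m sigma.
Hypothesis phi0P : forall i, phi0 (t' i) = t' i ^+ p.
Local Opaque subst sexp.
Local Notation subst0 := (@subst p r m k W res sigma W_witt sigma_frob phi0).

Lemma series_log1 : series_log p (1 : A) = 0.
Proof.
apply: mseriesP => l; rewrite scoef0; apply: (padic_limE W_witt).
apply: (cvg_ext (D0 := 0%N) _ (cvg_const p 0)) => D _.
rewrite big_nat_cond big1 ?oppr0 // => n /andP [/andP [n_gt0 _] _].
by rewrite subrr expr0n gtn_eqF // mulr0n scoef0 tofrac0 mul0r.
Qed.

(** At phi0 the factors lfac are 1 and their logarithms vanish, so that the equation
    for tau, freed from its constant term, is the hypothesis of dwork.  In
    degree 1 integrality holds because the derivatives of tau are integral. *)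
Lemma log_primitive_exp eta (u : lifting p r m sigma -> A) tau : log_primitive le_rm eta u tau -> p <> 2%N ->
  exists q : A, exp_series_to p tau.2 q /\ exists w : W, q 0%MM - 1 = p%:R * w.
Proof.
case: tau => c x [_ eta_d [w /= xw] pull] p2.
have [_ eq0] := (log_pull_equation le_rm phi0 c x (u phi0)).1 (pull phi0).
have sx : subst0 x = x *+ p + toK (u phi0) *+ p.
  move: eq0; rewrite big1 ?add0r => [|l _]; last first.
    by rewrite (origin_lfac W_witt phi0P) series_log1 mulr0.
  rewrite (series_pull_subst char_k W_witt sigma_frob phi0P) -addrA -opprD.
  by move=> /eqP; rewrite subr_eq0 => /eqP.
pose c0 := F (p%:R * w); pose x' := x - sconst m c0.
pose v := u phi0 - sconst m (u phi0 0%MM).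
have x'0 : x' 0%MM = 0 by rewrite scoefB xw /= eqxx subrr.
have sx'0 : subst0 x' 0%MM = 0.
  have v1 : eq_upto 1 x' 0 by apply/eq_uptoP; rewrite subr0; apply/vanish1.
  by rewrite (subst_eq_upto char_k W_witt sigma_frob phi0P v1) ?mdeg0 // rmorph0 // scoef0.
have sx' : subst0 x' = x' *+ p + toK v *+ p.
  have e : subst0 x' = x *+ p + toK (u phi0) *+ p - sconst m (F (sigma (p%:R * w))).
    rewrite rmorphB //= sx; congr (_ - _).
    by rewrite (subst_const char_k W_witt sigma_frob phi0P) fracmorF.
  have e0 : F (sigma (p%:R * w)) = c0 *+ p + F (u phi0 0%MM) *+ p.
    apply/esym/eqP; rewrite -subr_eq0 -[X in _ == X]sx'0 e scoefB scoefD !scoefMn xw.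
    by rewrite [sconst m _ 0%MM]/= eqxx.
  rewrite e e0 /x' /v [toK (_ - _)]rmorphB /= smap_const !mulrnBl addrACA -opprD.
  by rewrite rmorphD !rmorphMn.
have int1 l : mdeg l = 1%N -> exists z, x' l = F z.
  move=> l1; have [y [dy _]] := primitive_integral W_witt eta_d.
  have /mdeg1P [i /eqP el] : mdeg l == 1%N by rewrite l1.
  exists (y i 0%MM); have := congr1 (fun f : B => f 0%MM) (dy i).
  rewrite /= add0m mnm0E mulr1n -el => <-.
  by rewrite -mdeg_eq0 l1 subr0.
have v0 : v 0%MM = 0 by rewrite scoefB /= eqxx subrr.
have [q' eq'] := dwork char_k phi0P x'0 v0 sx' int1.
have [qc [z ez] cqc] := exp_const_cvg char_k W_witt w p2.
exists (sconst m qc * q'); split=> [l|]; last first.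
  exists z; rewrite scoef_sconstM -[p%:R]expr1 -ez; congr (_ - _).
  have := congr1 (fun f : B => f 0%MM) eq'; rewrite /= sexp0 -(tofrac1 W) => /eqP.
  by rewrite tofrac_eq => /eqP <-; rewrite mulr1.
have -> : x = sconst m c0 + x' by rewrite addrC subrK.
have -> : F ((sconst m qc * q') l) = F qc * sexp x' l.
  by rewrite eq' scoef_sconstM (rmorphM F).
exact: (exp_translate char_k W_witt x'0 cqc).
Qed.
End PrimitiveExponential.

Theorem theorem2p2 (p r m : nat) (k : closedFieldType) (W : idomainType)
    (res : {rmorphism W -> k}) (sigma : {rmorphism W -> W})
    (char_k : p \in [pchar k]) (W_witt : witt_ring p res)
    (sigma_frob : forall x, res (sigma x) = res x ^+ p)
    (le_rm : (r <= m)%N)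
    (H : hodge p r m sigma) (H_ord : ordinary H) (H_wt1 : has_weight H 1)
    (U : set H) (U_unit_root : unit_root_part U)
    (g h : nat) (rank_U : has_rank U g) (rank_Fil1 : has_rank (Fil H 1) h) :
  (exists (a : 'I_g -> H) (b : 'I_h -> H)
      (eta : 'I_h -> 'I_g -> 'rV[mseries m W]_m)
      (u : lifting p r m sigma -> 'I_h -> 'I_g -> mseries m W),
      adapted_bases U a b eta u) /\
  (forall (a : 'I_g -> H) (b : 'I_h -> H)
      (eta : 'I_h -> 'I_g -> 'rV[mseries m W]_m)
      (u : lifting p r m sigma -> 'I_h -> 'I_g -> mseries m W),
      adapted_bases U a b eta u ->
    [/\ forall phi i j,
          form_pull phi (eta i j) = eta i j *+ p + sd r (u phi i j) *+ p,
        exists! tau : 'I_h -> 'I_g -> log_series r m W,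
          forall i j,
            log_primitive le_rm (eta i j) (fun phi => u phi i j) (tau i j) &
        p <> 2%N ->
        forall tau : 'I_h -> 'I_g -> log_series r m W,
          (forall i j,
            log_primitive le_rm (eta i j) (fun phi => u phi i j) (tau i j)) ->
          forall i j, exists q : mseries m W,
            exp_series_to p (tau i j).2 q /\
            exists w : W, q 0%MM - 1 = p%:R * w]).
Proof.
have [phi0 [n [s [P [sl [phi0P _ _ _ _]]]]]] := H_ord.
split; first exact: (adapted_bases_exist char_k W_witt).
move=> a b eta u ab; split; first exact: (adapted_form_pull U_unit_root ab).
- have primitive i j := log_primitive_exists char_k W_witt sigma_frob le_rm phi0P U_unit_root ab i j.
  have /choice [tau tauP] : forall i, exists tau_i : 'I_g -> log_series r m W, forall j,
      log_primitive le_rm (eta i j) (fun phi => u phi i j) (tau_i j).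
    by move=> i; have [tau_i tau_iP] := choice (primitive i); exists tau_i.
  exists tau; split=> // tau' tau'P; apply: funext => i; apply: funext => j.
  exact: (log_primitive_unique char_k W_witt sigma_frob phi0P (tauP i j) (tau'P i j)).
move=> p_odd tau tauP i j.
exact: (log_primitive_exp char_k W_witt sigma_frob phi0P (tauP i j) p_odd).
Qed.
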